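(* (Nominalization is sound when applied to proofs that check.) Let $SP$ be a Kaisar structured proof with $(H\leadsto H_\phi)\,SP:(\Gamma\vdash[\alpha]\phi)$ derivable, and suppose the nominalization $\mathrm{nom}(\alpha,SP)$ is defined. Then for every interpretation $I(\eta)$ of state names arising from a dynamic trace $\eta$, the sequent $\Gamma\vdash[\mathrm{nom}(\alpha,SP)]\phi$ is valid under $I(\eta)$ in the nominal hybrid logic $dL_h$; i.e. every state satisfying all assumptions of $\Gamma$ satisfies $[\mathrm{nom}(\alpha,SP)]\phi$ under $I(\eta)$.
   Context: **Differential dynamic logic (dL).** A state $\omega$ assigns a real to every variable; each variable $x$ has an associated differential variable $x'$. Terms: $\theta::=x\mid q\mid\theta+\theta\mid\theta-\theta\mid\theta\cdot\theta\mid\theta/\theta\mid\theta^q$ with $q\in\mathbb Q$. Formulas: $\phi::=\phi\wedge\phi\mid\phi\vee\phi\mid\neg\phi\mid\forall x\,\phi\mid\exists x\,\phi\mid[\alpha]\phi\mid\langle\alpha\rangle\phi\mid\theta\sim\theta$ with $\sim\,\in\{<,\le,=,\ge,>,\ne\}$ ($\rightarrow,\leftrightarrow$ derived). Programs: $\alpha::=x:=\theta\mid x:=*\mid\,?\phi\mid\alpha;\alpha\mid\alpha\cup\alpha\mid\alpha^*\mid\{x'=\theta\,\&\,Q\}$. First-order connectives are classical over $\mathbb R$. Programs denote relations on states: $x:=\theta$ assigns the value of $\theta$; $x:=*$ assigns an arbitrary real; $?\phi$ is the identity on states satisfying $\phi$; $;,\cup,{}^*$ are composition, union, reflexive transitive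 closure; $\{x'=\theta\,\&\,Q\}$ relates $\omega$ to $\varphi(T)$ for every $T\ge0$ such that the unique solution $\varphi$ of $x'=\theta$ with $\varphi(0)=\omega$ exists on $[0,T]$ and satisfies $Q$ on $[0,T]$. $[\alpha]\phi$ (resp. $\langle\alpha\rangle\phi$) holds in $\omega$ iff $\phi$ holds in all (resp. some) $\nu$ with $(\omega,\nu)\in[\![\alpha]\!]$. $FV$, $BV$ are free and bound variables ($BV(\{x'=\theta\,\&\,Q\})=\{x,x'\}$). $e[x\mapsto\theta]$ is capture-free substitution, required to be admissible wherever used. The differential $(\theta)'$ of a term has value $\sum_x\frac{\partial\theta}{\partial x}(\omega)\,\omega(x')$; terms are assumed defined where evaluated and differentiable where differentiated. For a formula $\psi$ built from comparisons by $\wedge,\vee$: $(\psi_1\wedge\psi_2)'\equiv(\psi_1\vee\psi_2)'\equiv(\psi_1)'\wedge(\psi_2)'$; $(\theta_1\sim\theta_2)'$ is $(\theta_1)'\ge(\theta_2)'$ for $\sim\in\{\ge,>\}$, $(\theta_1)'\le(\theta_2)'$ for $\sim\in\{\le,<\}$, $(\theta_1)'=(\theta_2)'$ for $\sim\in\{=,\ne\}$. Differential variables and differentials arise only through the differential-invariant rule below. $FOL_{\mathbb R}$ is the program-free fragment. **Nominal logic $dL_h$, dynamic traces, interpretations.** $dL_h$ extends dL with atomic formulas $t$ for state names $t$; an interpretation $I$ assigns a state $I(t)$ to each name, and $t$ is true in $\omega$ under $I$ iff $\omega=I(t)$; otherwise semantics is as in dL. A dynamic trace $\eta$ is a finite list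 of states, containing at least one state, possibly interleaved with state names; $t(\eta)$ is the longest prefix of $\eta$ preceding the name $t$, and $I(\eta)$ maps each $t$ occurring in $\eta$ to the last state of $t(\eta)$ (other names arbitrary). **Nominalization.** $\mathrm{nom}(\alpha,SP)$ is the $dL_h$ program defined (partially) by recursion: - $\mathrm{nom}(\alpha,\mathsf{state}\,t\,SP)=\,?t;\mathrm{nom}(\alpha,SP)$; $\mathrm{nom}(\alpha,\mathsf{show}\dots)=\alpha$; $\mathrm{nom}(\alpha\cup\beta,SP)=\alpha\cup\beta$; $\mathrm{nom}(\alpha^*,\mathsf{case}\dots)=\alpha^*$; $\mathrm{nom}(\alpha,\mathsf{focus}\,p\,SP)=\alpha$. - $\mathrm{nom}(\alpha,\mathsf{have}\,x:\phi\,SP_1\,SP_2)=\mathrm{nom}(\alpha,SP_2)$; $\mathrm{nom}(\alpha,\mathsf{let}\dots SP)=\mathrm{nom}(\alpha,\mathsf{note}\dots SP)=\mathrm{nom}(\alpha,SP)$ (both forms of let). - $\mathrm{nom}(?\phi;\alpha,\mathsf{assume}\,x:\phi\,SP)=\,?\phi;\mathrm{nom}(\alpha,SP)$; $\mathrm{nom}(x:=\theta;\alpha,\mathsf{assign}\,x:=\theta\,SP)=x:=\theta;\mathrm{nom}(\alpha,SP)$; $\mathrm{nom}(x:=*;\alpha,\mathsf{assign}\,x:=*\,SP)=x:=*;\mathrm{nom}(\alpha,SP)$; $\mathrm{nom}(\{x'=\theta\&Q\};\alpha,\mathsf{solve}\dots SP)=\{x'=\theta\&Q\};\mathrm{nom}(\alpha,SP)$.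 - $\mathrm{nom}(\alpha;\beta,\mathsf{after}\{SP_\psi\}\mathsf{have}\,\psi\,\mathsf{then}\{SP_\phi\})=\mathrm{nom}(\alpha,SP_\psi);\mathrm{nom}(\beta,SP_\phi)$. - For $\gamma=\alpha^*$ or $\gamma=\{x'=\theta\&Q\}$: $\mathrm{nom}(\gamma;\beta,\mathsf{inv}\dots IP)=\mathrm{nom}(\gamma;\beta,IP)$ and $\mathrm{nom}(\gamma;\beta,\mathsf{finally}\,SP)=\gamma;\mathrm{nom}(\beta,SP)$. - $\mathrm{nom}(\{x'=\theta\&Q\};\alpha,\mathsf{Ghost}\,y:=\theta_y;y'=\theta_{y'}\,IP)=\{x'=\theta\&Q\};\beta'$ where $\mathrm{nom}(\{x'=\theta,y'=\theta_{y'}\&Q\};\alpha,IP)=\{x'=\theta,y'=\theta_{y'}\&Q\};\beta'$. **Contexts and sequents in Kaisar.** A context $\Gamma$ is a finite list of named assumptions $x:\phi$ ($\phi$ a dL formula) and abbreviations $\mathtt{ident\_}\mapsto e$ or $t(\mathtt{ident\_})\mapsto e$. A succedent $\Delta$ is a finite list of (optionally named) dL formulas. Only assumption formulas count for the meaning of $\Gamma$. **Static traces.** $H$ is a finite list of records $\mathrm{sub}(x,\theta)$, $\mathrm{eq}(x,x_i,\theta)$, $\mathrm{any}(x,x_i)$, and state names $t$; $\epsilon$ is the empty trace. $\mathrm{now}_\epsilon(x)=x$; $\mathrm{now}_{H,\mathrm{sub}(x,\theta)}(x)=\theta$; $\mathrm{now}_{H,\mathrm{eq}(x,x_i,\theta)}(x)=\mathrm{now}_{H,\mathrm{any}(x,x_i)}(x)=x$;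 $\mathrm{now}_{H,hr}(x)=\mathrm{now}_H(x)$ for all other records. $t_{H,t}(x)=\mathrm{now}_H(x)$; $t_{H,\mathrm{eq}(x,x_i,\theta)}(x)=t_{H,\mathrm{any}(x,x_i)}(x)=t_H(x_i)$; $t_{H,hr}(x)=t_H(x)$ for all other records. Both extend homomorphically to terms. **Extended expressions.** Expressions in proofs may use abbreviations and nominal terms $t(\theta)$. The expansion $\bar e$ (relative to the current $\Gamma,H$) replaces each abbreviation by its expanded value, each $t(\theta)$ by $t_H(\theta)$, each other program variable $x$ by $\mathrm{now}_H(x)$, and is homomorphic otherwise. For functional abbreviations, $\mathrm{mob}_H(x,t)=\mathrm{now}_H(x)$, $\mathrm{mob}_H(t(\theta),t)=\mathrm{now}(\theta)$, homomorphic otherwise; in a use at state $s$, subterms marked $\mathrm{now}(\theta)$ are evaluated at $s$. **Patterns.** $p::=\mathtt{ident\_}\mid x\mid p(vars)\mid p(\neg vars)\mid\_\mid p\cup q\mid p\cap q\mid\neg p\mid\otimes(p,q)$ ($\otimes$ any dL operator). $\mathrm{match}_\Gamma(p,e)=\Gamma'$ is defined by: $\otimes(p,q)$ matches $\otimes(e,f)$ componentwise, threading the context; $\mathtt{ident\_}$ matches only $\Gamma(\mathtt{ident})$ if bound, otherwise matches any $e$ and adds $\mathtt{ident\_}\mapsto e$; a program variable $x$ matches its expansion; $\_$ matches anything; $p(vars)$ matches $e$ iff $vars\subseteq FV(e)$; $p(\neg vars)$ iff $vars\cap FV(e)=\emptyset$; $p\cup q$ uses $p$ if it matches and otherwise $q$;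 $p\cap q$ matches $p$ then $q$; $\neg p$ matches iff $p$ does not ($p$ binding no variables). Unless a rule states otherwise the result equals the input context. **Forward proofs.** $FP::=p\mid(FP\ FP)\mid(FP\ \theta)$, with a fixed library $\Sigma$ of valid first-order axiom schemata (instantiated with dL formulas). $p:(\Gamma\vdash\phi)$ if $\phi\in\Sigma\cup\Gamma$ and $p$ matches $\phi$; $FP_1\,FP_2:(\Gamma\vdash\psi)$ if $FP_1:(\Gamma\vdash\phi\rightarrow\psi)$ and $FP_2:(\Gamma\vdash\phi)$; $FP\,\theta:(\Gamma\vdash\phi[x\mapsto\bar\theta])$ if $FP:(\Gamma\vdash\forall x\,\phi)$. **Abstraction.** If $BV(\alpha)=\{x_1,\dots,x_n\}$ and $y_1,\dots,y_n$ are fresh, then $\Gamma^\alpha,\Delta^\alpha$ result from replacing each $x_i$ by $y_i$, and $H^\alpha=H,\mathrm{any}(x_1,y_1),\dots,\mathrm{any}(x_n,y_n)$. **Kaisar proof-checking judgment** $(H\leadsto H')\,SP:(\Gamma\vdash\Delta)$, the least relation closed under the following rules. Where traces are not displayed, all judgments start from $H$; a rule with a single (main) subproof returns that subproof's final trace, and $\mathsf{case}$ rules, $\mathsf{focus}$, $\mathsf{show}$ and invariant steps return $H$. *Structural.* - $\mathsf{have}\ x:\psi\ SP_1\ SP_2:(\Gamma\vdash\phi,\Delta)$ if $SP_1:(\Gamma\vdash\bar\psi)$ and $SP_2:(\Gamma,x:\bar\psi\vdash\phi,\Delta)$. - $\mathsf{note}\ x=FP\ SP:(\Gamma\vdash\phi,\Delta)$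 if $FP:(\Gamma\vdash\psi)$ and $SP:(\Gamma,x:\psi\vdash\phi,\Delta)$. - $\mathsf{let}\ p=e\ SP:(\Gamma\vdash\phi,\Delta)$ if $\mathrm{match}_\Gamma(p,\bar e)=\Gamma_1$ and $SP:(\Gamma_1\vdash\phi,\Delta)$. - $\mathsf{let}\ t(x\_)=e\ SP:(\Gamma\vdash\phi,\Delta)$ if $SP$ checks from trace $H,t_{now}$ for $(\Gamma,\,t(x\_)\mapsto\mathrm{mob}(e,t_{now})\vdash\phi,\Delta)$. - $\mathsf{state}\ t\ SP:(\Gamma\vdash\phi,\Delta)$ if $SP$ checks from trace $H,t$ for the same sequent. - $\mathsf{focus}\ p\ SP:(\Gamma\vdash\Delta_1,\phi,\Delta_2)$ if $p$ matches $\phi$ and $SP:(\Gamma\vdash\phi,\Delta_1,\Delta_2)$; $\mathsf{focus}\ p\ SP:(\Gamma_1,\phi,\Gamma_2\vdash\Delta)$ if $p$ matches $\phi$ and $SP:(\Gamma_1,\Gamma_2\vdash\neg\phi,\Delta)$. - $\mathsf{show}\ q\ \mathsf{using}\ ps\ FPs\ \mathsf{by}\ M$: let $F$ be the set of assumptions of $\Gamma$ matching some pattern in $ps$, together with all conclusions of the forward proofs $FPs$ (all of $\Gamma$ if the using clause is empty); let $\phi$ be the succedent formula selected by $q$, or by default the disjunction of the entire succedent. It checks if: $M=\mathsf{id}$ and $\phi\in F$; or $M=\mathbb R$ and $\bigwedge F\rightarrow\phi$ is valid in $FOL_{\mathbb R}$; or $M=\mathsf{auto}$ and the fixed method $\mathsf{auto}$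 (an arbitrary method accepting only valid sequents) accepts. *First-order.* - $\mathsf{assume}\ x:p\ SP$ proves $(\Gamma\vdash(\psi\rightarrow\phi),\Delta)$, and likewise $(\Gamma\vdash[?\psi]\phi,\Delta)$, if $\mathrm{match}_\Gamma(p,\psi)=\Gamma_\psi$ and $SP:(\Gamma_\psi,x:\psi\vdash\phi,\Delta)$. - $\mathsf{case}$ on $\phi\wedge\psi$: from $SP_1:(\Gamma_1\vdash\phi,\Delta)$ and $SP_2:(\Gamma_1\vdash\psi,\Delta)$ infer $(\Gamma\vdash\phi\wedge\psi,\Delta)$. On $\phi\vee\psi$: from $SP:(\Gamma\vdash\phi,\psi,\Delta)$ infer $(\Gamma\vdash\phi\vee\psi,\Delta)$. On $\phi\leftrightarrow\psi$: from $(\Gamma_1,x:\phi\vdash\psi,\Delta)$ and $(\Gamma_1,y:\psi\vdash\phi,\Delta)$ infer $(\Gamma\vdash\phi\leftrightarrow\psi,\Delta)$. ($\Gamma_1$ is the result of pattern-matching the goal formula; likewise in all rules below patterns only add abbreviations and are omitted.) *Boxes and diamonds.* Below $\langle\!\cdot\!]$ stands uniformly for $[\cdot]$ or $\langle\cdot\rangle$. - $\mathsf{assign}\ x:=\theta$ (sub): if $\phi[x\mapsto\bar\theta]$ is admissible, from trace $H,\mathrm{sub}(x,\bar\theta)$ and $(\Gamma\vdash\phi[x\mapsto\bar\theta],\Delta)$ infer $(\Gamma\vdash\langle\!x:=\bar\theta]\phi,\Delta)$. - $\mathsf{assign}\ x:=\theta$ (eq): for $x_i$ fresh, from trace $H,\mathrm{eq}(x,x_i,\bar\theta)$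 and $(\Gamma[x\mapsto x_i],\,x=\bar\theta[x\mapsto x_i]\vdash\phi,\Delta[x\mapsto x_i])$ infer $(\Gamma\vdash\langle\!x:=\bar\theta]\phi,\Delta)$. - $\mathsf{assign}\ x:=*$: for $x_i$ fresh, from trace $H,\mathrm{any}(x,x_i)$ and $(\Gamma[x\mapsto x_i]\vdash\phi,\Delta[x\mapsto x_i])$ infer $(\Gamma\vdash[x:=*]\phi,\Delta)$. With a witness $\theta$: from trace $H,\mathrm{sub}(x,\bar\theta)$ and $(\Gamma\vdash\phi[x\mapsto\bar\theta],\Delta)$ infer $(\Gamma\vdash\langle x:=*\rangle\phi,\Delta)$. - $\mathsf{case}$: from $(\Gamma\vdash[\alpha]\phi,\Delta)$ and $(\Gamma\vdash[\beta]\phi,\Delta)$ infer $(\Gamma\vdash[\alpha\cup\beta]\phi,\Delta)$; from $(\Gamma\vdash\langle\alpha\rangle\phi,\langle\beta\rangle\phi,\Delta)$ infer $(\Gamma\vdash\langle\alpha\cup\beta\rangle\phi,\Delta)$; from $(\Gamma\vdash[\alpha]\phi,\Delta)$ and $(\Gamma\vdash[\alpha]\psi,\Delta)$ infer $(\Gamma\vdash[\alpha](\phi\wedge\psi),\Delta)$; from $(\Gamma\vdash\phi,\Delta)$ and $(\Gamma\vdash[\alpha][\alpha^*]\phi,\Delta)$ infer $(\Gamma\vdash[\alpha^*]\phi,\Delta)$; from $(\Gamma\vdash\phi,\langle\alpha\rangle\langle\alpha^*\rangle\phi,\Delta)$ infer $(\Gamma\vdash\langle\alpha^*\rangle\phi,\Delta)$.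 - $\mathsf{after}\{SP_\psi\}\,\mathsf{have}\ \psi\ \mathsf{then}\{SP_\phi\}$: from $(H\leadsto H_\psi)SP_\psi:(\Gamma\vdash\langle\!\alpha]\bar\psi,\Delta)$ and $(H_\psi^\alpha\leadsto H_\phi)SP_\phi:(\Gamma^\alpha,\bar\psi\vdash\phi,\Delta^\alpha)$ infer $(\Gamma\vdash\langle\!\alpha]\phi,\Delta)$. - $\mathsf{solve}$: let $y(t)$ be a term with $y(0)=x$, $y'(t)=\theta(y(t))$, and $Q(s)$ denote $Q[x\mapsto y(s)]$. For fresh $t$, from trace $H,\mathrm{sub}(x,y(t))$ and $(\Gamma,\ t\ge0,\ \forall s\in[0,t]\,Q(s)\vdash\phi[x\mapsto y(t)],\Delta)$ infer $(\Gamma\vdash[\{x'=\theta\,\&\,Q\}]\phi,\Delta)$. For a term $\theta_t$, from $(\Gamma\vdash\theta_t\ge0\wedge\forall s\in[0,\theta_t]\,Q(s),\Delta)$ and, with trace $H,\mathrm{sub}(x,y(\bar\theta_t))$, $(\Gamma\vdash\phi[x\mapsto y(\bar\theta_t)],\Delta)$ infer $(\Gamma\vdash\langle\{x'=\theta\,\&\,Q\}\rangle\phi,\Delta)$. *Invariants and variants.* Invariant proofs $IP$ (also structured proofs) are $\mathsf{inv}\,x:\psi\{\mathsf{Pre}\Rightarrow SP\mid\mathsf{Ind}\Rightarrow SP\}\,IP$, $\mathsf{Ghost}\ y:=\theta_y;y'=\theta_{y'}\ IP$, and $\mathsf{finally}\,SP$. $Js$ is a list of formulas, initially empty, and $[\alpha]Js$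 means $[\alpha]J$ for each $J$ in $Js$. - Loop $\mathsf{inv}$: from $(\Gamma,Js\vdash\bar\psi,\Delta)$; $(\Gamma^\alpha,Js,\bar\psi\vdash[\alpha]\bar\psi,\Delta^\alpha)$ with initial trace $H^\alpha$; and $IP:(\Gamma,[\alpha^*]Js,x:[\alpha^*]\bar\psi\vdash[\alpha^*]\phi,\Delta)$, infer $(\Gamma,[\alpha^*]Js\vdash[\alpha^*]\phi,\Delta)$. - Loop $\mathsf{finally}$: from $(\Gamma^\alpha,Js\vdash\phi,\Delta^\alpha)$ with initial trace $H^\alpha$ infer $(\Gamma,[\alpha^*]Js\vdash[\alpha^*]\phi,\Delta)$. - ODE $\mathsf{inv}$, $\alpha=\{x'=\theta\,\&\,Q\}$: from $(\Gamma,Js\vdash\bar\psi,\Delta)$; $(\Gamma^\alpha,Js,Q\vdash[x':=\theta](\bar\psi)',\Delta^\alpha)$ with initial trace $H^\alpha$; and $IP:(\Gamma,[\alpha]Js,x:[\alpha]\bar\psi\vdash[\alpha]\phi,\Delta)$, infer $(\Gamma,[\alpha]Js\vdash[\alpha]\phi,\Delta)$. - ODE $\mathsf{finally}$: from $(\Gamma^\alpha,Js,Q\vdash\phi,\Delta^\alpha)$ with initial trace $H^\alpha$ infer $(\Gamma,[\alpha]Js\vdash[\alpha]\phi,\Delta)$. - $\mathsf{Ghost}$: for $y$ fresh and $\bar\theta_{y'}$ linear in $y$, from $IP:(\Gamma,y=\bar\theta_y\vdash[\{x'=\theta,y'=\bar\theta_{y'}\,\&\,Q\}]\phi,\Delta)$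 infer $(\Gamma\vdash[\{x'=\theta\,\&\,Q\}]\phi,\Delta)$ (invariants $Js$ being retained). - Loop variant, $v$ fresh: from $(\Gamma\vdash\exists v\,\bar\psi(v),\Delta)$; $(\Gamma^\alpha,\bar\psi(v),v>0\vdash\langle\alpha\rangle\bar\psi(v-1),\Delta^\alpha)$ with initial trace $H^\alpha$; and $(\Gamma^\alpha,\bar\psi(v),v\le0\vdash\langle\alpha^*\rangle\phi)$, infer $(\Gamma\vdash\langle\alpha^*\rangle\phi,\Delta)$. *Implicit conversions* ($A\Leftarrow B$ means: if $SP:(\Gamma\vdash B,\Delta)$ then $SP:(\Gamma\vdash A,\Delta)$, traces unchanged): $[\alpha;\beta]\phi\Leftarrow[\alpha][\beta]\phi$; $\langle\alpha;\beta\rangle\phi\Leftarrow\langle\alpha\rangle\langle\beta\rangle\phi$; $\forall x\,\phi\Leftarrow[x:=*]\phi$; $\exists x\,\phi\Leftarrow\langle x:=*\rangle\phi$; $\phi\rightarrow\psi\Leftarrow[?\phi]\psi$; $\langle?\phi\rangle\psi\Leftarrow\phi\wedge\psi$; $\neg\forall x\phi\Leftarrow\exists x\neg\phi$; $\neg\exists x\phi\Leftarrow\forall x\neg\phi$; $\neg\neg\phi\Leftarrow\phi$; $\neg(\phi\wedge\psi)\Leftarrow\neg\phi\vee\neg\psi$; $\neg(\phi\vee\psi)\Leftarrow\neg\phi\wedge\neg\psi$; $\neg(\phi\rightarrow\psi)\Leftarrow\phi\wedge\neg\psi$; $\neg(\phi\leftrightarrow\psi)\Leftarrow(\phi\wedge\neg\psi)\vee(\neg\phi\wedge\psi)$;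 $\neg[\alpha]\psi\Leftarrow\langle\alpha\rangle\neg\psi$; $\neg\langle\alpha\rangle\psi\Leftarrow[\alpha]\neg\psi$. *)

(* Defs.v *)
From Stdlib Require Import Reals QArith Qreals List Relations Bool.
From Coquelicot Require Import Coquelicot.
Import ListNotations.
Open Scope R_scope.

(** * Syntax *)

(** [V n] is a program variable x and [D n] its differential variable x'. *)
Inductive var : Set := V (n : nat) | D (n : nat).

Definition name := nat.    (* names of assumptions *)
Definition ident := nat.   (* identifiers of abbreviations, written ident_ *)
Definition sname := nat.   (* state names *)

Definition var_eq_dec (x y : var) : {x = y} + {x <> y}.
Proof. decide equality; apply PeanoNat.Nat.eq_dec. Defined.

Definition mem (x : var) (l : list var) : bool :=
  if in_dec var_eq_dec x l then true else false.

Definition disjoint (l1 l2 : list var) : bool :=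
  forallb (fun x => negb (mem x l2)) l1.

(** Terms with leaves in [L].  The terms of dL are those with variables as
    leaves; other leaves occur in the bodies of functional abbreviations. *)
Inductive gterm (L : Type) : Type :=
| TLeaf (l : L)
| TConst (q : Q)
| TPlus (a b : gterm L)
| TMinus (a b : gterm L)
| TTimes (a b : gterm L)
| TDiv (a b : gterm L)
| TPow (a : gterm L) (q : Q)
| TDiff (a : gterm L).     (* the differential (a)' *)
Arguments TLeaf {L} l.
Arguments TConst {L} q.
Arguments TPlus {L} a b.
Arguments TMinus {L} a b.
Arguments TTimes {L} a b.
Arguments TDiv {L} a b.
Arguments TPow {L} a q.
Arguments TDiff {L} a.

Definition term := gterm var.
Definition TVar (x : var) : term := TLeaf x.

Inductive cmp : Set := LT | LE | EQ | GE | GT | NE.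

(** Formulas and programs over terms [T], with additional atomic formulas [A]
    and additional atomic programs [P].  [PODE [(x1,e1);...] q] is the system
    {x1'=e1, ... & q}; [PRand x] is x:=*. *)
Inductive fml (T A P : Type) : Type :=
| FAtom (a : A)
| FCmp (c : cmp) (s t : T)
| FAnd (f g : fml T A P)
| FOr (f g : fml T A P)
| FNot (f : fml T A P)
| FAll (x : var) (f : fml T A P)
| FEx (x : var) (f : fml T A P)
| FBox (a : prog T A P) (f : fml T A P)
| FDia (a : prog T A P) (f : fml T A P)
with prog (T A P : Type) : Type :=
| PAtom (p : P)
| PAssign (x : var) (t : T)
| PRand (x : var)
| PTest (f : fml T A P)
| PSeq (a b : prog T A P)
| PChoice (a b : prog T A P)
| PLoop (a : prog T A P)
| PODE (ode : list (nat * T)) (q : fml T A P).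
Arguments FAtom {T A P} a.
Arguments FCmp {T A P} c s t.
Arguments FAnd {T A P} f g.
Arguments FOr {T A P} f g.
Arguments FNot {T A P} f.
Arguments FAll {T A P} x f.
Arguments FEx {T A P} x f.
Arguments FBox {T A P} a f.
Arguments FDia {T A P} a f.
Arguments PAtom {T A P} p.
Arguments PAssign {T A P} x t.
Arguments PRand {T A P} x.
Arguments PTest {T A P} f.
Arguments PSeq {T A P} a b.
Arguments PChoice {T A P} a b.
Arguments PLoop {T A P} a.
Arguments PODE {T A P} ode q.

Definition FImp {T A P} (f g : fml T A P) : fml T A P := FOr (FNot f) g.
Definition FIff {T A P} (f g : fml T A P) : fml T A P :=
  FAnd (FImp f g) (FImp g f).

(** dL, and the nominal logic dL_h whose extra atoms are state names. *)
Definition dfml := fml term Empty_set Empty_set.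
Definition dprog := prog term Empty_set Empty_set.
Definition hfml := fml term sname Empty_set.
Definition hprog := prog term sname Empty_set.

Fixpoint fmap {T A T' A'} (f : T -> T') (h : A -> A')
    (p : fml T A Empty_set) : fml T' A' Empty_set :=
  match p with
  | FAtom a => FAtom (h a)
  | FCmp c s t => FCmp c (f s) (f t)
  | FAnd p q => FAnd (fmap f h p) (fmap f h q)
  | FOr p q => FOr (fmap f h p) (fmap f h q)
  | FNot p => FNot (fmap f h p)
  | FAll x p => FAll x (fmap f h p)
  | FEx x p => FEx x (fmap f h p)
  | FBox a p => FBox (pmap f h a) (fmap f h p)
  | FDia a p => FDia (pmap f h a) (fmap f h p)
  end
with pmap {T A T' A'} (f : T -> T') (h : A -> A')
    (a : prog T A Empty_set) : prog T' A' Empty_set :=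
  match a with
  | PAtom e => match e with end
  | PAssign x t => PAssign x (f t)
  | PRand x => PRand x
  | PTest p => PTest (fmap f h p)
  | PSeq a b => PSeq (pmap f h a) (pmap f h b)
  | PChoice a b => PChoice (pmap f h a) (pmap f h b)
  | PLoop a => PLoop (pmap f h a)
  | PODE ode q => PODE (map (fun xe => (fst xe, f (snd xe))) ode) (fmap f h q)
  end.

Definition absurd_atom {X : Type} (e : Empty_set) : X := match e with end.

(** dL as a sublanguage of dL_h. *)
Definition flift : dfml -> hfml := fmap (fun t => t) absurd_atom.
Definition plift : dprog -> hprog := pmap (fun t => t) absurd_atom.

(** * Free and bound variables *)

Fixpoint bases (l : list var) : list nat :=
  match l with
  | [] => []
  | V n :: l => n :: bases l
  | D _ :: l => bases l
  end.

Fixpoint tfv (t : term) : list var :=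
  match t with
  | TLeaf x => [x]
  | TConst _ => []
  | TPlus a b | TMinus a b | TTimes a b | TDiv a b => tfv a ++ tfv b
  | TPow a _ => tfv a
  | TDiff a => tfv a ++ map D (bases (tfv a))
  end.

Definition odevars {T} (ode : list (nat * T)) : list var :=
  map (fun xe => V (fst xe)) ode.
Definition odediffs {T} (ode : list (nat * T)) : list var :=
  map (fun xe => D (fst xe)) ode.

(** Bound variables, given those of the atomic programs. *)
Fixpoint bv_gen {T A P} (h : P -> list var) (a : prog T A P) : list var :=
  match a with
  | PAtom p => h p
  | PAssign x _ | PRand x => [x]
  | PTest _ => []
  | PSeq a b | PChoice a b => bv_gen h a ++ bv_gen h b
  | PLoop a => bv_gen h a
  | PODE ode _ => odevars ode ++ odediffs ode
  end.

(** Variables bound on every path.  An ODE determines the final value of its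
    variables x; x' is bound by it, but see [psem]. *)
Fixpoint mbv_gen {T A P} (h : P -> list var) (a : prog T A P) : list var :=
  match a with
  | PAtom p => h p
  | PAssign x _ | PRand x => [x]
  | PTest _ | PLoop _ => []
  | PSeq a b => mbv_gen h a ++ mbv_gen h b
  | PChoice a b => filter (fun x => mem x (mbv_gen h b)) (mbv_gen h a)
  | PODE ode _ => odevars ode
  end.

Definition bv {T A} : prog T A Empty_set -> list var := bv_gen absurd_atom.
Definition mbv {T A} : prog T A Empty_set -> list var := mbv_gen absurd_atom.

Definition minus (l1 l2 : list var) : list var :=
  filter (fun x => negb (mem x l2)) l1.

Fixpoint ffv (p : dfml) : list var :=
  match p with
  | FAtom e => match e with end
  | FCmp _ s t => tfv s ++ tfv t
  | FAnd p q | FOr p q => ffv p ++ ffv q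
  | FNot p => ffv p
  | FAll x p | FEx x p => minus (ffv p) [x]
  | FBox a p | FDia a p => pfv a ++ minus (ffv p) (mbv a)
  end
with pfv (a : dprog) : list var :=
  match a with
  | PAtom e => match e with end
  | PAssign _ t => tfv t
  | PRand _ => []
  | PTest p => ffv p
  | PSeq a b => pfv a ++ minus (pfv b) (mbv a)
  | PChoice a b => pfv a ++ pfv b
  | PLoop a => pfv a
  | PODE ode q =>
      odevars ode ++ flat_map (fun xe => tfv (snd xe)) ode ++ ffv q
  end.

(** All variables that occur, free or bound. *)
Section AllVars.
  Variable T : Type.
  Variable tv : T -> list var.
  Fixpoint fvars (p : fml T Empty_set Empty_set) : list var :=
    match p with
    | FAtom e => match e with end
    | FCmp _ s t => tv s ++ tv t
    | FAnd p q | FOr p q => fvars p ++ fvars q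
    | FNot p => fvars p
    | FAll x p | FEx x p => x :: fvars p
    | FBox a p | FDia a p => pvars a ++ fvars p
    end
  with pvars (a : prog T Empty_set Empty_set) : list var :=
    match a with
    | PAtom e => match e with end
    | PAssign x t => x :: tv t
    | PRand x => [x]
    | PTest p => fvars p
    | PSeq a b | PChoice a b => pvars a ++ pvars b
    | PLoop a => pvars a
    | PODE ode q =>
        odevars ode ++ odediffs ode ++ flat_map (fun xe => tv (snd xe)) ode
          ++ fvars q
    end.
End AllVars.
Arguments fvars {T} tv p.
Arguments pvars {T} tv a.

(** * Semantics *)

Definition state := var -> R.

Definition upd (w : state) (x : var) (r : R) : state :=
  fun z => if var_eq_dec z x then r else w z.

Definition integral (q : Q) : bool := Pos.eqb (Qden (Qred q)) 1.

Definition rpow (r : R) (q : Q) : R :=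
  if integral q then powerRZ r (Qnum (Qred q))
  else if Rlt_dec 0 r then Rpower r (Q2R q) else 0.

(** Values are total; where a term is not [tdef] or not differentiable they are
    arbitrary.  The last case is the sum of (d a / d x)(w) * w(x') over the free
    variables x of a. *)
Fixpoint teval (t : term) (w : state) : R :=
  match t with
  | TLeaf x => w x
  | TConst q => Q2R q
  | TPlus a b => teval a w + teval b w
  | TMinus a b => teval a w - teval b w
  | TTimes a b => teval a w * teval b w
  | TDiv a b => teval a w / teval b w
  | TPow a q => rpow (teval a w) q
  | TDiff a =>
      fold_right
        (fun n acc =>
           Derive (fun r => teval a (upd w (V n) r)) (w (V n)) * w (D n) + acc)
        0 (nodup PeanoNat.Nat.eq_dec (bases (tfv a)))
  end.

Definition sum_over (l : list var) (f : var -> R) : R :=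
  fold_right (fun x acc => f x + acc) 0 l.

(** Frechet differentiability in the free variables of the term. *)
Definition frechet (t : term) (w : state) : Prop :=
  let xs := nodup var_eq_dec (tfv t) in
  exists g : var -> R, forall eps, 0 < eps -> exists del, 0 < del /\
    forall w' : state,
      (forall x, In x xs -> Rabs (w' x - w x) < del) ->
      Rabs (teval t w' - teval t w - sum_over xs (fun x => g x * (w' x - w x)))
        <= eps * sum_over xs (fun x => Rabs (w' x - w x)).

(** Definedness of a term in a state.  A non-integral power is defined at
    positive arguments, and at 0 if the exponent is positive. *)
Fixpoint tdef (t : term) (w : state) : Prop :=
  match t with
  | TLeaf _ | TConst _ => True
  | TPlus a b | TMinus a b | TTimes a b => tdef a w /\ tdef b w
  | TDiv a b => tdef a w /\ tdef b w /\ teval b w <> 0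
  | TPow a q =>
      tdef a w /\
      if integral q then (0 <= Qnum q)%Z \/ teval a w <> 0
      else 0 < teval a w \/ (teval a w = 0 /\ (0 < Qnum q)%Z)
  | TDiff a => tdef a w /\ frechet a w
  end.

Definition differentiable (t : term) (w : state) : Prop :=
  tdef t w /\ frechet t w.

Definition csem (c : cmp) (a b : R) : Prop :=
  match c with
  | LT => a < b | LE => a <= b | EQ => a = b
  | GE => a >= b | GT => a > b | NE => a <> b
  end.

(** [f] solves the system on [0,T] from [w]; derivatives at the end points are
    one-sided, and everything but the variables of the system is constant. *)
Definition ode_sol (ode : list (nat * term)) (w : state) (T : R)
    (f : R -> state) : Prop :=
  f 0 = w /\
  forall t, 0 <= t <= T ->
    (forall x e, In (x, e) ode ->
       D_in (fun s => f s (V x)) (fun s => teval e (f s))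
            (fun s => 0 <= s <= T) t) /\
    (forall z, ~ In z (odevars ode) -> f t z = w z).

(** [f] is the unique solution on [0,T]. *)
Definition ode_flow (ode : list (nat * term)) (w : state) (T : R)
    (f : R -> state) : Prop :=
  0 <= T /\ ode_sol ode w T f /\
  forall S g, 0 <= S <= T -> ode_sol ode w S g ->
    forall t, 0 <= t <= S -> g t = f t.

Section Semantics.
  Variable N : Type.
  Variable I : N -> state.
  Fixpoint fsem (p : fml term N Empty_set) (w : state) : Prop :=
    match p with
    | FAtom t => w = I t
    | FCmp c s t => csem c (teval s w) (teval t w)
    | FAnd p q => fsem p w /\ fsem q w
    | FOr p q => fsem p w \/ fsem q w
    | FNot p => ~ fsem p w
    | FAll x p => forall r, fsem p (upd w x r)
    | FEx x p => exists r, fsem p (upd w x r)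
    | FBox a p => forall v, psem a w v -> fsem p v
    | FDia a p => exists v, psem a w v /\ fsem p v
    end
  with psem (a : prog term N Empty_set) (w v : state) : Prop :=
    match a with
    | PAtom e => match e with end
    | PAssign x t => v = upd w x (teval t w)
    | PRand x => exists r, v = upd w x r
    | PTest p => v = w /\ fsem p w
    | PSeq a b => exists u, psem a w u /\ psem b u v
    | PChoice a b => psem a w v \/ psem b w v
    | PLoop a => clos_refl_trans state (psem a) w v
    | PODE ode q =>
        (* x' keeps its value: the solution f satisfies f(0) = w exactly *)
        exists T f, ode_flow ode w T f /\
          (forall t, 0 <= t <= T -> fsem q (f t)) /\ v = f T
    end.
End Semantics.
Arguments fsem {N} I p w.
Arguments psem {N} I a w v.

Definition dsem : dfml -> state -> Prop := fsem absurd_atom.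
Definition drun : dprog -> state -> state -> Prop := psem absurd_atom.
Definition dvalid (p : dfml) : Prop := forall w, dsem p w.

Fixpoint fol (p : dfml) : Prop :=
  match p with
  | FAtom _ | FCmp _ _ _ => True
  | FAnd p q | FOr p q => fol p /\ fol q
  | FNot p | FAll _ p | FEx _ p => fol p
  | FBox _ _ | FDia _ _ => False
  end.

(** * Dynamic traces and interpretations *)

Inductive devent := DState (w : state) | DName (t : sname).
Definition dtrace := list devent.     (* in chronological order *)

Definition dtrace_ok (eta : dtrace) : Prop := exists w, In (DState w) eta.

Fixpoint last_state (eta : dtrace) : option state :=
  match eta with
  | [] => None
  | DState w :: eta =>
      match last_state eta with Some v => Some v | None => Some w end
  | DName _ :: eta => last_state eta
  end.

(** [pre] is t(eta), the longest prefix of [eta] that is followed by t. *)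
Definition prefix_at (eta : dtrace) (t : sname) (pre : dtrace) : Prop :=
  exists post, eta = pre ++ DName t :: post /\ ~ In (DName t) post.

Definition interp_of (eta : dtrace) (I : sname -> state) : Prop :=
  forall t pre w, prefix_at eta t pre -> last_state pre = Some w -> I t = w.

(** * Homomorphic maps and capture-free substitution *)

Definition obind {X Y} (o : option X) (f : X -> option Y) : option Y :=
  match o with Some x => f x | None => None end.
Notation "x <- a ;; b" := (obind a (fun x => b))
  (at level 61, a at next level, right associativity).

Fixpoint omap {X Y} (f : X -> option Y) (l : list X) : option (list Y) :=
  match l with
  | [] => Some []
  | x :: l => y <- f x;; l' <- omap f l;; Some (y :: l')
  end.

Fixpoint tmap {L L'} (f : L -> L') (t : gterm L) : gterm L' :=
  match t with
  | TLeaf l => TLeaf (f l)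
  | TConst q => TConst q
  | TPlus a b => TPlus (tmap f a) (tmap f b)
  | TMinus a b => TMinus (tmap f a) (tmap f b)
  | TTimes a b => TTimes (tmap f a) (tmap f b)
  | TDiv a b => TDiv (tmap f a) (tmap f b)
  | TPow a q => TPow (tmap f a) q
  | TDiff a => TDiff (tmap f a)
  end.

Fixpoint otmap {L L'} (f : L -> option L') (t : gterm L) : option (gterm L') :=
  match t with
  | TLeaf l => l' <- f l;; Some (TLeaf l')
  | TConst q => Some (TConst q)
  | TPlus a b => a' <- otmap f a;; b' <- otmap f b;; Some (TPlus a' b')
  | TMinus a b => a' <- otmap f a;; b' <- otmap f b;; Some (TMinus a' b')
  | TTimes a b => a' <- otmap f a;; b' <- otmap f b;; Some (TTimes a' b')
  | TDiv a b => a' <- otmap f a;; b' <- otmap f b;; Some (TDiv a' b')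
  | TPow a q => a' <- otmap f a;; Some (TPow a' q)
  | TDiff a => a' <- otmap f a;; Some (TDiff a')
  end.

(** Replaces leaves by terms.  Below a differential only leaves accepted by
    [g] may occur. *)
Fixpoint tbind {L L'} (f : L -> option (gterm L')) (g : L -> option L')
    (t : gterm L) : option (gterm L') :=
  match t with
  | TLeaf l => f l
  | TConst q => Some (TConst q)
  | TPlus a b => a' <- tbind f g a;; b' <- tbind f g b;; Some (TPlus a' b')
  | TMinus a b => a' <- tbind f g a;; b' <- tbind f g b;; Some (TMinus a' b')
  | TTimes a b => a' <- tbind f g a;; b' <- tbind f g b;; Some (TTimes a' b')
  | TDiv a b => a' <- tbind f g a;; b' <- tbind f g b;; Some (TDiv a' b')
  | TPow a q => a' <- tbind f g a;; Some (TPow a' q)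
  | TDiff a => a' <- otmap g a;; Some (TDiff a')
  end.

(** Traversal of formulas and programs.  The lists [B] and [M] contain the
    variables that may, resp. must, have been bound on the way to the current
    position.  [lt] translates terms, [la] and [lp] atoms; [lo] decides whether
    an ODE may start from the current value of a variable. *)
Section Traversal.
  Variables T1 A1 P1 T2 : Type.
  Variable lt : list var -> list var -> T1 -> option T2.
  Variable lo : list var -> list var -> var -> bool.
  Variable la : list var -> A1 -> option (fml T2 Empty_set Empty_set).
  Variable lp : list var -> P1 -> option (prog T2 Empty_set Empty_set).
  Variables hb hm : P1 -> list var.   (* bound variables of atomic programs *)

  Fixpoint ftrav (B M : list var) (p : fml T1 A1 P1)
      : option (fml T2 Empty_set Empty_set) :=
    match p with
    | FAtom a => la B a
    | FCmp c s t => s' <- lt B M s;; t' <- lt B M t;; Some (FCmp c s' t')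
    | FAnd p q => p' <- ftrav B M p;; q' <- ftrav B M q;; Some (FAnd p' q')
    | FOr p q => p' <- ftrav B M p;; q' <- ftrav B M q;; Some (FOr p' q')
    | FNot p => p' <- ftrav B M p;; Some (FNot p')
    | FAll x p => p' <- ftrav (x :: B) (x :: M) p;; Some (FAll x p')
    | FEx x p => p' <- ftrav (x :: B) (x :: M) p;; Some (FEx x p')
    | FBox a p =>
        a' <- ptrav B M a;;
        p' <- ftrav (bv_gen hb a ++ B) (mbv_gen hm a ++ M) p;;
        Some (FBox a' p')
    | FDia a p =>
        a' <- ptrav B M a;;
        p' <- ftrav (bv_gen hb a ++ B) (mbv_gen hm a ++ M) p;;
        Some (FDia a' p')
    end
  with ptrav (B M : list var) (a : prog T1 A1 P1)
      : option (prog T2 Empty_set Empty_set) :=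
    match a with
    | PAtom p => lp B p
    | PAssign x t => t' <- lt B M t;; Some (PAssign x t')
    | PRand x => Some (PRand x)
    | PTest p => p' <- ftrav B M p;; Some (PTest p')
    | PSeq a b =>
        a' <- ptrav B M a;;
        b' <- ptrav (bv_gen hb a ++ B) (mbv_gen hm a ++ M) b;;
        Some (PSeq a' b')
    | PChoice a b => a' <- ptrav B M a;; b' <- ptrav B M b;; Some (PChoice a' b')
    | PLoop a => a' <- ptrav (bv_gen hb a ++ B) M a;; Some (PLoop a')
    | PODE ode q =>
        let B' := odevars ode ++ odediffs ode ++ B in
        if forallb (lo B M) (odevars ode) then
          ode' <- omap (fun xe => e <- lt B' M (snd xe);; Some (fst xe, e)) ode;;
          q' <- ftrav B' M q;;
          Some (PODE ode' q')
        else None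
    end.
End Traversal.
Arguments ftrav {T1 A1 P1 T2} lt lo la lp hb hm B M p.
Arguments ptrav {T1 A1 P1 T2} lt lo la lp hb hm B M a.

Definition ftrav0 {T1 T2} lt lo : list var -> list var ->
    fml T1 Empty_set Empty_set -> option (fml T2 Empty_set Empty_set) :=
  ftrav lt lo (fun _ => absurd_atom) (fun _ => absurd_atom)
        absurd_atom absurd_atom.
Definition ptrav0 {T1 T2} lt lo : list var -> list var ->
    prog T1 Empty_set Empty_set -> option (prog T2 Empty_set Empty_set) :=
  ptrav lt lo (fun _ => absurd_atom) (fun _ => absurd_atom)
        absurd_atom absurd_atom.

Definition is_var (x : var) (t : term) : bool :=
  match t with TLeaf y => if var_eq_dec x y then true else false | _ => false end.

Definition chk (B : list var) (t : term) : option term :=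
  if disjoint (tfv t) B then Some t else None.

(** The value of an occurrence of [x] under the simultaneous replacement [s]:
    a bound occurrence stays, a free one becomes [s x] provided no variable of
    [s x] is captured; [None] if [x] may, but need not, be bound and [s] moves
    it. *)
Definition vsub (s : var -> term) (B M : list var) (x : var) : option term :=
  if mem x M then Some (TVar x)
  else if mem x B then (if is_var x (s x) then Some (TVar x) else None)
  else chk B (s x).

Definition vfix (s : var -> term) (B M : list var) (x : var) : bool :=
  match vsub s B M x with Some t => is_var x t | None => false end.

(** Leaves allowed below a differential: those left alone together with their
    differential variable. *)
Definition vdiff (s : var -> term) (B M : list var) (x : var) : option var :=
  if vfix s B M x && match x with V n => vfix s B M (D n) | D _ => true end
  then Some x else None.

Definition tsub_at (s : var -> term) (B M : list var) : term -> option term :=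
  tbind (vsub s B M) (vdiff s B M).

Definition osub (s : var -> term) (B M : list var) (x : var) : bool :=
  mem x M || is_var x (s x).

Definition sigma (l : list (var * term)) (x : var) : term :=
  match find (fun yt => if var_eq_dec x (fst yt) then true else false) l with
  | Some yt => snd yt
  | None => TVar x
  end.

(** e[x1 |-> t1, ...] for l = [(x1,t1);...]; [None] when not admissible. *)
Definition tsubst (l : list (var * term)) : term -> option term :=
  tsub_at (sigma l) [] [].
Definition fsubst (l : list (var * term)) : dfml -> option dfml :=
  ftrav0 (tsub_at (sigma l)) (osub (sigma l)) [] [].
Definition psubst (l : list (var * term)) : dprog -> option dprog :=
  ptrav0 (tsub_at (sigma l)) (osub (sigma l)) [] [].

(** * Contexts *)

Inductive expr := ETm (t : term) | EFm (p : dfml) | EPg (a : dprog).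

(** Bodies of functional abbreviations: [Now x] is the variable x of a subterm
    now(..), to be evaluated at the state of use; [Fix x] is a variable of the
    expanded rest. *)
Inductive mleaf : Set := Fix (x : var) | Now (x : var).
Definition mterm := gterm mleaf.
Inductive mexpr :=
| MTm (t : mterm)
| MFm (p : fml mterm Empty_set Empty_set)
| MPg (a : prog mterm Empty_set Empty_set).

Inductive centry :=
| CAsm (x : option name) (p : dfml)
| CAbb (i : ident) (e : expr)
| CFun (i : ident) (b : mexpr).
Definition ctx := list centry.        (* the newest entry is the last one *)

Fixpoint asms (G : ctx) : list dfml :=
  match G with
  | [] => []
  | CAsm _ p :: G => p :: asms G
  | _ :: G => asms G
  end.

Definition csat (G : ctx) (w : state) : Prop :=
  forall p, In p (asms G) -> dsem p w.

Inductive abbr := AVal (e : expr) | AFun (b : mexpr).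

Fixpoint lookup_new (G : ctx) (i : ident) : option abbr :=
  match G with
  | [] => None
  | CAsm _ _ :: G => lookup_new G i
  | CAbb j e :: G => if Nat.eqb i j then Some (AVal e) else lookup_new G i
  | CFun j b :: G => if Nat.eqb i j then Some (AFun b) else lookup_new G i
  end.
Definition lookup (G : ctx) : ident -> option abbr := lookup_new (rev G).

Definition mleaf_vars (l : mleaf) : list var :=
  match l with Fix x => [x] | Now x => [x] end.
Fixpoint mvars (t : mterm) : list var :=
  match t with
  | TLeaf l => mleaf_vars l
  | TConst _ => []
  | TPlus a b | TMinus a b | TTimes a b | TDiv a b => mvars a ++ mvars b
  | TPow a _ => mvars a
  | TDiff a => mvars a ++ map D (bases (mvars a))
  end.

Definition cvars (G : ctx) : list var :=
  flat_map (fun c =>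
    match c with
    | CAsm _ p | CAbb _ (EFm p) => fvars tfv p
    | CAbb _ (ETm t) => tfv t
    | CAbb _ (EPg a) => pvars tfv a
    | CFun _ (MTm t) => mvars t
    | CFun _ (MFm p) => fvars mvars p
    | CFun _ (MPg a) => pvars mvars a
    end) G.

Definition dvars (Dl : list dfml) : list var := flat_map (fvars tfv) Dl.

(** Substitution in bodies leaves now(..) alone. *)
Definition msub_at (s : var -> term) (B M : list var) : mterm -> option mterm :=
  tbind (fun l => match l with
                  | Fix x => t <- vsub s B M x;; Some (tmap Fix t)
                  | Now x => Some (TLeaf (Now x))
                  end)
        (fun l => match l with
                  | Fix x => y <- vdiff s B M x;; Some (Fix y)
                  | Now x => Some (Now x)
                  end).

Definition esubst (l : list (var * term)) (e : expr) : option expr :=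
  match e with
  | ETm t => t' <- tsubst l t;; Some (ETm t')
  | EFm p => p' <- fsubst l p;; Some (EFm p')
  | EPg a => a' <- psubst l a;; Some (EPg a')
  end.
Definition msubst (l : list (var * term)) (b : mexpr) : option mexpr :=
  match b with
  | MTm t => t' <- msub_at (sigma l) [] [] t;; Some (MTm t')
  | MFm p => p' <- ftrav0 (msub_at (sigma l)) (osub (sigma l)) [] [] p;;
             Some (MFm p')
  | MPg a => a' <- ptrav0 (msub_at (sigma l)) (osub (sigma l)) [] [] a;;
             Some (MPg a')
  end.

Definition csubst (l : list (var * term)) : ctx -> option ctx :=
  omap (fun c =>
    match c with
    | CAsm x p => p' <- fsubst l p;; Some (CAsm x p')
    | CAbb i e => e' <- esubst l e;; Some (CAbb i e')
    | CFun i b => b' <- msubst l b;; Some (CFun i b')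
    end).
Definition dsubst (l : list (var * term)) : list dfml -> option (list dfml) :=
  omap (fsubst l).

(** * Static traces *)

Inductive record :=
| RSub (x : var) (t : term)
| REq (x xi : var) (t : term)
| RAny (x xi : var)
| RName (t : sname).
Definition trace := list record.      (* the newest record is the first one *)

Fixpoint now (H : trace) (x : var) : term :=
  match H with
  | [] => TVar x
  | RSub y t :: H => if var_eq_dec x y then t else now H x
  | REq y _ _ :: H | RAny y _ :: H => if var_eq_dec x y then TVar x else now H x
  | RName _ :: H => now H x
  end.

(** t_H(x), undefined if t is not recorded in [H]. *)
Fixpoint at_state (t : sname) (H : trace) (x : var) : option term :=
  match H with
  | [] => None
  | RName s :: H => if Nat.eqb s t then Some (now H x) else at_state t H x
  | REq y yi _ :: H | RAny y yi :: H =>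
      if var_eq_dec x y then at_state t H yi else at_state t H x
  | RSub _ _ :: H => at_state t H x
  end.

Definition hvars (H : trace) : list var :=
  flat_map (fun r =>
    match r with
    | RSub x t => x :: tfv t
    | REq x xi t => x :: xi :: tfv t
    | RAny x xi => [x; xi]
    | RName _ => []
    end) H.

(** * Extended expressions and their expansion *)

(** [XNom t e] is the nominal term t(e); [XAbbr i] is ident_.  A use s(ident_)
    of a functional abbreviation is [XNom s (XAbbr i)]. *)
Inductive xterm : Type :=
| XVar (x : var)
| XConst (q : Q)
| XPlus (a b : xterm)
| XMinus (a b : xterm)
| XTimes (a b : xterm)
| XDiv (a b : xterm)
| XPow (a : xterm) (q : Q)
| XAbbr (i : ident)
| XNom (t : sname) (a : xterm).

(** Abbreviations in the place of a formula or a program. *)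
Inductive xatom := XA (i : ident) | XAt (s : sname) (i : ident).

Definition xfml := fml xterm xatom xatom.
Definition xprog := prog xterm xatom xatom.
Inductive xexpr := XTm (t : xterm) | XFm (p : xfml) | XPg (a : xprog).

(** Use of a functional abbreviation at state [s]. *)
Definition inst_at (H : trace) (s : sname) (B M : list var)
    : mterm -> option term :=
  tbind (fun l => match l with
                  | Fix x => Some (TVar x)
                  | Now x => t <- at_state s H x;; chk B t
                  end)
        (fun l => match l with Fix x => Some x | Now _ => None end).
Definition finst (H : trace) (s : sname)
    : fml mterm Empty_set Empty_set -> option dfml :=
  ftrav0 (inst_at H s) (fun _ _ _ => true) [] [].
Definition pinst (H : trace) (s : sname)
    : prog mterm Empty_set Empty_set -> option dprog :=
  ptrav0 (inst_at H s) (fun _ _ _ => true) [] [].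

(** Common part of expansion and of mob: homomorphic translation of extended
    expressions to terms with leaves in [L].  Occurrences t(x) and t(ident_)
    are translated by [nv] and [nt], [nf], [np]. *)
Section Expansion.
  Variable L : Type.
  Variable inj : var -> L.
  Variable H : trace.
  Variable G : ctx.
  Variable nv : list var -> sname -> var -> option (gterm L).
  Variable nt : list var -> sname -> mterm -> option (gterm L).
  Variable nf : list var -> sname -> fml mterm Empty_set Empty_set ->
                option (fml (gterm L) Empty_set Empty_set).
  Variable np : list var -> sname -> prog mterm Empty_set Empty_set ->
                option (prog (gterm L) Empty_set Empty_set).

  (* [st] is the innermost enclosing state name *)
  Fixpoint texp_gen (st : option sname) (B M : list var) (e : xterm)
      : option (gterm L) :=
    match e with
    | XVar x =>
        match st with
        | None => t <- vsub (now H) B M x;; Some (tmap inj t)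
        | Some s => nv B s x
        end
    | XConst q => Some (TConst q)
    | XPlus a b =>
        a' <- texp_gen st B M a;; b' <- texp_gen st B M b;; Some (TPlus a' b')
    | XMinus a b =>
        a' <- texp_gen st B M a;; b' <- texp_gen st B M b;; Some (TMinus a' b')
    | XTimes a b =>
        a' <- texp_gen st B M a;; b' <- texp_gen st B M b;; Some (TTimes a' b')
    | XDiv a b =>
        a' <- texp_gen st B M a;; b' <- texp_gen st B M b;; Some (TDiv a' b')
    | XPow a q => a' <- texp_gen st B M a;; Some (TPow a' q)
    | XAbbr i =>
        match lookup G i, st with
        | Some (AVal (ETm t)), _ => t' <- chk B t;; Some (tmap inj t')
        | Some (AFun (MTm b)), Some s => nt B s b
        | _, _ => None
        end
    | XNom s a => texp_gen (Some s) B M a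
    end.

  Definition aexp_gen (B : list var) (a : xatom)
      : option (fml (gterm L) Empty_set Empty_set) :=
    match a with
    | XA i =>
        match lookup G i with
        | Some (AVal (EFm p)) =>
            if disjoint (ffv p) B then Some (fmap (tmap inj) absurd_atom p)
            else None
        | _ => None
        end
    | XAt s i =>
        match lookup G i with Some (AFun (MFm b)) => nf B s b | _ => None end
    end.

  Definition apexp_gen (B : list var) (a : xatom)
      : option (prog (gterm L) Empty_set Empty_set) :=
    match a with
    | XA i =>
        match lookup G i with
        | Some (AVal (EPg a)) =>
            if disjoint (pfv a) B then Some (pmap (tmap inj) absurd_atom a)
            else None
        | _ => None
        end
    | XAt s i =>
        match lookup G i with Some (AFun (MPg b)) => np B s b | _ => None end
    end.

  Definition abv (get : forall T, prog T Empty_set Empty_set -> list var)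
      (a : xatom) : list var :=
    match a with
    | XA i =>
        match lookup G i with Some (AVal (EPg a)) => get _ a | _ => [] end
    | XAt _ i =>
        match lookup G i with Some (AFun (MPg b)) => get _ b | _ => [] end
    end.

  Definition fexp_gen : xfml -> option (fml (gterm L) Empty_set Empty_set) :=
    ftrav (texp_gen None) (osub (now H)) aexp_gen apexp_gen
          (abv (fun T => bv)) (abv (fun T => mbv)) [] [].
  Definition pexp_gen : xprog -> option (prog (gterm L) Empty_set Empty_set) :=
    ptrav (texp_gen None) (osub (now H)) aexp_gen apexp_gen
          (abv (fun T => bv)) (abv (fun T => mbv)) [] [].
End Expansion.
Arguments texp_gen {L} inj H G nv nt st B M e.
Arguments fexp_gen {L} inj H G nv nt nf np p : rename.
Arguments pexp_gen {L} inj H G nv nt nf np a : rename.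

Definition ev (H : trace) B s x := t <- at_state s H x;; chk B t.
Definition et (H : trace) B s b := t <- inst_at H s [] [] b;; chk B t.
Definition ef (H : trace) B s b :=
  p <- finst H s b;; if disjoint (ffv p) B then Some p else None.
Definition ep (H : trace) B s b :=
  a <- pinst H s b;; if disjoint (pfv a) B then Some a else None.

(** The expansion of an extended expression relative to [H] and [G]. *)
Definition texp (H : trace) (G : ctx) : xterm -> option term :=
  texp_gen (fun x => x) H G (ev H) (et H) None [] [].
Definition fexp (H : trace) (G : ctx) : xfml -> option dfml :=
  fexp_gen (fun x => x) H G (ev H) (et H) (ef H) (ep H).
Definition pexp (H : trace) (G : ctx) : xprog -> option dprog :=
  pexp_gen (fun x => x) H G (ev H) (et H) (ef H) (ep H).

Definition expand (H : trace) (G : ctx) (e : xexpr) : option expr :=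
  match e with
  | XTm t => t' <- texp H G t;; Some (ETm t')
  | XFm p => p' <- fexp H G p;; Some (EFm p')
  | XPg a => a' <- pexp H G a;; Some (EPg a')
  end.

(** mob_H(e,t): t(e') becomes now(e'), which is pushed to the variables of e';
    everything else is expanded. *)
Definition mv (H : trace) (t : sname) (B : list var) (s : sname) (x : var)
    : option mterm :=
  if Nat.eqb s t then Some (TLeaf (Now x))
  else u <- ev H B s x;; Some (tmap Fix u).
Definition mt (H : trace) (t : sname) (B : list var) (s : sname) (b : mterm)
    : option mterm :=
  if Nat.eqb s t then (if disjoint (mvars b) B then Some b else None)
  else u <- et H B s b;; Some (tmap Fix u).
Definition mf (H : trace) (t : sname) (B : list var) (s : sname)
    (b : fml mterm Empty_set Empty_set) :=
  if Nat.eqb s t then (if disjoint (fvars mvars b) B then Some b else None)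
  else p <- ef H B s b;; Some (fmap (tmap Fix) absurd_atom p).
Definition mp (H : trace) (t : sname) (B : list var) (s : sname)
    (b : prog mterm Empty_set Empty_set) :=
  if Nat.eqb s t then (if disjoint (pvars mvars b) B then Some b else None)
  else a <- ep H B s b;; Some (pmap (tmap Fix) absurd_atom a).

Definition mob (H : trace) (G : ctx) (e : xexpr) (t : sname) : option mexpr :=
  match e with
  | XTm a =>
      a' <- texp_gen Fix H G (mv H t) (mt H t) None [] [] a;; Some (MTm a')
  | XFm p =>
      p' <- fexp_gen Fix H G (mv H t) (mt H t) (mf H t) (mp H t) p;;
      Some (MFm p')
  | XPg a =>
      a' <- pexp_gen Fix H G (mv H t) (mt H t) (mf H t) (mp H t) a;;
      Some (MPg a')
  end.

(** * Patterns *)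

(** The operators of dL other than variables.  Bound variables and rational
    parameters belong to the operator. *)
Inductive op :=
| OConst (q : Q) | OPlus | OMinus | OTimes | ODiv | OPow (q : Q) | ODiff
| OCmp (c : cmp) | OAnd | OOr | ONot | OAll (x : var) | OEx (x : var)
| OBox | ODia
| OAssign (x : var) | ORand (x : var) | OTest | OSeq | OChoice | OLoop
| OODE (xs : list nat).

Definition Q_eq_dec (p q : Q) : {p = q} + {p <> q}.
Proof. decide equality; [apply Pos.eq_dec | apply Z.eq_dec]. Defined.
Definition term_eq_dec (s t : term) : {s = t} + {s <> t}.
Proof. unfold term in *; decide equality; auto using Q_eq_dec, var_eq_dec. Defined.
Definition cmp_eq_dec (c d : cmp) : {c = d} + {c <> d}.
Proof. decide equality. Defined.
Definition ode_eq_dec (l k : list (nat * term)) : {l = k} + {l <> k}.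
Proof.
  apply list_eq_dec; intros [x s] [y t].
  destruct (PeanoNat.Nat.eq_dec x y); destruct (term_eq_dec s t);
    (left; congruence) || (right; congruence).
Defined.
Fixpoint dfml_eq_dec (p q : dfml) {struct p} : {p = q} + {p <> q}
with dprog_eq_dec (a b : dprog) {struct a} : {a = b} + {a <> b}.
Proof.
  - unfold dfml, dprog in *; decide equality;
      auto using term_eq_dec, cmp_eq_dec, var_eq_dec;
      match goal with e : Empty_set |- _ => destruct e end.
  - unfold dfml, dprog in *; decide equality;
      auto using term_eq_dec, var_eq_dec, ode_eq_dec;
      match goal with e : Empty_set |- _ => destruct e end.
Defined.
Definition expr_eq_dec (e f : expr) : {e = f} + {e <> f}.
Proof.
  decide equality; auto using term_eq_dec, dfml_eq_dec, dprog_eq_dec.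
Defined.
Definition op_eq_dec (o o' : op) : {o = o'} + {o <> o'}.
Proof.
  decide equality; auto using Q_eq_dec, cmp_eq_dec, var_eq_dec.
  apply list_eq_dec, PeanoNat.Nat.eq_dec.
Defined.

Definition view (e : expr) : option (op * list expr) :=
  match e with
  | ETm t =>
      match t with
      | TLeaf _ => None
      | TConst q => Some (OConst q, [])
      | TPlus a b => Some (OPlus, [ETm a; ETm b])
      | TMinus a b => Some (OMinus, [ETm a; ETm b])
      | TTimes a b => Some (OTimes, [ETm a; ETm b])
      | TDiv a b => Some (ODiv, [ETm a; ETm b])
      | TPow a q => Some (OPow q, [ETm a])
      | TDiff a => Some (ODiff, [ETm a])
      end
  | EFm p =>
      match p with
      | FAtom e => match e with end
      | FCmp c s t => Some (OCmp c, [ETm s; ETm t])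
      | FAnd p q => Some (OAnd, [EFm p; EFm q])
      | FOr p q => Some (OOr, [EFm p; EFm q])
      | FNot p => Some (ONot, [EFm p])
      | FAll x p => Some (OAll x, [EFm p])
      | FEx x p => Some (OEx x, [EFm p])
      | FBox a p => Some (OBox, [EPg a; EFm p])
      | FDia a p => Some (ODia, [EPg a; EFm p])
      end
  | EPg a =>
      match a with
      | PAtom e => match e with end
      | PAssign x t => Some (OAssign x, [ETm t])
      | PRand x => Some (ORand x, [])
      | PTest p => Some (OTest, [EFm p])
      | PSeq a b => Some (OSeq, [EPg a; EPg b])
      | PChoice a b => Some (OChoice, [EPg a; EPg b])
      | PLoop a => Some (OLoop, [EPg a])
      | PODE ode q =>
          Some (OODE (map fst ode),
                map (fun xe => ETm (snd xe)) ode ++ [EFm q])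
      end
  end.

Definition efv (e : expr) : list var :=
  match e with ETm t => tfv t | EFm p => ffv p | EPg a => pfv a end.

Inductive pat :=
| PtId (i : ident)
| PtVar (x : var)
| PtIn (p : pat) (xs : list var)       (* p(vars) *)
| PtNotIn (p : pat) (xs : list var)    (* p(not vars) *)
| PtWild
| PtOr (p q : pat)
| PtAnd (p q : pat)
| PtNot (p : pat)
| PtOp (o : op) (ps : list pat).

Fixpoint pids (p : pat) : list ident :=
  match p with
  | PtId i => [i]
  | PtVar _ | PtWild => []
  | PtIn p _ | PtNotIn p _ | PtNot p => pids p
  | PtOr p q | PtAnd p q => pids p ++ pids q
  | PtOp _ ps => flat_map pids ps
  end.

Definition bound (G : ctx) (i : ident) : bool :=
  match lookup G i with Some _ => true | None => false end.

Fixpoint pmatch (H : trace) (G : ctx) (p : pat) (e : expr) {struct p}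
    : option ctx :=
  match p with
  | PtId i =>
      match lookup G i with
      | Some (AVal e') => if expr_eq_dec e e' then Some G else None
      | Some (AFun _) => None
      | None => Some (G ++ [CAbb i e])
      end
  | PtVar x => if expr_eq_dec e (ETm (now H x)) then Some G else None
  | PtIn _ xs => if forallb (fun x => mem x (efv e)) xs then Some G else None
  | PtNotIn _ xs => if disjoint xs (efv e) then Some G else None
  | PtWild => Some G
  | PtOr p q =>
      match pmatch H G p e with Some G' => Some G' | None => pmatch H G q e end
  | PtAnd p q => G' <- pmatch H G p e;; pmatch H G' q e
  | PtNot p =>
      if forallb (bound G) (pids p) then
        match pmatch H G p e with Some _ => None | None => Some G end
      else None
  | PtOp o ps =>
      match view e with
      | Some (o', es) =>
          if op_eq_dec o o' then
            (fix go (G : ctx) (ps : list pat) (es : list expr) {struct ps} :=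
               match ps, es with
               | [], [] => Some G
               | p :: ps, e :: es => G' <- pmatch H G p e;; go G' ps es
               | _, _ => None
               end) G ps es
          else None
      | None => None
      end
  end.

Definition matches (H : trace) (G : ctx) (p : pat) (f : dfml) : bool :=
  match pmatch H G p (EFm f) with Some _ => true | None => false end.

(** * Proofs *)

Inductive fp :=
| FPPat (p : pat)
| FPApp (f g : fp)
| FPInst (f : fp) (t : xterm).

Inductive method := MId | MReal | MAuto.

(** Case proofs are written [SCase1] and [SCase2] according to their number of
    branches, [SCaseIff] on an equivalence.  [SAssignWit] is assign x:=* with a
    witness, [SSolveAt] is solve with a given duration and a proof of the
    domain constraint. *)
Inductive sp :=
| SHave (x : name) (p : xfml) (s1 s2 : sp)
| SNote (x : name) (f : fp) (s : sp)
| SLet (p : pat) (e : xexpr) (s : sp)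
| SLetFun (t : sname) (i : ident) (e : xexpr) (s : sp)
| SState (t : sname) (s : sp)
| SFocus (p : pat) (s : sp)
| SShow (q : option pat) (ps : list pat) (fs : list fp) (m : method)
| SAssume (x : name) (p : pat) (s : sp)
| SCase1 (p : pat) (s : sp)
| SCase2 (p : pat) (s1 s2 : sp)
| SCaseIff (p : pat) (x : name) (s1 : sp) (y : name) (s2 : sp)
| SAssign (x : var) (t : xterm) (s : sp)
| SAssignAny (x : var) (s : sp)
| SAssignWit (x : var) (t : xterm) (s : sp)
| SAfter (s1 : sp) (p : xfml) (s2 : sp)
| SSolve (s : sp)
| SSolveAt (t : xterm) (s1 s2 : sp)
| SVariant (v : var) (p : xfml) (s1 s2 s3 : sp)
| SInv (i : ip)
with ip :=
| IInv (x : name) (p : xfml) (pre ind : sp) (i : ip)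
| IGhost (y : nat) (t t' : xterm) (i : ip)
| IFinally (s : sp).

(** [Sigma]: the instances of the library axioms. *)
Inductive fpcheck (Sigma : dfml -> Prop) (H : trace) (G : ctx)
    : fp -> dfml -> Prop :=
| fp_pat p f :
    Sigma f \/ In f (asms G) -> matches H G p f = true ->
    fpcheck Sigma H G (FPPat p) f
| fp_app f1 f2 p q :
    fpcheck Sigma H G f1 (FImp p q) -> fpcheck Sigma H G f2 p ->
    fpcheck Sigma H G (FPApp f1 f2) q
| fp_inst f1 t t' x p q :
    fpcheck Sigma H G f1 (FAll x p) -> texp H G t = Some t' ->
    fsubst [(x, t')] p = Some q ->
    fpcheck Sigma H G (FPInst f1 t) q.

(** * Auxiliary notions for the proof rules *)

Definition FTrue : dfml := FCmp EQ (TConst 0) (TConst 0).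
Definition FFalse : dfml := FNot FTrue.
Definition conj_of (l : list dfml) : dfml := fold_right FAnd FTrue l.
Fixpoint disj_of (l : list dfml) : dfml :=
  match l with
  | [] => FFalse
  | [p] => p
  | p :: l => FOr p (disj_of l)
  end.

Definition facts (Sigma : dfml -> Prop) (H : trace) (G : ctx)
    (ps : list pat) (fs : list fp) (F : list dfml) : Prop :=
  match ps, fs with
  | [], [] => F = asms G
  | _, _ =>
      exists cs, Forall2 (fpcheck Sigma H G) fs cs /\
        F = filter (fun f => existsb (fun p => matches H G p f) ps) (asms G) ++ cs
  end.

Definition goal_of (H : trace) (G : ctx) (Dl : list dfml) (q : option pat)
    (f : dfml) : Prop :=
  match q with
  | Some q => In f Dl /\ matches H G q f = true
  | None => f = disj_of Dl
  end.

Definition closes (auto : list dfml -> dfml -> Prop) (m : method)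
    (F : list dfml) (f : dfml) : Prop :=
  match m with
  | MId => In f F
  | MReal => let g := FImp (conj_of F) f in fol g /\ dvalid g
  | MAuto => auto F f
  end.

Definition fresh (xs : list var) (H : trace) (G : ctx) (Dl : list dfml)
    (more : list var) : Prop :=
  NoDup xs /\
  forall x, In x xs -> ~ In x (hvars H ++ cvars G ++ dvars Dl ++ more).

Definition bvset (a : dprog) : list var := nodup var_eq_dec (bv a).

(** Ga, Da, Ha are G^a, D^a, H^a for fresh [ys]; the variables [more] are
    avoided as well. *)
Definition abstraction (a : dprog) (ys : list var) (more : list var)
    (H : trace) (G : ctx) (Dl : list dfml)
    (Ha : trace) (Ga : ctx) (Da : list dfml) : Prop :=
  length ys = length (bvset a) /\
  fresh ys H G Dl (pvars tfv a ++ more) /\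
  let l := combine (bvset a) (map TVar ys) in
  csubst l G = Some Ga /\ dsubst l Dl = Some Da /\
  Ha = rev (map (fun xy => RAny (fst xy) (snd xy)) (combine (bvset a) ys)) ++ H.

(** The differential of a formula built from comparisons by conjunction and
    disjunction. *)
Fixpoint fdiff (p : dfml) : option dfml :=
  match p with
  | FCmp c s t =>
      let c' := match c with
                | GE | GT => GE | LE | LT => LE | EQ | NE => EQ
                end in
      Some (FCmp c' (TDiff s) (TDiff t))
  | FAnd p q | FOr p q => p' <- fdiff p;; q' <- fdiff q;; Some (FAnd p' q')
  | _ => None
  end.

Fixpoint fdifferentiable (p : dfml) (w : state) : Prop :=
  match p with
  | FCmp _ s t => differentiable s w /\ differentiable t w
  | FAnd p q | FOr p q => fdifferentiable p w /\ fdifferentiable q w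
  | _ => False
  end.

Definition nodiff (l : list var) : Prop := forall n, ~ In (D n) l.

(** [x1':=e1]...[xn':=en]p *)
Definition diff_assigns (ode : list (nat * term)) (p : dfml) : dfml :=
  fold_right (fun xe q => FBox (PAssign (D (fst xe)) (snd xe)) q) p ode.

Inductive linear_in (y : var) : term -> Prop :=
| lin_free t : ~ In y (tfv t) -> linear_in y t
| lin_var : linear_in y (TVar y)
| lin_plus a b : linear_in y a -> linear_in y b -> linear_in y (TPlus a b)
| lin_minus a b : linear_in y a -> linear_in y b -> linear_in y (TMinus a b)
| lin_times_l a b : linear_in y a -> ~ In y (tfv b) -> linear_in y (TTimes a b)
| lin_times_r a b : ~ In y (tfv a) -> linear_in y b -> linear_in y (TTimes a b)
| lin_div a b : linear_in y a -> ~ In y (tfv b) -> linear_in y (TDiv a b).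

(** [P] holds wherever the system leads from states satisfying [G] while
    [q] and the formulas [Js] hold. *)
Definition along (G : ctx) (ode : list (nat * term)) (q : dfml)
    (Js : list dfml) (P : state -> Prop) : Prop :=
  forall w v, csat G w -> drun (PODE ode (FAnd q (conj_of Js))) w v -> P v.

(** The curve r |-> w with each variable x of the system replaced by the value
    of its term y(t) at time t = r. *)
Definition curve (ode : list (nat * term)) (ys : list term) (t : var)
    (w : state) (r : R) : state :=
  fold_right (fun xy u => upd u (fst xy) (teval (snd xy) (upd w t r)))
    w (combine (odevars ode) ys).

Definition solution_subst (ode : list (nat * term)) (ys : list term)
    : list (var * term) := combine (odevars ode) ys.

(** The records sub(x1,y1), sub(x2,y2), ... appended to [H]. *)
Definition add_subs (l : list (var * term)) (H : trace) : trace :=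
  rev (map (fun xt => RSub (fst xt) (snd xt)) l) ++ H.

(** ys[t |-> e] *)
Definition at_time (t : var) (e : term) (ys : list term) : option (list term) :=
  omap (tsubst [(t, e)]) ys.

(** forall s in [0,e], qs *)
Definition during (s : var) (e : term) (qs : dfml) : dfml :=
  FAll s (FImp (FAnd (FCmp LE (TConst 0) (TVar s)) (FCmp LE (TVar s) e)) qs).

Definition asm (p : dfml) : centry := CAsm None p.

Definition modal (b : bool) (a : dprog) (p : dfml) : dfml :=
  if b then FBox a p else FDia a p.

(** Implicit conversions: [conv p q] is p <= q. *)
Inductive conv : dfml -> dfml -> Prop :=
| cv_box_seq a b p : conv (FBox (PSeq a b) p) (FBox a (FBox b p))
| cv_dia_seq a b p : conv (FDia (PSeq a b) p) (FDia a (FDia b p))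
| cv_all x p : conv (FAll x p) (FBox (PRand x) p)
| cv_ex x p : conv (FEx x p) (FDia (PRand x) p)
| cv_imp p q : conv (FImp p q) (FBox (PTest p) q)
| cv_dia_test p q : conv (FDia (PTest p) q) (FAnd p q)
| cv_not_all x p : conv (FNot (FAll x p)) (FEx x (FNot p))
| cv_not_ex x p : conv (FNot (FEx x p)) (FAll x (FNot p))
| cv_not_not p : conv (FNot (FNot p)) p
| cv_not_and p q : conv (FNot (FAnd p q)) (FOr (FNot p) (FNot q))
| cv_not_or p q : conv (FNot (FOr p q)) (FAnd (FNot p) (FNot q))
| cv_not_imp p q : conv (FNot (FImp p q)) (FAnd p (FNot q))
| cv_not_iff p q :
    conv (FNot (FIff p q)) (FOr (FAnd p (FNot q)) (FAnd (FNot p) q))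
| cv_not_box a p : conv (FNot (FBox a p)) (FDia a (FNot p))
| cv_not_dia a p : conv (FNot (FDia a p)) (FBox a (FNot p)).

(** * The proof-checking judgment *)

Section Checking.
  Variable Sigma : dfml -> Prop.
  Variable auto : list dfml -> dfml -> Prop.

  (** [check H G Dl s H'] is (H ~> H') s : (G |- Dl).
      [ipcheck H G Js a p Dl i] is the judgment for (G, [a]Js |- [a]p, Dl); an
      invariant proof returns its initial trace [H]. *)
  Inductive check : trace -> ctx -> list dfml -> sp -> trace -> Prop :=
  (* structural rules *)
  | c_have H H1 H' G f Dl x e p s1 s2 :
      fexp H G e = Some p ->
      check H G [p] s1 H1 ->
      check H (G ++ [CAsm (Some x) p]) (f :: Dl) s2 H' ->
      check H G (f :: Dl) (SHave x e s1 s2) H'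
  | c_note H H' G f Dl x r p s :
      fpcheck Sigma H G r p ->
      check H (G ++ [CAsm (Some x) p]) (f :: Dl) s H' ->
      check H G (f :: Dl) (SNote x r s) H'
  | c_let H H' G G1 f Dl p e e' s :
      expand H G e = Some e' -> pmatch H G p e' = Some G1 ->
      check H G1 (f :: Dl) s H' ->
      check H G (f :: Dl) (SLet p e s) H'
  | c_letfun H H' G f Dl t tnow i e b s :
      ~ In (RName tnow) H ->
      mob H G e t = Some b ->
      check (RName tnow :: H) (G ++ [CFun i b]) (f :: Dl) s H' ->
      check H G (f :: Dl) (SLetFun t i e s) H'
  | c_state H H' G f Dl t s :
      check (RName t :: H) G (f :: Dl) s H' ->
      check H G (f :: Dl) (SState t s) H'
  | c_focus_succ H H' G D1 f D2 p s :
      matches H G p f = true ->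
      check H G (f :: D1 ++ D2) s H' ->
      check H G (D1 ++ f :: D2) (SFocus p s) H
  | c_focus_ante H H' G1 x f G2 Dl p s :
      matches H (G1 ++ CAsm x f :: G2) p f = true ->
      check H (G1 ++ G2) (FNot f :: Dl) s H' ->
      check H (G1 ++ CAsm x f :: G2) Dl (SFocus p s) H
  | c_show H G Dl q ps fs m F f :
      facts Sigma H G ps fs F -> goal_of H G Dl q f -> closes auto m F f ->
      check H G Dl (SShow q ps fs m) H
  (* first-order rules *)
  | c_assume_imp H H' G G1 x p f g Dl s :
      pmatch H G p (EFm f) = Some G1 ->
      check H (G1 ++ [CAsm (Some x) f]) (g :: Dl) s H' ->
      check H G (FImp f g :: Dl) (SAssume x p s) H'
  | c_assume_test H H' G G1 x p f g Dl s :
      pmatch H G p (EFm f) = Some G1 ->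
      check H (G1 ++ [CAsm (Some x) f]) (g :: Dl) s H' ->
      check H G (FBox (PTest f) g :: Dl) (SAssume x p s) H'
  | c_case_and H H1 H2 G G1 f g Dl p s1 s2 :
      pmatch H G p (EFm (FAnd f g)) = Some G1 ->
      check H G1 (f :: Dl) s1 H1 -> check H G1 (g :: Dl) s2 H2 ->
      check H G (FAnd f g :: Dl) (SCase2 p s1 s2) H
  | c_case_or H H1 G G1 f g Dl p s :
      pmatch H G p (EFm (FOr f g)) = Some G1 ->
      check H G1 (f :: g :: Dl) s H1 ->
      check H G (FOr f g :: Dl) (SCase1 p s) H
  | c_case_iff H H1 H2 G G1 f g Dl p x s1 y s2 :
      pmatch H G p (EFm (FIff f g)) = Some G1 ->
      check H (G1 ++ [CAsm (Some x) f]) (g :: Dl) s1 H1 ->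
      check H (G1 ++ [CAsm (Some y) g]) (f :: Dl) s2 H2 ->
      check H G (FIff f g :: Dl) (SCaseIff p x s1 y s2) H
  (* boxes and diamonds *)
  | c_assign_sub H H' G b x e t f f' Dl s :
      texp H G e = Some t -> fsubst [(x, t)] f = Some f' ->
      check (RSub x t :: H) G (f' :: Dl) s H' ->
      check H G (modal b (PAssign x t) f :: Dl) (SAssign x e s) H'
  | c_assign_eq H H' G G1 b x xi e t t1 f Dl D1 s :
      texp H G e = Some t ->
      fresh [xi] H G (modal b (PAssign x t) f :: Dl) [] ->
      csubst [(x, TVar xi)] G = Some G1 ->
      tsubst [(x, TVar xi)] t = Some t1 ->
      dsubst [(x, TVar xi)] Dl = Some D1 ->
      check (REq x xi t :: H) (G1 ++ [asm (FCmp EQ (TVar x) t1)]) (f :: D1) s H' ->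
      check H G (modal b (PAssign x t) f :: Dl) (SAssign x e s) H'
  | c_assign_any H H' G G1 x xi f Dl D1 s :
      fresh [xi] H G (FBox (PRand x) f :: Dl) [] ->
      csubst [(x, TVar xi)] G = Some G1 ->
      dsubst [(x, TVar xi)] Dl = Some D1 ->
      check (RAny x xi :: H) G1 (f :: D1) s H' ->
      check H G (FBox (PRand x) f :: Dl) (SAssignAny x s) H'
  | c_assign_wit H H' G x e t f f' Dl s :
      texp H G e = Some t -> fsubst [(x, t)] f = Some f' ->
      check (RSub x t :: H) G (f' :: Dl) s H' ->
      check H G (FDia (PRand x) f :: Dl) (SAssignWit x e s) H'
  | c_case_box_choice H H1 H2 G G1 a b f Dl p s1 s2 :
      pmatch H G p (EFm (FBox (PChoice a b) f)) = Some G1 ->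
      check H G1 (FBox a f :: Dl) s1 H1 -> check H G1 (FBox b f :: Dl) s2 H2 ->
      check H G (FBox (PChoice a b) f :: Dl) (SCase2 p s1 s2) H
  | c_case_dia_choice H H1 G G1 a b f Dl p s :
      pmatch H G p (EFm (FDia (PChoice a b) f)) = Some G1 ->
      check H G1 (FDia a f :: FDia b f :: Dl) s H1 ->
      check H G (FDia (PChoice a b) f :: Dl) (SCase1 p s) H
  | c_case_box_and H H1 H2 G G1 a f g Dl p s1 s2 :
      pmatch H G p (EFm (FBox a (FAnd f g))) = Some G1 ->
      check H G1 (FBox a f :: Dl) s1 H1 -> check H G1 (FBox a g :: Dl) s2 H2 ->
      check H G (FBox a (FAnd f g) :: Dl) (SCase2 p s1 s2) H
  | c_case_box_loop H H1 H2 G G1 a f Dl p s1 s2 :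
      pmatch H G p (EFm (FBox (PLoop a) f)) = Some G1 ->
      check H G1 (f :: Dl) s1 H1 ->
      check H G1 (FBox a (FBox (PLoop a) f) :: Dl) s2 H2 ->
      check H G (FBox (PLoop a) f :: Dl) (SCase2 p s1 s2) H
  | c_case_dia_loop H H1 G G1 a f Dl p s :
      pmatch H G p (EFm (FDia (PLoop a) f)) = Some G1 ->
      check H G1 (f :: FDia a (FDia (PLoop a) f) :: Dl) s H1 ->
      check H G (FDia (PLoop a) f :: Dl) (SCase1 p s) H
  | c_after H Hp Hpa H' G Ga b a e p f Dl Da ys s1 s2 :
      fexp H G e = Some p ->
      check H G (modal b a p :: Dl) s1 Hp ->
      abstraction a ys (fvars tfv p ++ fvars tfv f ++ hvars H)
        Hp G Dl Hpa Ga Da ->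
      check Hpa (Ga ++ [asm p]) (f :: Da) s2 H' ->
      check H G (modal b a f :: Dl) (SAfter s1 e s2) H'
  (* y(t) need be a solution only for the durations t that occur *)
  | c_solve_box H H' G ode q f f' Dl ys yss t s qs sp0 :
      length ys = length ode ->
      fresh [t; s] H G (FBox (PODE ode q) f :: Dl) [] ->
      ~ In s (flat_map tfv ys) ->
      (forall w T g, csat G w -> ode_flow ode w T g ->
         (forall r, 0 <= r <= T -> dsem q (g r)) ->
         ode_sol ode w T (curve ode ys t w)) ->
      at_time t (TVar s) ys = Some yss ->
      fsubst (solution_subst ode yss) q = Some qs ->
      fsubst (solution_subst ode ys) f = Some f' ->
      check (add_subs (solution_subst ode ys) H)
        (G ++ [asm (FCmp GE (TVar t) (TConst 0)); asm (during s (TVar t) qs)])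
        (f' :: Dl) sp0 H' ->
      check H G (FBox (PODE ode q) f :: Dl) (SSolve sp0) H'
  (* here y(t) has to be the solution that the semantics refers to *)
  | c_solve_dia H H1 H' G ode q f f' Dl ys yss yst t s e et qs s1 s2 :
      texp H G e = Some et ->
      length ys = length ode ->
      fresh [t; s] H G (FDia (PODE ode q) f :: Dl) (tfv et) ->
      ~ In s (flat_map tfv ys) ->
      (forall w, csat G w -> 0 <= teval et w ->
         ode_flow ode w (teval et w) (curve ode ys t w)) ->
      at_time t (TVar s) ys = Some yss ->
      at_time t et ys = Some yst ->
      fsubst (solution_subst ode yss) q = Some qs ->
      fsubst (solution_subst ode yst) f = Some f' ->
      check H G (FAnd (FCmp GE et (TConst 0)) (during s et qs) :: Dl) s1 H1 ->
      check (add_subs (solution_subst ode yst) H) G (f' :: Dl) s2 H' ->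
      check H G (FDia (PODE ode q) f :: Dl) (SSolveAt e s1 s2) H'
  (* variants, invariants, conversions *)
  | c_variant H H1 H2 H3 Ha G Ga a f Dl Da v e p p1 ys s1 s2 s3 :
      fexp H G e = Some p ->
      fresh [v] H G (FDia (PLoop a) f :: Dl) [] ->
      fsubst [(v, TMinus (TVar v) (TConst 1))] p = Some p1 ->
      abstraction a ys (v :: fvars tfv p ++ fvars tfv f) H G Dl Ha Ga Da ->
      check H G (FEx v p :: Dl) s1 H1 ->
      check Ha (Ga ++ [asm p; asm (FCmp GT (TVar v) (TConst 0))])
        (FDia a p1 :: Da) s2 H2 ->
      check H (Ga ++ [asm p; asm (FCmp LE (TVar v) (TConst 0))])
        [FDia (PLoop a) f] s3 H3 ->
      check H G (FDia (PLoop a) f :: Dl) (SVariant v e s1 s2 s3) H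
  | c_inv H G a f Dl i :
      ipcheck H G [] a f Dl i ->
      check H G (FBox a f :: Dl) (SInv i) H
  | c_conv H H' G f g Dl s :
      conv f g -> check H G (g :: Dl) s H' ->
      check H G (f :: Dl) s H'

  with ipcheck : trace -> ctx -> list dfml -> dprog -> dfml -> list dfml ->
                 ip -> Prop :=
  | i_loop_inv H H1 H2 Ha G Ga Js a f Dl Da x e p ys s1 s2 i :
      fexp H G e = Some p ->
      abstraction a ys (dvars Js ++ fvars tfv p ++ fvars tfv f)
        H G Dl Ha Ga Da ->
      check H (G ++ map asm Js) (p :: Dl) s1 H1 ->
      check Ha (Ga ++ map asm Js ++ [asm p]) (FBox a p :: Da) s2 H2 ->
      ipcheck H G (Js ++ [p]) (PLoop a) f Dl i ->
      ipcheck H G Js (PLoop a) f Dl (IInv x e s1 s2 i)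
  | i_loop_finally H H1 Ha G Ga Js a f Dl Da ys s :
      abstraction a ys (dvars Js ++ fvars tfv f) H G Dl Ha Ga Da ->
      check Ha (Ga ++ map asm Js) (f :: Da) s H1 ->
      ipcheck H G Js (PLoop a) f Dl (IFinally s)
  (* p is differentiable where it is differentiated, and differential variables
     occur in the induction step only in [x':=e](p)' *)
  | i_ode_inv H H1 H2 Ha G Ga Js ode q f Dl Da x e p p' ys s1 s2 i :
      fexp H G e = Some p ->
      fdiff p = Some p' ->
      abstraction (PODE ode q) ys (dvars Js ++ fvars tfv p ++ fvars tfv f)
        H G Dl Ha Ga Da ->
      along G ode q Js (fdifferentiable p) ->
      nodiff (flat_map ffv (asms Ga ++ Js ++ q :: p :: Da) ++
              flat_map (fun xe => tfv (snd xe)) ode) ->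
      check H (G ++ map asm Js) (p :: Dl) s1 H1 ->
      check Ha (Ga ++ map asm Js ++ [asm q]) (diff_assigns ode p' :: Da) s2 H2 ->
      ipcheck H G (Js ++ [p]) (PODE ode q) f Dl i ->
      ipcheck H G Js (PODE ode q) f Dl (IInv x e s1 s2 i)
  | i_ode_finally H H1 Ha G Ga Js ode q f Dl Da ys s :
      abstraction (PODE ode q) ys (dvars Js ++ fvars tfv f) H G Dl Ha Ga Da ->
      check Ha (Ga ++ map asm Js ++ [asm q]) (f :: Da) s H1 ->
      ipcheck H G Js (PODE ode q) f Dl (IFinally s)
  (* the new right-hand side is defined where it is evaluated *)
  | i_ghost H G Js ode q f Dl y e e' t t' i :
      texp H G e = Some t -> texp H G e' = Some t' ->
      fresh [V y; D y] H G (FBox (PODE ode q) f :: Js ++ Dl) (tfv t) ->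
      linear_in (V y) t' ->
      nodiff (tfv t') ->
      along G ode q Js (tdef t') ->
      ipcheck H (G ++ [asm (FCmp EQ (TVar (V y)) t)]) Js
        (PODE (ode ++ [(y, t')]) q) f Dl i ->
      ipcheck H G Js (PODE ode q) f Dl (IGhost y e e' i).
End Checking.

(** * Nominalization *)

Definition is_case (s : sp) : Prop :=
  match s with SCase1 _ _ | SCase2 _ _ _ | SCaseIff _ _ _ _ _ => True | _ => False end.

Definition loop_or_ode (a : dprog) : Prop :=
  match a with PLoop _ | PODE _ _ => True | _ => False end.

(** [nom a s r] is nom(a,s) = r.  Where several clauses apply (on a choice) any
    of them may be used. *)
Inductive nom : dprog -> sp -> hprog -> Prop :=
| n_state a t s r :
    nom a s r -> nom a (SState t s) (PSeq (PTest (FAtom t)) r)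
| n_show a q ps fs m : nom a (SShow q ps fs m) (plift a)
| n_choice a b s : nom (PChoice a b) s (plift (PChoice a b))
| n_loop_case a s : is_case s -> nom (PLoop a) s (plift (PLoop a))
| n_focus a p s : nom a (SFocus p s) (plift a)
| n_have a x p s1 s2 r : nom a s2 r -> nom a (SHave x p s1 s2) r
| n_let a p e s r : nom a s r -> nom a (SLet p e s) r
| n_letfun a t i e s r : nom a s r -> nom a (SLetFun t i e s) r
| n_note a x f s r : nom a s r -> nom a (SNote x f s) r
| n_assume p a x pt s r :
    nom a s r -> nom (PSeq (PTest p) a) (SAssume x pt s) (PSeq (PTest (flift p)) r)
| n_assign x t a e s r :
    nom a s r -> nom (PSeq (PAssign x t) a) (SAssign x e s) (PSeq (PAssign x t) r)
| n_any x a s r :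
    nom a s r -> nom (PSeq (PRand x) a) (SAssignAny x s) (PSeq (PRand x) r)
| n_wit x a e s r :
    nom a s r -> nom (PSeq (PRand x) a) (SAssignWit x e s) (PSeq (PRand x) r)
| n_solve ode q a s r :
    nom a s r ->
    nom (PSeq (PODE ode q) a) (SSolve s) (PSeq (plift (PODE ode q)) r)
| n_solve_at ode q a e s1 s r :
    nom a s r ->
    nom (PSeq (PODE ode q) a) (SSolveAt e s1 s) (PSeq (plift (PODE ode q)) r)
| n_after a b s1 p s2 r1 r2 :
    nom a s1 r1 -> nom b s2 r2 ->
    nom (PSeq a b) (SAfter s1 p s2) (PSeq r1 r2)
| n_inv c b x p s1 s2 i r :
    loop_or_ode c -> nom (PSeq c b) (SInv i) r ->
    nom (PSeq c b) (SInv (IInv x p s1 s2 i)) r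
| n_finally c b s r :
    loop_or_ode c -> nom b s r ->
    nom (PSeq c b) (SInv (IFinally s)) (PSeq (plift c) r)
(* the expansion [t'] of the ghost's right-hand side does not enter the result *)
| n_ghost ode q a y e e' t' i r :
    nom (PSeq (PODE (ode ++ [(y, t')]) q) a) (SInv i)
        (PSeq (plift (PODE (ode ++ [(y, t')]) q)) r) ->
    nom (PSeq (PODE ode q) a) (SInv (IGhost y e e' i))
        (PSeq (plift (PODE ode q)) r).

(** Validity under [I] of a sequent of dL_h with dL antecedents. *)
Definition hvalid (I : sname -> state) (G : ctx) (p : hfml) : Prop :=
  forall w, (forall f, In f (asms G) -> fsem I (flift f) w) -> fsem I p w.

(* Main.v *)
From Stdlib Require Import Reals QArith Lra Lia Classical FunctionalExtensionality.
From Stdlib Require Import Relations IndefiniteDescription.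
From Coquelicot Require Import Coquelicot.
Require Import Defs.
From Stdlib Require Import List.
Import ListNotations.
Open Scope R_scope.

(** Nominalization only inserts tests, so every run of [nom a s] is a run of [a],
    and it suffices that the calculus is sound for the semantics of dL.  Since
    static traces affect only which formulas expressions expand to, soundness holds
    for arbitrary traces.

    The delicate rule is the differential ghost: the validity of box formulas has to be
    transferred to the system extended by the ghost, although the projection of a
    unique solution of the extended system might not be unique for the original
    one.  Where the new right-hand side is defined it is continuous in a
    neighbourhood, so a second solution of the original system could be extended by
    solving the linear equation of the ghost along it, contradicting uniqueness for
    the extended system; a supremum argument makes this precise. *)

(* Two features of the semantics shape the proof. An ODE run requires its solution to be unique, and
   right-hand sides need not be Lipschitz, so uniqueness is part of the meaning: transferring a run
   to another system or initial state also means carrying competing solutions back. Moreover an ODE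
   leaves x' untouched, whereas the induction step of a differential invariant speaks about states
   after x':=θ. Such states need not lie on the flow; they are manufactured, one for each time, by
   storing velocities in the differential variables of a flow state.

   Renaming to fresh variables has a uniform reading: the fresh variables are memory cells. For a
   reached state u one builds u', which differs only on them and holds the initial values there, so
   that Γ^α in u' means Γ in the initial state w. As Δ is treated alike, it may be assumed false in
   w, and then every premise has to yield its principal formula.

   Substitution is handled by a bisimulation between the runs of a program and of its instance,
   since negations, boxes and diamonds need both directions. *)
Scheme fml_mut := Induction for fml Sort Prop
  with prog_mut := Induction for prog Sort Prop.
Combined Scheme fml_prog_ind from fml_mut, prog_mut.

Lemma obind_some {X Y} (o : option X) (f : X -> option Y) y :
  obind o f = Some y -> exists x, o = Some x /\ f x = Some y.
Proof. destruct o; simpl; intros; [eauto | discriminate]. Qed.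

Ltac binv :=
  repeat match goal with
  | H : obind _ _ = Some _ |- _ =>
      let x := fresh "r" in let E := fresh "E" in
      apply obind_some in H; destruct H as (x & E & H)
  end.

Lemma omap_Forall2 {X Y} (f : X -> option Y) l l' :
  omap f l = Some l' -> Forall2 (fun x y => f x = Some y) l l'.
Proof.
  revert l'; induction l as [|x l IH]; simpl; intros l' H.
  - injection H as <-; constructor.
  - binv; injection H as <-; constructor; auto.
Qed.

Lemma mem_In x l : mem x l = true <-> In x l.
Proof. unfold mem; destruct in_dec; intuition discriminate. Qed.

Lemma mem_notIn x l : mem x l = false <-> ~ In x l.
Proof. unfold mem; destruct in_dec; intuition discriminate. Qed.

Lemma disjoint_spec l1 l2 :
  disjoint l1 l2 = true <-> forall x, In x l1 -> ~ In x l2.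
Proof.
  unfold disjoint; rewrite forallb_forall; split; intros H x Hx;
    specialize (H x Hx).
  - now apply mem_notIn, Bool.negb_true_iff.
  - now apply Bool.negb_true_iff, mem_notIn.
Qed.

Lemma in_bases n l : In n (bases l) <-> In (V n) l.
Proof.
  induction l as [|[m|m] l IH]; simpl; [tauto| |]; rewrite IH;
    intuition congruence.
Qed.

Lemma in_minus x l1 l2 : In x (minus l1 l2) <-> In x l1 /\ ~ In x l2.
Proof.
  unfold minus; rewrite filter_In, Bool.negb_true_iff, mem_notIn; tauto.
Qed.

Lemma upd_same w x r : upd w x r x = r.
Proof. unfold upd; destruct var_eq_dec; congruence. Qed.

Lemma upd_other w x r z : z <> x -> upd w x r z = w z.
Proof. unfold upd; destruct var_eq_dec; congruence. Qed.

(** * Agreement of states and dependence of terms on their free variables *)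

Definition agree (l : list var) (u v : state) : Prop :=
  forall x, In x l -> u x = v x.

Definition agree_off (l : list var) (u v : state) : Prop :=
  forall x, ~ In x l -> u x = v x.

Lemma agree_sym l u v : agree l u v -> agree l v u.
Proof. intros H x Hx; symmetry; auto. Qed.

Lemma agree_incl l l' u v : incl l' l -> agree l u v -> agree l' u v.
Proof. unfold agree; auto. Qed.

Lemma agree_upd l u v x r : agree l u v -> agree l (upd u x r) (upd v x r).
Proof. intros H z Hz; unfold upd; destruct var_eq_dec; auto. Qed.

Lemma agree_upd_cons l u v x r :
  agree (minus l [x]) u v -> agree l (upd u x r) (upd v x r).
Proof.
  intros H z Hz; unfold upd; destruct var_eq_dec; auto.
  apply H, in_minus; simpl; intuition.
Qed.

Lemma fold_right_ext_in {X Y} (f g : X -> Y -> Y) a l :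
  (forall x y, In x l -> f x y = g x y) -> fold_right f a l = fold_right g a l.
Proof.
  induction l; simpl; intros H; auto; rewrite IHl; auto.
Qed.

Lemma teval_agree t u v : agree (tfv t) u v -> teval t u = teval t v.
Proof.
  revert u v; induction t; simpl; intros u v H;
    try solve [auto | rewrite (IHt1 u v), (IHt2 u v); auto;
               eapply agree_incl; try eassumption; auto using incl_appl, incl_appr, incl_refl].
  - apply H; simpl; auto.
  - rewrite (IHt u v); auto.
  (* The partial derivatives agree because the differentiated functions of [r] are pointwise equal;
     the factors agree because [tfv] of a differential lists the differential variables too. *)
  - apply fold_right_ext_in; intros n acc Hn.
    apply nodup_In in Hn.
    assert (Hv : In (V n) (tfv t)) by now apply in_bases.
    rewrite (H (V n)), (H (D n)).
    + f_equal; f_equal; apply Derive_ext; intros r; apply IHt, agree_upd.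
      eapply agree_incl; [|exact H]; auto using incl_appl, incl_refl.
    + apply in_or_app; right; now apply in_map.
    + apply in_or_app; auto.
Qed.

Lemma sum_over_ext l f g :
  (forall x, In x l -> f x = g x) -> sum_over l f = sum_over l g.
Proof.
  intros H; apply fold_right_ext_in; intros; rewrite H; auto.
Qed.

Lemma frechet_agree t u v : agree (tfv t) u v -> frechet t u -> frechet t v.
Proof.
  intros A (g & Hg); exists g; intros eps He.
  destruct (Hg eps He) as (del & Hd & Hb); exists del; split; auto.
  assert (B : forall x, In x (nodup var_eq_dec (tfv t)) -> u x = v x)
    by (intros x Hx; apply A; now apply nodup_In in Hx).
  intros w' Hw'.
  specialize (Hb w'); rewrite (teval_agree t u v A) in Hb.
  rewrite (sum_over_ext _ (fun x => g x * (w' x - v x)) (fun x => g x * (w' x - u x)))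
    by (intros x Hx; rewrite B; auto).
  rewrite (sum_over_ext _ (fun x => Rabs (w' x - v x)) (fun x => Rabs (w' x - u x)))
    by (intros x Hx; rewrite B; auto).
  apply Hb; intros x Hx; rewrite B; auto.
Qed.

Lemma tdef_agree t u v : agree (tfv t) u v -> tdef t u -> tdef t v.
Proof.
  revert u v; induction t; simpl; intros u v A;
    try (assert (A1 : agree (tfv t1) u v)
           by (eapply agree_incl; [|exact A]; auto using incl_appl, incl_refl);
         assert (A2 : agree (tfv t2) u v)
           by (eapply agree_incl; [|exact A]; auto using incl_appr, incl_refl);
         rewrite <- ?(teval_agree _ _ _ A2);
         intuition eauto).
  - auto.
  - auto.
  - rewrite <- (teval_agree _ _ _ A); intuition eauto.
  - assert (A1 : agree (tfv t) u v)
      by (eapply agree_incl; [|exact A]; auto using incl_appl, incl_refl).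
    intuition eauto using frechet_agree.
Qed.

(** * Solutions of differential equations *)

(** A solution is constant outside its system, so moving it to another initial state means
    exchanging that constant background. *)
Definition graft (xs : list var) (u w : state) : state :=
  fun z => if mem z xs then u z else w z.

Lemma graft_in xs u w z : In z xs -> graft xs u w z = u z.
Proof. unfold graft; intros H; apply mem_In in H; now rewrite H. Qed.

Lemma graft_out xs u w z : ~ In z xs -> graft xs u w z = w z.
Proof. unfold graft; intros H; apply mem_notIn in H; now rewrite H. Qed.

Lemma D_in_ext f f' d d' P x :
  (forall s, f s = f' s) -> d x = d' x -> D_in f d P x -> D_in f' d' P x.
Proof.
  unfold D_in; intros Hf Hd H.
  replace f' with f by (apply functional_extensionality; auto).
  now rewrite <- Hd.
Qed.

(** Abstracts what coincidence and substitution have in common: a system is compared with itself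
    from another state, or with its instance. Right-hand sides are compared only on states with the
    background of the respective initial state, which is where solutions stay. *)
Definition ode_similar (ode1 ode2 : list (nat * term)) (w1 w2 : state) : Prop :=
  let xs := odevars ode1 in
  odevars ode2 = xs /\ agree xs w1 w2 /\
  forall u1 u2, agree_off xs u1 w1 -> agree_off xs u2 w2 -> agree xs u1 u2 ->
    Forall2 (fun p1 p2 => fst p1 = fst p2 /\
                          teval (snd p1) u1 = teval (snd p2) u2) ode1 ode2.

Lemma Forall2_sym {X Y} (P : X -> Y -> Prop) (Q : Y -> X -> Prop) l l' :
  (forall x y, P x y -> Q y x) -> Forall2 P l l' -> Forall2 Q l' l.
Proof. induction 2; constructor; auto. Qed.

Lemma Forall2_in_r {X Y} (P : X -> Y -> Prop) l l' y :
  Forall2 P l l' -> In y l' -> exists x, In x l /\ P x y.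
Proof.
  induction 1 as [|a b l l' Hab Hl IH]; simpl; [tauto|]; intros [<-|Hy];
    [|destruct (IH Hy) as (x & ? & ?)]; eauto.
Qed.

Lemma ode_similar_sym ode1 ode2 w1 w2 :
  ode_similar ode1 ode2 w1 w2 -> ode_similar ode2 ode1 w2 w1.
Proof.
  intros (E & A & S); unfold ode_similar; rewrite E.
  split; [|split]; auto using agree_sym.
  intros u2 u1 O2 O1 A12.
  eapply Forall2_sym, (S u1 u2); auto using agree_sym.
  intros ? ? []; auto.
Qed.

Lemma ode_sol_transfer ode1 ode2 w1 w2 T f :
  ode_similar ode1 ode2 w1 w2 -> ode_sol ode1 w1 T f ->
  ode_sol ode2 w2 T (fun t => graft (odevars ode1) (f t) w2).
Proof.
  intros (E & A & S) (F0 & F); split.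
  - apply functional_extensionality; intros z; rewrite F0.
    unfold graft; destruct (mem z _) eqn:M; auto; apply A, mem_In, M.
  - intros t Ht; destruct (F t Ht) as (Fd & Fc); split.
    + intros x e Hxe.
      destruct (Forall2_in_r _ _ _ _
        (S (f t) (graft (odevars ode1) (f t) w2) Fc
           (fun z Hz => graft_out _ _ _ _ Hz)
           (fun z Hz => eq_sym (graft_in _ _ _ _ Hz))) Hxe)
        as ((x1 & e1) & H1 & Hx & He); simpl in Hx, He; subst x1.
      eapply D_in_ext; [| |exact (Fd x e1 H1)]; simpl; auto.
      intros s; rewrite graft_in; auto.
      apply (in_map (fun xe => V (fst xe)) _ _ H1).
    + intros z Hz; rewrite E in Hz; now apply graft_out.
Qed.

(** Uniqueness travels backwards: a competing solution of the second system is grafted onto the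
    first, where it has to equal [f]. *)
Lemma ode_flow_transfer ode1 ode2 w1 w2 T f :
  ode_similar ode1 ode2 w1 w2 -> ode_flow ode1 w1 T f ->
  ode_flow ode2 w2 T (fun t => graft (odevars ode1) (f t) w2).
Proof.
  intros S (HT & Hf & U); split; [|split]; eauto using ode_sol_transfer.
  intros S0 g HS Hg t Ht.
  pose proof (ode_sol_transfer _ _ _ _ _ _ (ode_similar_sym _ _ _ _ S) Hg) as Hg1.
  pose proof (U _ _ HS Hg1 t Ht) as Eg; simpl in Eg.
  destruct S as (E & A & S); rewrite E in Eg.
  apply functional_extensionality; intros z; rewrite <- Eg.
  destruct (in_dec var_eq_dec z (odevars ode1)) as [I|I].
  - now rewrite !graft_in.
  - rewrite graft_out by auto.
    destruct Hg as (_ & Hg); apply (Hg t Ht); now rewrite E.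
Qed.

Lemma ode_sol_restrict ode w T T' f :
  T' <= T -> ode_sol ode w T f -> ode_sol ode w T' f.
Proof.
  intros HT (F0 & F); split; auto; intros t Ht.
  destruct (F t) as (Fd & Fc); [lra|]; split; auto; intros x e Hxe.
  eapply D_in_imp; [|exact (Fd x e Hxe)]; simpl; unfold D_x; intros; intuition lra.
Qed.

Lemma ode_flow_restrict ode w T T' f :
  0 <= T' <= T -> ode_flow ode w T f -> ode_flow ode w T' f.
Proof.
  intros HT (H0 & Hf & U); split; [|split]; [lra| |].
  - eapply ode_sol_restrict; [|exact Hf]; lra.
  - intros S g HS; apply U; lra.
Qed.

Lemma ode_run_transfer ode1 ode2 q1 q2 w1 w2 v1 :
  ode_similar ode1 ode2 w1 w2 ->
  (forall u1 u2, agree_off (odevars ode1) u1 w1 ->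
     agree_off (odevars ode1) u2 w2 -> agree (odevars ode1) u1 u2 ->
     dsem q1 u1 -> dsem q2 u2) ->
  drun (PODE ode1 q1) w1 v1 ->
  drun (PODE ode2 q2) w2 (graft (odevars ode1) v1 w2) /\
  agree_off (odevars ode1) v1 w1.
Proof.
  intros S Hq (T & f & Hf & Q & ->); split.
  - exists T, (fun t => graft (odevars ode1) (f t) w2); split; [|split]; auto.
    + now apply (ode_flow_transfer _ _ _ _ _ _ S).
    + intros t Ht; apply (Hq (f t)).
      * intros z Hz; destruct Hf as (_ & (_ & Hf) & _); now apply (Hf t Ht).
      * intros z Hz; now apply graft_out.
      * intros z Hz; symmetry; now apply graft_in.
      * now apply Q.
  - intros z Hz; destruct Hf as (HT & (_ & Hf) & _); apply (Hf T); auto; lra.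
Qed.

(** * Free and bound variables *)

Lemma mbv_incl_bv {T A} (a : prog T A Empty_set) : incl (mbv a) (bv a).
Proof.
  unfold mbv, bv; induction a; simpl; auto using incl_refl, incl_nil_l.
  - intros z; rewrite !in_app_iff; intuition.
  - intros z; rewrite filter_In, !in_app_iff; intuition.
  - apply incl_appl, incl_refl.
Qed.

Lemma fv_incl_vars :
  (forall p : dfml, incl (ffv p) (fvars tfv p)) /\
  (forall a : dprog, incl (pfv a) (pvars tfv a)).
Proof.
  apply fml_prog_ind; simpl; intros; try contradiction;
    try match goal with e : Empty_set |- _ => destruct e end;
    auto using incl_refl, incl_nil_l, incl_app, incl_appl, incl_appr, incl_tl;
    intros z; rewrite ?in_app_iff, ?in_minus, ?in_app_iff; simpl; intuition.
Qed.

Lemma bv_incl_vars (a : dprog) : incl (bv a) (pvars tfv a).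
Proof.
  unfold bv; induction a; simpl; auto using incl_nil_l.
  - destruct p.
  - intros z; simpl; intuition.
  - apply incl_refl.
  - intros z; rewrite !in_app_iff; intuition.
  - intros z; rewrite !in_app_iff; intuition.
  - intros z; rewrite !in_app_iff; intuition.
Qed.

Lemma bound_effect (a : dprog) : forall w v, drun a w v -> agree_off (bv a) v w.
Proof.
  unfold drun, bv; induction a; simpl; intros w v.
  - destruct p.
  - intros -> z Hz; apply upd_other; intros ->; apply Hz; simpl; auto.
  - intros (r & ->) z Hz; apply upd_other; intros ->; apply Hz; simpl; auto.
  - intros (-> & _) z Hz; auto.
  - intros (u & H1 & H2) z Hz; rewrite in_app_iff in Hz.
    rewrite (IHa2 _ _ H2), (IHa1 _ _ H1); intuition.
  - intros [H|H] z Hz; rewrite in_app_iff in Hz;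
      [apply (IHa1 _ _ H) | apply (IHa2 _ _ H)]; intuition.
  - intros H; induction H as [w v H| |w u v _ IH1 _ IH2]; intros z Hz; auto.
    + now apply (IHa _ _ H).
    + now rewrite IH2, IH1.
  - intros (T & f & Hf & Q & ->) z Hz; rewrite in_app_iff in Hz.
    destruct Hf as (HT & (_ & Hf) & _); apply (Hf T); intuition lra.
Qed.

(** The part on programs allows any [X] containing the free variables, so that in a sequence [X] can
    be enlarged by what the first program must bind before the second is treated. *)
Lemma coincidence :
  (forall (p : dfml) u v, agree (ffv p) u v -> dsem p u -> dsem p v) /\
  (forall (a : dprog) X u v u', incl (pfv a) X -> agree X u v -> drun a u u' ->
     exists v', drun a v v' /\ agree (mbv a ++ X) u' v').
Proof.
  unfold dsem, drun, mbv; apply fml_prog_ind; simpl.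
  - intros [].
  - intros c s t u v A.
    rewrite (teval_agree s u v), (teval_agree t u v); auto;
      eapply agree_incl; try exact A; auto using incl_appl, incl_appr, incl_refl.
  - intros p IHp q IHq u v A (Hp & Hq); split; [eapply IHp|eapply IHq]; eauto;
      eapply agree_incl; try exact A; auto using incl_appl, incl_appr, incl_refl.
  - intros p IHp q IHq u v A [H|H]; [left; eapply IHp|right; eapply IHq]; eauto;
      eapply agree_incl; try exact A; auto using incl_appl, incl_appr, incl_refl.
  - intros p IHp u v A H C; apply H; eapply IHp; eauto using agree_sym.
  - intros x p IHp u v A H r; eapply IHp, H; now apply agree_upd_cons.
  - intros x p IHp u v A (r & H); exists r; eapply IHp, H; now apply agree_upd_cons.
  - intros a IHa p IHp u v A H v' Hv'.
    destruct (IHa _ v u v' (incl_appl _ (incl_refl _)) (agree_sym _ _ _ A) Hv')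
      as (u' & Hu' & A').
    eapply IHp; [|apply H, Hu']; apply agree_sym.
    eapply agree_incl; [|exact A']; intros z Hz.
    rewrite !in_app_iff, in_minus.
    destruct (in_dec var_eq_dec z (mbv a)); tauto.
  - intros a IHa p IHp u v A (u' & Hu' & H).
    destruct (IHa _ u v u' (incl_appl _ (incl_refl _)) A Hu') as (v' & Hv' & A').
    exists v'; split; auto; eapply IHp; [|exact H].
    eapply agree_incl; [|exact A']; intros z Hz.
    rewrite !in_app_iff, in_minus.
    destruct (in_dec var_eq_dec z (mbv a)); tauto.
  - intros [].
  - intros x t X u v u' I A ->; eexists; split; [reflexivity|].
    rewrite (teval_agree t u v) by (eapply agree_incl; eauto).
    intros z [<-|Hz]; unfold upd; destruct var_eq_dec; auto; congruence.
  - intros x X u v u' I A (r & ->); eexists; split; [eexists; reflexivity|].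
    intros z [<-|Hz]; unfold upd; destruct var_eq_dec; auto; congruence.
  - intros p IHp X u v u' I A (-> & H); exists v; repeat split; auto.
    eapply IHp, H; eapply agree_incl; eauto.
  - intros a IHa b IHb X u v u' I A (m & H1 & H2).
    destruct (IHa X u v m) as (m' & H1' & A1); auto.
    { intros z Hz; apply I, in_or_app; auto. }
    destruct (IHb (mbv_gen absurd_atom a ++ X) m m' u') as (v' & H2' & A2); auto.
    { intros z Hz; rewrite in_app_iff.
      destruct (in_dec var_eq_dec z (mbv a)); auto.
      right; apply I, in_or_app; right; apply in_minus; auto. }
    exists v'; split; eauto.
    eapply agree_incl; [|exact A2]; intros z; rewrite !in_app_iff; tauto.
  - intros a IHa b IHb X u v u' I A [H|H];
      [destruct (IHa X u v u') as (v' & H' & A') |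
       destruct (IHb X u v u') as (v' & H' & A')]; auto;
      try (intros z Hz; apply I, in_or_app; auto);
      exists v'; split; auto; eapply agree_incl; try exact A'; intros z;
      rewrite !in_app_iff, filter_In, ?mem_In; tauto.
  (* Iterations preserve agreement on the fixed set [X]; a loop need not run, so [mbv] contributes
     nothing. *)
  - intros a IHa X u v u' I A H.
    enough (exists v', clos_refl_trans _ (psem absurd_atom a) v v' /\ agree X u' v')
      by eauto.
    revert v A; induction H as [u u' H|u|u m u' _ IH1 _ IH2]; intros v A.
    + destruct (IHa X u v u' I A H) as (v' & Hv & A').
      exists v'; split; [now apply rt_step|].
      eapply agree_incl; [|exact A']; auto using incl_appr, incl_refl.
    + exists v; split; auto; apply rt_refl.
    + destruct (IH1 v A) as (m' & H1 & A1), (IH2 m' A1) as (v' & H2 & A2).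
      exists v'; split; auto; eapply rt_trans; eauto.
  - intros ode q IHq X u v u' I A H.
    assert (A' : forall u1 u2, agree_off (odevars ode) u1 u ->
        agree_off (odevars ode) u2 v -> agree (odevars ode) u1 u2 -> agree X u1 u2).
    { intros u1 u2 O1 O2 A12 z Hz.
      destruct (in_dec var_eq_dec z (odevars ode)) as [J|J]; auto.
      rewrite O1, O2; auto. }
    destruct (ode_run_transfer ode ode q q u v u') as (R & O); auto.
    + split; [|split]; auto.
      * eapply agree_incl; [|exact A]; intros z Hz; apply I, in_or_app; auto.
      * intros u1 u2 O1 O2 A12; specialize (A' u1 u2 O1 O2 A12).
        assert (F : incl (flat_map (fun xe => tfv (snd xe)) ode) X)
          by (intros z Hz; apply I; rewrite !in_app_iff; auto).
        clear - F A'; induction ode as [|xe ode IH]; constructor.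
        -- split; auto; apply teval_agree; eapply agree_incl; [|exact A'].
           intros z Hz; apply F; simpl; apply in_or_app; auto.
        -- apply IH; intros z Hz; apply F; simpl; apply in_or_app; auto.
    + intros u1 u2 O1 O2 A12; apply IHq.
      eapply agree_incl; [|apply A'; eauto].
      intros z Hz; apply I; rewrite !in_app_iff; auto.
    + eexists; split; [exact R|].
      intros z Hz; destruct (in_dec var_eq_dec z (odevars ode)) as [J|J].
      * now rewrite graft_in.
      * rewrite graft_out, O by auto; apply A; rewrite in_app_iff in Hz; tauto.
Qed.

Lemma dsem_agree p u v : agree (ffv p) u v -> dsem p u <-> dsem p v.
Proof. split; apply coincidence; auto using agree_sym. Qed.

Lemma dsem_agree_off l p u v :
  agree_off l u v -> (forall x, In x l -> ~ In x (fvars tfv p)) ->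
  dsem p u <-> dsem p v.
Proof.
  intros O F; apply dsem_agree; intros z Hz; apply O; intros I.
  now apply (F z I), fv_incl_vars.
Qed.

Lemma drun_agree_off l a u v u' :
  agree_off l u v -> (forall x, In x l -> ~ In x (pvars tfv a)) -> drun a u u' ->
  exists v', drun a v v' /\ agree_off l u' v'.
Proof.
  intros O F H.
  (* Bound variables outside [l] are added to the set: they agree initially, hence finally, even if
     [a] binds them on some paths only. Unbound variables keep their values anyway. *)
  destruct (proj2 coincidence a (pfv a ++ minus (bv a) l) u v u')
    as (v' & Hv & A); auto using incl_appl, incl_refl.
  { intros z Hz; apply O; intros I; apply in_app_or in Hz as [Hz|Hz].
    - now apply (F z I), fv_incl_vars.
    - now apply in_minus in Hz. }
  exists v'; split; auto; intros z Hz.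
  destruct (in_dec var_eq_dec z (bv a)) as [B|B].
  - apply A; rewrite !in_app_iff, in_minus; auto.
  - rewrite (bound_effect _ _ _ H), (bound_effect _ _ _ Hv); auto.
Qed.

(** * Substitution *)

(** An expression is evaluated in [w], its instance under [s] in [w']. *)
Definition simul (s : var -> term) (B M : list var) (w w' : state) : Prop :=
  forall x t, vsub s B M x = Some t -> w x = teval t w'.

Lemma is_var_spec x t : is_var x t = true <-> t = TVar x.
Proof.
  destruct t; simpl; try (split; discriminate).
  destruct var_eq_dec as [->|N]; split; unfold TVar; congruence.
Qed.

Lemma vfix_simul s B M w w' x :
  simul s B M w w' -> vfix s B M x = true -> w x = w' x.
Proof.
  unfold vfix; intros S H; destruct (vsub s B M x) as [t|] eqn:E; [|discriminate].
  apply is_var_spec in H; subst t; apply (S _ _ E).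
Qed.

(** The value of (a)' depends on partial derivatives and on differential variables, which a
    replacement by terms does not respect. Accepted leaves are therefore fixed together with their
    differential variables, and the term itself is unchanged. *)
Lemma otmap_vdiff s B M w w' t t' :
  simul s B M w w' -> otmap (vdiff s B M) t = Some t' ->
  t' = t /\ forall x, In x (tfv t) ->
    w x = w' x /\ match x with V n => w (D n) = w' (D n) | D _ => True end.
Proof.
  intros S; revert t'; induction t; simpl; intros t' H; binv;
    injection H as <-;
    try (destruct (IHt1 _ E) as [-> H1]; destruct (IHt2 _ E0) as [-> H2];
         split; auto; intros x Hx; apply in_app_or in Hx as [Hx|Hx]; auto).
  - unfold vdiff in E; destruct (_ && _)%bool eqn:F; [|discriminate].
    injection E as <-; apply andb_prop in F as [F1 F2].
    split; auto; intros x [<-|[]]; split; [eapply vfix_simul; eauto|].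
    destruct l; auto; eapply vfix_simul; eauto.
  - split; auto; intros x [].
  - destruct (IHt _ E) as [-> H1]; auto.
  - destruct (IHt _ E) as [-> H1]; split; auto; intros x Hx.
    apply in_app_or in Hx as [Hx|Hx]; auto.
    apply in_map_iff in Hx as (n & <- & Hn); apply in_bases in Hn.
    split; auto; now apply (H1 _ Hn).
Qed.

Lemma tsub_sound s B M w w' t t' :
  simul s B M w w' -> tsub_at s B M t = Some t' -> teval t w = teval t' w'.
Proof.
  unfold tsub_at; intros S; revert t'; induction t; intros t' H;
    try (simpl in H; binv; injection H as <-; simpl;
         try (rewrite (IHt1 _ E), (IHt2 _ E0)); try (rewrite (IHt _ E)); reflexivity).
  - apply (S _ _ H).
  - simpl in H; binv; injection H as <-.
    destruct (otmap_vdiff _ _ _ _ _ _ _ S E) as (-> & A).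
    apply teval_agree; intros x Hx; simpl in Hx; apply in_app_or in Hx as [Hx|Hx].
    + now apply A.
    + apply in_map_iff in Hx as (n & <- & Hn); apply in_bases in Hn.
      now apply (A _ Hn).
Qed.

Lemma simul_init s w : simul s [] [] (fun x => teval (s x) w) w.
Proof.
  intros x t; unfold vsub, chk; simpl.
  destruct disjoint; intros H; now inversion H.
Qed.

(** A variable in [Y] has been rebound and is left alone by [vsub], so equal values suffice. Any
    other variable keeps its value, and so does its replacement term: admissibility keeps the
    variables of that term out of [B'], hence out of [Y]. *)
Lemma simul_bind s B M B' M' Y w w' v v' :
  simul s B M w w' -> incl M B ->
  agree_off Y v w -> agree_off Y v' w' -> agree Y v v' ->
  incl (Y ++ B) B' -> incl M' (Y ++ M) -> simul s B' M' v v'.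
Proof.
  intros S MB O O' A HB HM y t H.
  destruct (in_dec var_eq_dec y Y) as [Iy|Iy].
  - assert (t = TVar y) as ->; [|now apply A].
    assert (E : mem y B' = true) by (apply mem_In, HB, in_or_app; auto).
    unfold vsub in H; rewrite E in H; destruct (mem y M'); [congruence|].
    destruct (is_var _ _); congruence.
  - rewrite (O y Iy).
    (* An unmoved [y] outside [Y] was already unmoved under the old lists [B] and [M], so the old
       relation applies to it. *)
    assert (Fix : t = TVar y -> (In y M \/ is_var y (s y) = true) -> w y = teval t v').
    { intros -> F; change (w y = v' y); rewrite (O' y Iy); apply (S y (TVar y)).
      unfold vsub; destruct (mem y M) eqn:EM; auto.
      destruct F as [F|F]; [apply mem_In in F; congruence|].
      rewrite F; destruct (mem y B) eqn:EB; auto.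
      apply is_var_spec in F; rewrite F; unfold chk; simpl.
      now rewrite EB. }
    unfold vsub in H; destruct (mem y M') eqn:EM'.
    + injection H as <-; apply Fix; auto; left.
      apply mem_In, HM, in_app_or in EM' as []; tauto.
    + destruct (mem y B') eqn:EB'.
      * destruct is_var eqn:E; [|discriminate]; injection H as <-; auto.
      * unfold chk in H; destruct disjoint eqn:ED; [|discriminate].
        injection H as <-; rewrite disjoint_spec in ED.
        apply mem_notIn in EB'.
        transitivity (teval (s y) w').
        -- apply S; unfold vsub, chk.
           replace (mem y M) with false; [replace (mem y B) with false|];
             try (symmetry; apply mem_notIn; intros J; apply EB', HB, in_or_app; auto).
           replace (disjoint _ _) with true; auto; symmetry; apply disjoint_spec.
           intros x Hx J; apply (ED x Hx), HB, in_or_app; auto.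
        -- apply teval_agree; intros x Hx; symmetry; apply O'; intros J.
           apply (ED x Hx), HB, in_or_app; auto.
Qed.

Lemma simul_weaken s B M B' M' w w' :
  simul s B M w w' -> incl M B -> incl B B' -> incl M' M -> simul s B' M' w w'.
Proof.
  intros S I IB IM; eapply (simul_bind s B M B' M' [] w w'); eauto;
    try (intros x _; reflexivity); intros x [].
Qed.

Lemma simul_upd s B M w w' x r :
  simul s B M w w' -> incl M B ->
  simul s (x :: B) (x :: M) (upd w x r) (upd w' x r).
Proof.
  intros S I; eapply (simul_bind s B M _ _ [x]); eauto; simpl;
    auto using incl_refl.
  - intros z Hz; apply upd_other; simpl in Hz; intuition.
  - intros z Hz; apply upd_other; simpl in Hz; intuition.
  - intros z [<-|[]]; now rewrite !upd_same.
Qed.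

Lemma incl_cons2 (x : var) M B : incl M B -> incl (x :: M) (x :: B).
Proof. intros I z [<-|H]; simpl; auto. Qed.

Lemma incl_mbv {T A} (a : prog T A Empty_set) M B :
  incl M B -> incl (mbv a ++ M) (bv a ++ B).
Proof.
  intros I z Hz; apply in_app_or in Hz as [Hz|Hz]; apply in_or_app; auto.
  left; now apply mbv_incl_bv.
Qed.

Section SubstSound.
  Variable s : var -> term.
  Notation ft := (ftrav0 (tsub_at s) (osub s)).
  Notation pt := (ptrav0 (tsub_at s) (osub s)).

  Definition simulates (R : state -> state -> Prop) (P P' : state -> Prop) : Prop :=
    (forall v, P v -> exists v', P' v' /\ R v v') /\
    (forall v', P' v' -> exists v, P v /\ R v v').

  (** [osub] forces both systems to start from equal values. Inside, [B] grows by x and x', but only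
      x moves during a run, so the binder step is taken with [odevars] alone. *)
  Lemma ode_simul B M w w' ode ode' q q' :
    (forall B M q' w w', ft B M q = Some q' -> incl M B -> simul s B M w w' ->
       (dsem q w <-> dsem q' w')) ->
    pt B M (PODE ode q) = Some (PODE ode' q') -> incl M B -> simul s B M w w' ->
    ode_similar ode ode' w w' /\
    (forall u u', agree_off (odevars ode) u w ->
       agree_off (odevars ode) u' w' -> agree (odevars ode) u u' ->
       (dsem q u <-> dsem q' u')).
  Proof.
    intros IHq H I S; unfold ptrav0 in H; simpl in H.
    destruct forallb eqn:F; [|discriminate].
    binv; injection H as -> ->; rename E into Eo, E0 into Eq.
    rewrite forallb_forall in F.
    apply omap_Forall2 in Eo.
    remember (odevars ode ++ odediffs ode ++ B) as B' eqn:EB'.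
    assert (S' : forall u u', agree_off (odevars ode) u w ->
        agree_off (odevars ode) u' w' -> agree (odevars ode) u u' ->
        simul s B' M u u').
    { intros u u' O O' A; eapply (simul_bind s B M _ _ (odevars ode)); eauto.
      - subst B'; intros z; rewrite !in_app_iff; tauto.
      - apply incl_appr, incl_refl. }
    assert (I' : incl M B') by (subst B'; intros z Hz; rewrite !in_app_iff; auto).
    split; [split; [|split]|].
    - clear - Eo; induction Eo as [|[x e] [x' e'] l l' H Hl IH]; auto; simpl in *.
      binv; injection H as <- ->; simpl; now rewrite IH.
    - intros z Hz; apply (S z (TVar z)); specialize (F z Hz); unfold osub in F.
      unfold vsub; destruct (mem z M); auto; simpl in F; rewrite F.
      apply is_var_spec in F; rewrite F.
      destruct (mem z B) eqn:EB; auto; unfold chk; simpl; now rewrite EB.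
    - intros u u' O O' A; specialize (S' u u' O O' A).
      clear - Eo S'; induction Eo as [|[x e] [x' e'] l l' H Hl IH]; constructor; auto.
      simpl in *; binv; injection H as <- ->; split; auto.
      eapply tsub_sound; eauto.
    - intros u u' O O' A; eapply IHq; eauto.
  Qed.

  (** The substitution lemma as a bisimulation. The relation after a program carries the enlarged
      lists, which is exactly how the traversal treats what follows the program. *)
  Lemma simul_sound :
    (forall (p : dfml) B M p' w w', ft B M p = Some p' -> incl M B ->
       simul s B M w w' -> (dsem p w <-> dsem p' w')) /\
    (forall (a : dprog) B M a' w w', pt B M a = Some a' -> incl M B ->
       simul s B M w w' ->
       simulates (simul s (bv a ++ B) (mbv a ++ M)) (drun a w) (drun a' w')).
  Proof.
    apply fml_prog_ind.
    - intros [].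
    - intros c t1 t2 B M p' w w' H I S; unfold ftrav0 in H; simpl in H; binv.
      injection H as <-; unfold dsem; simpl.
      rewrite (tsub_sound _ _ _ _ _ _ _ S E), (tsub_sound _ _ _ _ _ _ _ S E0); tauto.
    - intros p IHp q IHq B M p' w w' H I S; unfold ftrav0 in H; simpl in H; binv.
      injection H as <-.
      specialize (IHp _ _ _ _ _ E I S); specialize (IHq _ _ _ _ _ E0 I S).
      unfold dsem in *; simpl; tauto.
    - intros p IHp q IHq B M p' w w' H I S; unfold ftrav0 in H; simpl in H; binv.
      injection H as <-.
      specialize (IHp _ _ _ _ _ E I S); specialize (IHq _ _ _ _ _ E0 I S).
      unfold dsem in *; simpl; tauto.
    - intros p IHp B M p' w w' H I S; unfold ftrav0 in H; simpl in H; binv.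
      injection H as <-; specialize (IHp _ _ _ _ _ E I S).
      unfold dsem in *; simpl; tauto.
    - intros x p IHp B M p' w w' H I S; unfold ftrav0 in H; simpl in H; binv.
      injection H as <-.
      assert (K : forall z, dsem p (upd w x z) <-> dsem r (upd w' x z))
        by (intros z; eapply IHp; eauto using incl_cons2, simul_upd).
      unfold dsem in *; simpl; split; intros H z; apply K, H.
    - intros x p IHp B M p' w w' H I S; unfold ftrav0 in H; simpl in H; binv.
      injection H as <-.
      assert (K : forall z, dsem p (upd w x z) <-> dsem r (upd w' x z))
        by (intros z; eapply IHp; eauto using incl_cons2, simul_upd).
      unfold dsem in *; simpl; split; intros (z & H); exists z; apply K, H.
    - intros a IHa p IHp B M p' w w' H I S; unfold ftrav0 in H; simpl in H; binv.
      injection H as <-.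
      destruct (IHa _ _ _ _ _ E I S) as (K1 & K2).
      split; intros H v Hv.
      + destruct (K2 v Hv) as (v' & Hv' & S').
        eapply (IHp _ _ _ _ _ E0 (incl_mbv _ _ _ I) S'), H, Hv'.
      + destruct (K1 v Hv) as (v' & Hv' & S').
        eapply (IHp _ _ _ _ _ E0 (incl_mbv _ _ _ I) S'), H, Hv'.
    - intros a IHa p IHp B M p' w w' H I S; unfold ftrav0 in H; simpl in H; binv.
      injection H as <-.
      destruct (IHa _ _ _ _ _ E I S) as (K1 & K2).
      split; intros (v & Hv & H).
      + destruct (K1 v Hv) as (v' & Hv' & S'); exists v'; split; auto.
        eapply (IHp _ _ _ _ _ E0 (incl_mbv _ _ _ I) S'), H.
      + destruct (K2 v Hv) as (v' & Hv' & S'); exists v'; split; auto.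
        eapply (IHp _ _ _ _ _ E0 (incl_mbv _ _ _ I) S'), H.
    - intros [].
    - intros x t B M a' w w' H I S; unfold ptrav0 in H; simpl in H; binv.
      injection H as <-; unfold drun, bv, mbv; simpl.
      pose proof (tsub_sound _ _ _ _ _ _ _ S E) as Et.
      split; intros v ->; eexists; (split; [reflexivity|]); rewrite Et;
        now apply simul_upd.
    - intros x B M a' w w' H I S; unfold ptrav0 in H; simpl in H.
      injection H as <-; unfold drun, bv, mbv; simpl.
      split; intros v (z & ->); eexists; (split; [exists z; reflexivity|]);
        now apply simul_upd.
    - intros p IHp B M a' w w' H I S; unfold ptrav0 in H; simpl in H; binv.
      injection H as <-; specialize (IHp _ _ _ _ _ E I S).
      unfold drun, bv, mbv; simpl.
      split; intros v (-> & H); eexists; (split; [split; [reflexivity|]|]); auto;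
        now apply IHp.
    - intros a IHa b IHb B M a' w w' H I S; unfold ptrav0 in H; simpl in H; binv.
      injection H as <-.
      destruct (IHa _ _ _ _ _ E I S) as (K1 & K2).
      assert (W : forall v v', simul s (bv b ++ bv a ++ B) (mbv b ++ mbv a ++ M) v v' ->
          simul s (bv (PSeq a b) ++ B) (mbv (PSeq a b) ++ M) v v').
      { intros v v' Sv; eapply simul_weaken; eauto using incl_mbv;
          unfold bv, mbv; simpl; intros z; rewrite !in_app_iff; tauto. }
      split; intros v (u & Hu & Hv).
      + destruct (K1 u Hu) as (u' & Hu' & Su).
        destruct (IHb _ _ _ _ _ E0 (incl_mbv _ _ _ I) Su) as (L1 & L2).
        destruct (L1 v Hv) as (v' & Hv' & Sv).
        exists v'; split; [exists u'; auto|auto].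
      + destruct (K2 u Hu) as (u' & Hu' & Su).
        destruct (IHb _ _ _ _ _ E0 (incl_mbv _ _ _ I) Su) as (L1 & L2).
        destruct (L2 v Hv) as (v' & Hv' & Sv).
        exists v'; split; [exists u'; auto|auto].
    - intros a IHa b IHb B M a' w w' H I S; unfold ptrav0 in H; simpl in H; binv.
      injection H as <-.
      destruct (IHa _ _ _ _ _ E I S) as (K1 & K2), (IHb _ _ _ _ _ E0 I S) as (L1 & L2).
      assert (W1 : forall v v', simul s (bv a ++ B) (mbv a ++ M) v v' ->
          simul s (bv (PChoice a b) ++ B) (mbv (PChoice a b) ++ M) v v').
      { intros v v' Sv; eapply simul_weaken; eauto using incl_mbv;
          unfold bv, mbv; simpl; intros z; rewrite !in_app_iff, ?filter_In; tauto. }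
      assert (W2 : forall v v', simul s (bv b ++ B) (mbv b ++ M) v v' ->
          simul s (bv (PChoice a b) ++ B) (mbv (PChoice a b) ++ M) v v').
      { intros v v' Sv; eapply simul_weaken; eauto using incl_mbv;
          unfold bv, mbv; simpl; intros z; rewrite !in_app_iff, ?filter_In, ?mem_In;
          tauto. }
      split; intros v [Hv|Hv];
        [destruct (K1 v Hv) as (v' & Hv' & Sv) | destruct (L1 v Hv) as (v' & Hv' & Sv)|
         destruct (K2 v Hv) as (v' & Hv' & Sv) | destruct (L2 v Hv) as (v' & Hv' & Sv)];
        exists v'; (split; [first [left; exact Hv' | right; exact Hv']|auto]).
    - intros a IHa B M a' w w' H I S; unfold ptrav0 in H; simpl in H; binv.
      injection H as <-.
      assert (I' : incl M (bv a ++ B)) by (apply incl_appr, I).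
      (* The relation is first weakened to one that an iteration preserves: whatever the body may
         bind counts as possibly bound from the start, and [M] does not grow since the loop may run
         zero times. *)
      assert (S0 : simul s (bv a ++ B) M w w')
        by (eapply simul_weaken; eauto using incl_refl, incl_appr).
      assert (W : forall v v',
          simul s (bv a ++ bv a ++ B) (mbv a ++ M) v v' -> simul s (bv a ++ B) M v v').
      { intros v v' Sv; eapply simul_weaken; eauto using incl_mbv;
          intros z; rewrite !in_app_iff; tauto. }
      unfold drun, bv, mbv in *; simpl in *; clear S.
      split; intros v H.
      + revert w' S0; induction H as [w v H|w|w u v _ IH1 _ IH2]; intros w' S0.
        * destruct (proj1 (IHa _ _ _ _ _ E I' S0) v H) as (v' & Hv' & Sv).
          exists v'; split; auto; now apply rt_step.
        * exists w'; split; auto; apply rt_refl.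
        * destruct (IH1 _ S0) as (u' & Hu & Su), (IH2 _ Su) as (v' & Hv & Sv).
          exists v'; split; auto; eapply rt_trans; eauto.
      + revert w S0; induction H as [w v H|w|w u v _ IH1 _ IH2]; intros w' S0.
        * destruct (proj2 (IHa _ _ _ _ _ E I' S0) v H) as (v' & Hv' & Sv).
          exists v'; split; auto; now apply rt_step.
        * exists w'; split; auto; apply rt_refl.
        * destruct (IH1 _ S0) as (u' & Hu & Su), (IH2 _ Su) as (v' & Hv & Sv).
          exists v'; split; auto; eapply rt_trans; eauto.
    - intros ode q IHq B M a' w w' H I S.
      assert (Ha : exists ode' q', a' = PODE ode' q').
      { unfold ptrav0 in H; simpl in H; destruct forallb; [|discriminate]; binv.
        injection H as <-; eauto. }
      destruct Ha as (ode' & q' & ->).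
      destruct (ode_simul _ _ _ _ _ _ _ _ IHq H I S) as (So & Sq).
      assert (Eo : odevars ode' = odevars ode) by apply So.
      assert (Sg : forall v v', agree_off (odevars ode) v w ->
          agree_off (odevars ode) v' w' -> agree (odevars ode) v v' ->
          simul s (bv (PODE ode q) ++ B) (mbv (PODE ode q) ++ M) v v').
      { intros v v' O O' A; eapply (simul_bind s B M _ _ (odevars ode)); eauto;
          unfold bv, mbv; simpl; intros z; rewrite !in_app_iff; tauto. }
      split; intros v Hv.
      + destruct (ode_run_transfer ode ode' q q' w w' v) as (Hr & O); auto.
        { intros u u' O O' A; now apply Sq. }
        eexists; split; [exact Hr|]; apply Sg; auto.
        * intros z Hz; now apply graft_out.
        * intros z Hz; symmetry; now apply graft_in.
      + destruct (ode_run_transfer ode' ode q' q w' w v) as (Hr & O); auto.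
        { now apply ode_similar_sym. }
        { rewrite Eo; intros u u' O O' A; apply Sq; auto using agree_sym. }
        rewrite Eo in *.
        eexists; split; [exact Hr|]; apply Sg; auto.
        * intros z Hz; now apply graft_out.
        * intros z Hz; now apply graft_in.
  Qed.
End SubstSound.

Definition subst_state (l : list (var * term)) (w : state) : state :=
  fun x => teval (sigma l x) w.

Lemma fsubst_sound l p p' w :
  fsubst l p = Some p' -> dsem p' w <-> dsem p (subst_state l w).
Proof.
  intros H; symmetry.
  eapply (proj1 (simul_sound (sigma l))); eauto using incl_refl, simul_init.
Qed.

Lemma tsubst_sound l t t' w :
  tsubst l t = Some t' -> teval t' w = teval t (subst_state l w).
Proof. intros H; symmetry; eapply tsub_sound; eauto using simul_init. Qed.

Lemma subst_state_one x t w : subst_state [(x, t)] w = upd w x (teval t w).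
Proof.
  apply functional_extensionality; intros z; unfold subst_state, sigma, upd; simpl.
  destruct var_eq_dec; reflexivity.
Qed.

(** * Calculus on an interval *)

Definition within0 (T : R) : R -> Prop := fun s => 0 <= s <= T.

(** Solutions are controlled only on [0,T]. Freezing the argument at the end points turns one-sided
    continuity there into continuity on the whole line, as the mean value theorem and integration
    ask for. *)
Definition clamp (T s : R) : R := Rmax 0 (Rmin s T).

Lemma clamp_id T s : 0 <= s <= T -> clamp T s = s.
Proof. intros H; unfold clamp; rewrite Rmin_left, Rmax_right; lra. Qed.

Lemma clamp_range T s : 0 <= T -> 0 <= clamp T s <= T.
Proof. unfold clamp, Rmax, Rmin; intros; repeat destruct Rle_dec; lra. Qed.

Lemma clamp_lipschitz T s t : Rabs (clamp T s - clamp T t) <= Rabs (s - t).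
Proof.
  unfold clamp, Rmax, Rmin; repeat destruct Rle_dec; unfold Rabs;
    repeat destruct Rcase_abs; lra.
Qed.

Definition cont_on (T : R) (h : R -> R) : Prop :=
  forall t, 0 <= t <= T -> forall eps, 0 < eps -> exists del, 0 < del /\
    forall s, 0 <= s <= T -> Rabs (s - t) < del -> Rabs (h s - h t) < eps.

Lemma cont_on_clamp T h :
  0 <= T -> cont_on T h -> forall s, continuity_pt (fun s => h (clamp T s)) s.
Proof.
  intros HT C s eps He.
  destruct (C (clamp T s) (clamp_range T s HT) eps He) as (del & Hd & H).
  exists del; split; auto; intros x (_ & Hx); simpl in *; unfold R_dist in *.
  apply H; auto using clamp_range.
  eapply Rle_lt_trans; [apply clamp_lipschitz|auto].
Qed.

Lemma D_in_cont_on T h d :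
  (forall t, 0 <= t <= T -> D_in h d (within0 T) t) -> cont_on T h.
Proof.
  intros H t Ht eps He.
  destruct (cont_deriv h d _ t (H t Ht) eps He) as (del & Hd & C).
  exists del; split; auto; intros s Hs Hst.
  destruct (Req_dec s t) as [->|N].
  - now rewrite Rminus_diag, Rabs_R0.
  - apply (C s); split; [split|]; auto.
Qed.

Lemma D_in_interior T h d t :
  0 < t < T -> D_in h d (within0 T) t -> derivable_pt_lim h t (d t).
Proof.
  intros Ht H eps He.
  destruct (H eps He) as (del & Hd & C).
  assert (Hm : 0 < Rmin del (Rmin t (T - t))) by (repeat apply Rmin_pos; lra).
  exists (mkposreal _ Hm); simpl; intros x Nx Hx.
  assert (L1 := Rmin_l del (Rmin t (T - t))); assert (L2 := Rmin_r del (Rmin t (T - t))).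
  assert (L3 := Rmin_l t (T - t)); assert (L4 := Rmin_r t (T - t)).
  specialize (C (t + x)); simpl in C; unfold R_dist in C.
  replace (t + x - t) with x in C by ring; apply C.
  assert (Hx' : Rabs x < Rmin t (T - t)) by lra.
  apply Rabs_def2 in Hx'.
  split; [split; [unfold within0; lra | lra] | lra].
Qed.

Lemma D_in_mean_value T h d :
  0 <= T -> (forall t, 0 <= t <= T -> D_in h d (within0 T) t) ->
  exists c, 0 <= c <= T /\ h T - h 0 = d c * T.
Proof.
  intros HT H.
  destruct (MVT_gen (fun s => h (clamp T s)) 0 T d) as (c & Hc & E).
  - rewrite Rmin_left, Rmax_right by lra; intros x Hx.
    apply is_derive_Reals.
    apply derivable_pt_lim_locally_ext with (f := h) (a := 0) (b := T); auto.
    + intros z Hz; rewrite clamp_id; lra.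
    + eapply D_in_interior; eauto; apply H; lra.
  - intros x _; apply cont_on_clamp; auto; eapply D_in_cont_on; eauto.
  - rewrite Rmin_left, Rmax_right in Hc by lra.
    exists c; split; auto.
    rewrite !clamp_id in E by lra; lra.
Qed.

Lemma D_in_nondecreasing T h d :
  0 <= T -> (forall t, 0 <= t <= T -> D_in h d (within0 T) t) ->
  (forall t, 0 <= t <= T -> 0 <= d t) -> h 0 <= h T.
Proof.
  intros HT H Hd; destruct (D_in_mean_value T h d HT H) as (c & Hc & E).
  specialize (Hd c Hc); nra.
Qed.

Lemma D_in_constant T h d :
  0 <= T -> (forall t, 0 <= t <= T -> D_in h d (within0 T) t) ->
  (forall t, 0 <= t <= T -> d t = 0) -> h T = h 0.
Proof.
  intros HT H Hd; destruct (D_in_mean_value T h d HT H) as (c & Hc & E).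
  rewrite (Hd c Hc) in E; lra.
Qed.

Lemma D_in_shrink T T' h d t :
  T' <= T -> D_in h d (within0 T) t -> D_in h d (within0 T') t.
Proof.
  intros HT; apply D_in_imp; unfold D_x, within0; intros; intuition lra.
Qed.

(** * The chain rule for terms *)

Lemma limit1_in_sum xs (F : var -> R -> R) (l : var -> R) P x0 :
  (forall x, In x xs -> limit1_in (F x) P (l x) x0) ->
  limit1_in (fun s => sum_over xs (fun x => F x s)) P (sum_over xs l) x0.
Proof.
  induction xs as [|x xs IH]; simpl; intros H.
  - apply (limit_free (fun _ => 0) P x0 x0).
  - apply limit_plus; auto.
Qed.

Lemma limit1_in_Rabs F P l x0 :
  limit1_in F P l x0 -> limit1_in (fun s => Rabs (F s)) P (Rabs l) x0.
Proof.
  intros H eps He; destruct (H eps He) as (del & Hd & C).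
  exists del; split; auto; intros s Hs; simpl; unfold R_dist.
  eapply Rle_lt_trans; [apply Rabs_triang_inv2|]; apply (C s Hs).
Qed.

Lemma sum_over_scal xs f k : sum_over xs (fun x => f x * k) = sum_over xs f * k.
Proof. induction xs; simpl; [ring|]; rewrite IHxs; ring. Qed.

Lemma sum_over_single xs f z :
  NoDup xs -> In z xs -> (forall x, x <> z -> f x = 0) -> sum_over xs f = f z.
Proof.
  induction 1 as [|x xs Hx N IH]; simpl; [tauto|]; intros [->|Hz] F.
  - rewrite (sum_over_ext xs f (fun _ => 0)).
    + clear; induction xs; simpl; lra.
    + intros x I; apply F; intros ->; auto.
  - rewrite IH, F; auto; [ring|]; intros ->; auto.
Qed.

Lemma finite_min (xs : list var) (Q : var -> R -> Prop) :
  (forall x d d', Q x d -> 0 < d' <= d -> Q x d') ->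
  (forall x, In x xs -> exists d, 0 < d /\ Q x d) ->
  exists d, 0 < d /\ forall x, In x xs -> Q x d.
Proof.
  intros M; induction xs as [|x xs IH]; intros H.
  - exists 1; split; [lra|]; intros x [].
  - destruct IH as (d1 & P1 & H1); [intros; apply H; simpl; auto|].
    destruct (H x) as (d2 & P2 & H2); simpl; auto.
    exists (Rmin d1 d2); split; [now apply Rmin_pos|].
    intros z [<-|Hz]; eapply M; eauto; split;
      auto using Rmin_l, Rmin_r, Rmin_pos.
Qed.

Section ChainRule.
  Variables (t : term) (w : state) (g : var -> R).
  Let xs := nodup var_eq_dec (tfv t).
  Hypothesis Hg : forall eps, 0 < eps -> exists del, 0 < del /\
    forall w' : state, (forall x, In x xs -> Rabs (w' x - w x) < del) ->
      Rabs (teval t w' - teval t w - sum_over xs (fun x => g x * (w' x - w x)))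
        <= eps * sum_over xs (fun x => Rabs (w' x - w x)).

  Lemma partial_derivative z :
    In z xs -> is_derive (fun r => teval t (upd w z r)) (w z) (g z).
  Proof.
    intros Hz; apply is_derive_Reals; intros eps He.
    (* Half of [eps], because the hypothesis bounds by [<=] and the derivative demands [<]. *)
    destruct (Hg (eps / 2)) as (del & Hd & H); [lra|].
    exists (mkposreal _ Hd); simpl; intros r Nr Hr.
    assert (Ew : upd w z (w z) = w).
    { apply functional_extensionality; intros x; unfold upd.
      destruct var_eq_dec; congruence. }
    rewrite Ew.
    specialize (H (upd w z (w z + r))).
    assert (N : NoDup xs) by apply NoDup_nodup.
    rewrite (sum_over_single xs _ z), (sum_over_single xs _ z) in H; auto;
      try (intros x Nx; rewrite upd_other by auto; rewrite Rminus_diag, ?Rabs_R0; ring).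
    rewrite upd_same in H; replace (w z + r - w z) with r in H by ring.
    assert (H' : Rabs (teval t (upd w z (w z + r)) - teval t w - g z * r)
                 <= eps / 2 * Rabs r).
    { apply H; intros x _; unfold upd; destruct var_eq_dec as [->|Nx].
      - now replace (w z + r - w z) with r by ring.
      - rewrite Rminus_diag, Rabs_R0; auto. }
    replace (_ - g z)
      with ((teval t (upd w z (w z + r)) - teval t w - g z * r) / r) by (field; auto).
    unfold Rdiv; rewrite Rabs_mult, Rabs_inv.
    assert (Pr : 0 < Rabs r) by now apply Rabs_pos_lt.
    apply (Rmult_lt_reg_r (Rabs r)); auto.
    rewrite Rmult_assoc, Rinv_l by lra; nra.
  Qed.

  Lemma frechet_chain (f : R -> state) (d : var -> R) (P : R -> Prop) t0 :
    f t0 = w ->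
    (forall x, In x xs -> D_in (fun s => f s x) (fun _ => d x) P t0) ->
    D_in (fun s => teval t (f s)) (fun _ => sum_over xs (fun x => g x * d x)) P t0.
  Proof.
    intros E0 Hd eps He.
    (* [K] strictly exceeds the sum of the absolute difference quotients near [t0], the summand 1
       being the tolerance taken from [L2]. With [eps / (2 * K)] the remainder costs less than
       [eps / 2]; the linear part costs the other half. *)
    set (K := sum_over xs (fun x => Rabs (d x)) + 1).
    assert (HK : 0 < K).
    { unfold K; clear; induction xs; simpl; [lra|].
      pose proof (Rabs_pos (d a)); lra. }
    pose (dq := fun x s => (f s x - f t0 x) / (s - t0)).
    assert (L1 : limit1_in (fun s => sum_over xs (fun x => g x * dq x s)) (D_x P t0)
                   (sum_over xs (fun x => g x * d x)) t0).
    { apply limit1_in_sum; intros x Hx; apply limit_mul; [apply (limit_free (fun _ => g x) _ t0)|].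
      apply (Hd x Hx). }
    assert (L2 : limit1_in (fun s => sum_over xs (fun x => Rabs (dq x s))) (D_x P t0)
                   (sum_over xs (fun x => Rabs (d x))) t0).
    { apply limit1_in_sum; intros x Hx; apply limit1_in_Rabs, (Hd x Hx). }
    assert (He2 : 0 < eps / (2 * K)) by (apply Rdiv_lt_0_compat; lra).
    destruct (Hg _ He2) as (del & Pd & H).
    destruct (L1 (eps / 2)) as (a1 & Pa1 & C1); [lra|].
    destruct (L2 1) as (a2 & Pa2 & C2); [lra|].
    destruct (finite_min xs (fun x d => forall s, D_x P t0 s -> Rabs (s - t0) < d ->
                               Rabs (f s x - f t0 x) < del)) as (a3 & Pa3 & C3).
    { intros x d1 d2 Q L s Hs Hs2; apply Q; auto; lra. }
    { intros x Hx; destruct (cont_deriv _ _ _ _ (Hd x Hx) del Pd) as (a & Pa & C).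
      exists a; split; auto; intros s Hs Hs2; apply (C s); split; auto. }
    exists (Rmin a1 (Rmin a2 a3)); split; [repeat apply Rmin_pos; auto|].
    intros s (Hs & Hs2); simpl in Hs2; unfold R_dist in Hs2.
    assert (M1 := Rmin_l a1 (Rmin a2 a3)); assert (M2 := Rmin_r a1 (Rmin a2 a3)).
    assert (M3 := Rmin_l a2 a3); assert (M4 := Rmin_r a2 a3).
    assert (B1 : Rabs (sum_over xs (fun x => g x * dq x s)
                       - sum_over xs (fun x => g x * d x)) < eps / 2)
      by exact (C1 s (conj Hs (Rlt_le_trans _ _ _ Hs2 M1))).
    assert (B2 : Rabs (sum_over xs (fun x => Rabs (dq x s))
                       - sum_over xs (fun x => Rabs (d x))) < 1)
      by exact (C2 s (conj Hs (Rlt_le_trans _ _ _ Hs2 (Rle_trans _ _ _ M2 M3)))).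
    clear C1 C2; rename B1 into C1, B2 into C2.
    assert (Ns : s - t0 <> 0) by (destruct Hs as (_ & Hs); intros Z; apply Hs; lra).
    assert (H' := H (f s)); rewrite <- E0 in H'.
    specialize (H' (fun x Hx => C3 x Hx s Hs ltac:(lra))).
    rewrite (sum_over_ext xs (fun x => g x * (f s x - f t0 x))
               (fun x => g x * dq x s * (s - t0))) in H'
      by (intros; unfold dq; field; auto).
    rewrite (sum_over_ext xs (fun x => Rabs (f s x - f t0 x))
               (fun x => Rabs (dq x s) * Rabs (s - t0))) in H'
      by (intros; rewrite <- Rabs_mult; unfold dq; f_equal; field; auto).
    rewrite !sum_over_scal in H'.
    set (S1 := sum_over xs (fun x => g x * dq x s)) in *.
    set (S2 := sum_over xs (fun x => Rabs (dq x s))) in *.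
    set (S3 := sum_over xs (fun x => g x * d x)) in *.
    set (X := teval t (f s) - teval t (f t0)) in *.
    assert (Ps : 0 < Rabs (s - t0)) by now apply Rabs_pos_lt.
    assert (B : Rabs (X / (s - t0) - S1) <= eps / (2 * K) * S2).
    { replace (X / (s - t0) - S1) with ((X - S1 * (s - t0)) / (s - t0)) by (field; auto).
      unfold Rdiv at 1; rewrite Rabs_mult, Rabs_inv.
      apply (Rmult_le_reg_r (Rabs (s - t0))); auto.
      rewrite Rmult_assoc, Rinv_l by lra; lra. }
    assert (S2K : S2 < K) by (apply Rabs_def2 in C2; unfold K; lra).
    assert (eps / (2 * K) * S2 < eps / 2).
    { replace (eps / 2) with (eps / (2 * K) * K) by (field; lra).
      apply Rmult_lt_compat_l; auto. }
    change (Rabs (X / (s - t0) - S3) < eps).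
    replace (X / (s - t0) - S3) with ((X / (s - t0) - S1) + (S1 - S3)) by ring.
    eapply Rle_lt_trans; [apply Rabs_triang|]; lra.
  Qed.
End ChainRule.

(** [u] plays the state after x':=θ: it agrees with the curve on the variables of the term and
    stores the velocities in the differential variables. The chain rule then identifies (t)' in [u]
    with the derivative of the term along the curve. *)
Lemma diff_sound t (f : R -> state) u P t0 :
  frechet t (f t0) -> nodiff (tfv t) -> agree (tfv t) u (f t0) ->
  (forall n, In (V n) (tfv t) ->
     D_in (fun s => f s (V n)) (fun _ => u (D n)) P t0) ->
  D_in (fun s => teval t (f s)) (fun _ => teval (TDiff t) u) P t0.
Proof.
  intros (g & Hg) N A Hd.
  pose (d := fun x => match x with V n => u (D n) | D _ => 0 end).
  eapply D_in_ext; [intros; reflexivity| |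
    apply (frechet_chain t (f t0) g Hg f d P t0 eq_refl)].
  - simpl; unfold sum_over.
    assert (E : forall ns, incl ns (bases (tfv t)) ->
       fold_right (fun x acc => g x * d x + acc) 0 (map V ns) =
       fold_right (fun n acc =>
         Derive (fun r => teval t (upd u (V n) r)) (u (V n)) * u (D n) + acc) 0 ns).
    { intros ns I; induction ns as [|n ns IH]; simpl; auto.
      rewrite IH by (intros z Hz; apply I; simpl; auto).
      assert (Hn : In (V n) (tfv t)) by (apply in_bases, I; simpl; auto).
      f_equal; f_equal.
      rewrite (A _ Hn); symmetry.
      rewrite (Derive_ext _ (fun r => teval t (upd (f t0) (V n) r)))
        by (intros r; apply teval_agree, agree_upd, A).
      apply is_derive_unique, (partial_derivative t (f t0) g Hg), nodup_In, Hn. }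
    rewrite <- E by (intros z Hz; now apply nodup_In in Hz).
    f_equal.
    (* Without differential variables, removing duplicates commutes with passing from variables to
       their base numbers. *)
    clear - N; induction (tfv t) as [|[n|n] l IH]; auto.
    + assert (N' : nodiff l) by (intros m Hm; apply (N m); simpl; auto).
      simpl; destruct (in_dec var_eq_dec (V n) l) as [I|I], (in_dec _ n (bases l)) as [J|J];
        rewrite in_bases in J; try tauto; simpl; rewrite IH; auto.
    + exfalso; apply (N n); simpl; auto.
  - intros x Hx; apply nodup_In in Hx.
    destruct x as [n|n]; [now apply Hd | exfalso; eapply N; eauto].
Qed.

(** The difference of the two sides of a comparison is monotone, or constant for equations and
    disequations, so strict and weak comparisons persist alike. Since the differential of a
    disjunction demands both parts, the disjunct that holds at the start is the one that
    persists. *)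
Lemma diff_invariant p p' T (f u : R -> state) :
  0 <= T -> fdiff p = Some p' ->
  (forall t, 0 <= t <= T -> fdifferentiable p (f t)) ->
  nodiff (ffv p) -> (forall t, 0 <= t <= T -> agree (ffv p) (u t) (f t)) ->
  (forall t n, 0 <= t <= T -> In (V n) (ffv p) ->
     D_in (fun s => f s (V n)) (fun _ => u t (D n)) (within0 T) t) ->
  (forall t, 0 <= t <= T -> dsem p' (u t)) ->
  dsem p (f 0) -> dsem p (f T).
Proof.
  intros HT; revert p'; unfold dsem; induction p; simpl; intros p' Hp' Df N A Hd H H0;
    try discriminate; binv.
  - injection Hp' as <-.
    assert (D1 : forall t, 0 <= t <= T ->
        D_in (fun s0 => teval s (f s0)) (fun t => teval (TDiff s) (u t)) (within0 T) t).
    { intros r Hr; eapply D_in_ext; [reflexivity| |apply (diff_sound s f (u r))];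
        try reflexivity.
      - apply (Df r Hr).
      - intros n Hn; apply (N n), in_or_app; auto.
      - intros z Hz; apply A, in_or_app; auto.
      - intros n Hn; apply Hd; auto; apply in_or_app; auto. }
    assert (D2 : forall r, 0 <= r <= T ->
        D_in (fun s0 => teval t (f s0)) (fun r => teval (TDiff t) (u r)) (within0 T) r).
    { intros r Hr; eapply D_in_ext; [reflexivity| |apply (diff_sound t f (u r))];
        try reflexivity.
      - apply (Df r Hr).
      - intros n Hn; apply (N n), in_or_app; auto.
      - intros z Hz; apply A, in_or_app; auto.
      - intros n Hn; apply Hd; auto; apply in_or_app; auto. }
    assert (D12 := fun r Hr => Dminus _ _ _ _ _ _ (D1 r Hr) (D2 r Hr)).
    assert (D21 := fun r Hr => Dminus _ _ _ _ _ _ (D2 r Hr) (D1 r Hr)).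
    cbv beta in D12, D21.
    assert (H' : forall r, 0 <= r <= T ->
              csem match c with GE | GT => GE | LE | LT => LE | EQ | NE => EQ end
                   (teval (TDiff s) (u r)) (teval (TDiff t) (u r))) by exact H.
    clear H Hd A Df.
    destruct c; simpl in *;
      first
      [ assert (L := D_in_nondecreasing T _ _ HT D21
                       (fun r Hr => ltac:(specialize (H' r Hr); cbv beta; lra)));
        simpl in L; lra
      | assert (L := D_in_nondecreasing T _ _ HT D12
                       (fun r Hr => ltac:(specialize (H' r Hr); cbv beta; lra)));
        simpl in L; lra
      | assert (L := D_in_constant T _ _ HT D12
                       (fun r Hr => ltac:(specialize (H' r Hr); cbv beta; lra)));
        simpl in L; lra ].
  - injection Hp' as <-; destruct H0 as (H1 & H2); split.
    + eapply IHp1; eauto.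
      * intros t Ht; apply (Df t Ht).
      * intros n Hn; apply (N n), in_or_app; auto.
      * intros t Ht z Hz; apply A; auto; apply in_or_app; auto.
      * intros t n Ht Hn; apply Hd; auto; apply in_or_app; auto.
      * intros t Ht; apply (H t Ht).
    + eapply IHp2; eauto.
      * intros t Ht; apply (Df t Ht).
      * intros n Hn; apply (N n), in_or_app; auto.
      * intros t Ht z Hz; apply A; auto; apply in_or_app; auto.
      * intros t n Ht Hn; apply Hd; auto; apply in_or_app; auto.
      * intros t Ht; apply (H t Ht).
  - injection Hp' as <-; destruct H0 as [H1|H2]; [left|right].
    + eapply IHp1; eauto.
      * intros t Ht; apply (Df t Ht).
      * intros n Hn; apply (N n), in_or_app; auto.
      * intros t Ht z Hz; apply A; auto; apply in_or_app; auto.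
      * intros t n Ht Hn; apply Hd; auto; apply in_or_app; auto.
      * intros t Ht; apply (H t Ht).
    + eapply IHp2; eauto.
      * intros t Ht; apply (Df t Ht).
      * intros n Hn; apply (N n), in_or_app; auto.
      * intros t Ht z Hz; apply A; auto; apply in_or_app; auto.
      * intros t n Ht Hn; apply Hd; auto; apply in_or_app; auto.
      * intros t Ht; apply (H t Ht).
Qed.

(** * Linear differential equations *)

Lemma is_derive_D_in (f f' : R -> R) P t :
  is_derive f t (f' t) -> D_in f f' P t.
Proof.
  intros H; apply is_derive_Reals in H.
  apply derivable_pt_lim_D_in in H; eapply D_in_imp; [|exact H].
  unfold D_x, no_cond; tauto.
Qed.

Lemma continuous_is_derive_RInt (A : R -> R) (t : R) :
  (forall t, continuous A t) -> is_derive (RInt A 0) t (A t).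
Proof.
  intros C; apply is_derive_RInt with 0; auto.
  apply filter_forall; intros x; apply RInt_correct.
  apply ex_RInt_continuous; auto.
Qed.

(** Variation of constants: with E the integral of A, the solution is exp(E) times y0 plus the
    integral of B exp(-E). *)
Lemma linear_ode_exists (A B : R -> R) (y0 : R) :
  (forall t, continuous A t) -> (forall t, continuous B t) ->
  exists Y, Y 0 = y0 /\ forall t, is_derive Y t (A t * Y t + B t).
Proof.
  intros CA CB.
  set (E := RInt A 0).
  assert (DE : forall t, is_derive E t (A t)) by (intros; now apply continuous_is_derive_RInt).
  set (F := RInt (fun s => B s * exp (- E s)) 0).
  assert (DF : forall t, is_derive F t (B t * exp (- E t))).
  { intros t; apply (continuous_is_derive_RInt (fun s => B s * exp (- E s))).
    clear t; intros t; apply (continuous_mult B (fun s => exp (- E s))); auto.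
    apply (ex_derive_continuous (fun s => exp (- E s))).
    exists (- A t * exp (- E t)).
    apply (is_derive_comp exp (fun s => - E s)); [apply is_derive_exp|].
    apply (is_derive_opp E), DE. }
  exists (fun t => exp (E t) * (y0 + F t)); split.
  - unfold E, F; rewrite !RInt_point; unfold zero; simpl; rewrite exp_0; ring.
  - intros t; evar_last.
    + apply (is_derive_mult (fun t => exp (E t)) (fun t => y0 + F t)).
      * apply (is_derive_comp exp E); [apply is_derive_exp|apply DE].
      * apply (is_derive_plus (fun _ => y0) F); [apply is_derive_const|apply DF].
      * intros; apply Rmult_comm.
    + unfold plus, mult, scal, zero; simpl; unfold mult; simpl.
      assert (EE : exp (E t) * exp (- E t) = 1)
        by (rewrite <- exp_plus, Rplus_opp_r; apply exp_0).
      transitivity (A t * (exp (E t) * (y0 + F t)) + B t * (exp (E t) * exp (- E t)));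
        [ring|rewrite EE; ring].
Qed.

(** The difference of the solutions, multiplied by the integrating factor [X], has derivative zero,
    and [X] never vanishes. *)
Lemma linear_ode_unique (A B Y1 Y2 : R -> R) (T : R) :
  0 <= T -> (forall t, continuous A t) -> Y1 0 = Y2 0 ->
  (forall t, 0 <= t <= T -> D_in Y1 (fun t => A t * Y1 t + B t) (within0 T) t) ->
  (forall t, 0 <= t <= T -> D_in Y2 (fun t => A t * Y2 t + B t) (within0 T) t) ->
  forall t, 0 <= t <= T -> Y1 t = Y2 t.
Proof.
  intros HT CA H0 D1 D2 t Ht.
  set (X := fun t => exp (- RInt A 0 t)).
  assert (DX : forall P t, D_in X (fun t => - A t * X t) P t).
  { intros P r; apply is_derive_D_in.
    apply (is_derive_comp exp (fun s => - RInt A 0 s)); [apply is_derive_exp|].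
    apply (is_derive_opp (RInt A 0)); now apply continuous_is_derive_RInt. }
  assert (E := D_in_constant t (fun t => (Y1 t - Y2 t) * X t)
    (fun t => ((A t * Y1 t + B t) - (A t * Y2 t + B t)) * X t
              + (Y1 t - Y2 t) * (- A t * X t))).
  cbv beta in E; rewrite H0 in E.
  assert (0 < X t) by apply exp_pos.
  enough ((Y1 t - Y2 t) * X t = 0) by nra.
  rewrite E; try ring; try lra.
  - intros r Hr; apply D_in_shrink with T; [lra|].
    apply (Dmult _ _ _ (fun t => Y1 t - Y2 t)); auto.
    apply Dminus; [apply D1|apply D2]; lra.
  - intros r _; ring.
Qed.

(** The supremum of the times up to which [C] holds throughout satisfies [C] by the limit step, and
    the extension step leaves it no value below [T]. *)
Lemma real_induction T (C : R -> Prop) :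
  (forall t, 0 <= t <= T -> (forall s, 0 <= s < t -> C s) -> C t) ->
  (forall t, 0 <= t < T -> (forall s, 0 <= s <= t -> C s) ->
     exists d, 0 < d /\ forall s, t < s <= t + d -> s <= T -> C s) ->
  forall t, 0 <= t <= T -> C t.
Proof.
  intros Lim Step t0 Ht0.
  set (E := fun t => 0 <= t <= T /\ forall s, 0 <= s <= t -> C s).
  assert (E0 : E 0).
  { split; [lra|]; intros s Hs; apply Lim; [lra|]; intros; lra. }
  destruct (completeness E) as (m & Hub & Hlub).
  { exists T; intros t (Ht & _); lra. }
  { exists 0; apply E0. }
  assert (Hm : 0 <= m) by now apply Hub.
  assert (HmT : m <= T) by (apply Hlub; intros t (Ht & _); lra).
  assert (Hlt : forall s, 0 <= s < m -> C s).
  { intros s Hs; apply NNPP; intros N.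
    enough (m <= s) by lra.
    apply Hlub; intros t (Ht & Hc).
    destruct (Rle_dec t s); auto; exfalso; apply N, Hc; lra. }
  assert (Hle : forall s, 0 <= s <= m -> C s).
  { intros s Hs; destruct (Rle_lt_or_eq_dec s m) as [L| ->]; try lra.
    - apply Hlt; lra.
    - apply Lim; auto; lra. }
  destruct (Rle_lt_or_eq_dec m T HmT) as [L| ->]; [|now apply Hle].
  destruct (Step m) as (d & Hd & Hs); auto.
  enough (Rmin (m + d) T <= m) by (unfold Rmin in *; destruct Rle_dec; lra).
  apply Hub; split; [unfold Rmin; destruct Rle_dec; lra|].
  intros s Hs1; destruct (Rle_dec s m); [apply Hle; lra|].
  apply Hs; unfold Rmin in Hs1; destruct Rle_dec; lra.
Qed.

(** * Continuity of terms and solutions *)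

(** A ball bounds all of the infinitely many variables at once, by a common radius. *)
Definition St : UniformSpace := fct_UniformSpace var R_UniformSpace.

Definition tcont (t : term) (u : state) : Prop :=
  @continuous St R_UniformSpace (teval t) u.

Lemma tcont_const t u : tfv t = [] -> tcont t u.
Proof.
  intros E; apply (continuous_ext (fun _ => teval t u)).
  - intros v; apply teval_agree; rewrite E; intros x [].
  - apply continuous_const.
Qed.

Lemma continuous_powerRZ (z : Z) (x : R) :
  (0 <= z)%Z \/ x <> 0 -> continuous (fun r => powerRZ r z) x.
Proof.
  intros H; destruct z as [|p|p]; simpl.
  - apply continuous_const.
  - apply (ex_derive_continuous (fun r => r ^ Pos.to_nat p)); auto_derive; auto.
  - assert (N : x <> 0) by (destruct H as [H|H]; [lia|auto]).
    apply (ex_derive_continuous (fun r => / r ^ Pos.to_nat p)).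
    auto_derive; auto; now apply pow_nonzero.
Qed.

Lemma continuous_Rpower_nonneg (a x : R) :
  0 < x \/ (x = 0 /\ 0 < a) \/ x < 0 ->
  continuous (fun r => if Rlt_dec 0 r then Rpower r a else 0) x.
Proof.
  intros [Hx|[(-> & Ha)|Hx]].
  - apply continuous_ext_loc with (g := fun r => Rpower r a).
    + exists (mkposreal x Hx); intros y Hy.
      destruct (Rlt_dec 0 y); auto.
      apply Rabs_def2 in Hy; unfold Hierarchy.minus, plus, opp in Hy; simpl in Hy; lra.
    + unfold Rpower; apply (ex_derive_continuous (fun r => exp (a * ln r))).
      auto_derive; auto.
  - apply continuity_pt_filterlim; intros eps He.
    (* The radius whose power with exponent [a] is exactly [eps]; the power is increasing on
       positive arguments. *)
    exists (Rpower eps (/ a)); split; [apply exp_pos|].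
    intros y (_ & Hy); simpl in *; unfold R_dist in *.
    destruct (Rlt_dec 0 0) as [C|_]; [lra|].
    destruct (Rlt_dec 0 y) as [Py|Ny]; [|rewrite Rminus_diag, Rabs_R0; auto].
    rewrite Rminus_0_r in *.
    rewrite Rabs_pos_eq in Hy by lra.
    rewrite Rabs_pos_eq by (left; apply exp_pos).
    replace eps with (Rpower (Rpower eps (/ a)) a).
    + unfold Rpower at 1 3; apply exp_increasing, Rmult_lt_compat_l; auto.
      apply ln_increasing; auto.
    + rewrite Rpower_mult, Rinv_l, Rpower_1; lra.
  - apply continuous_ext_loc with (g := fun r => 0).
    + assert (Hx' : 0 < - x) by lra.
      exists (mkposreal _ Hx'); intros y Hy.
      destruct (Rlt_dec 0 y); auto.
      apply Rabs_def2 in Hy; unfold Hierarchy.minus, plus, opp in Hy; simpl in Hy; lra.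
    + apply continuous_const.
Qed.

Lemma Q2R_pos q : (0 < Qnum q)%Z -> 0 < Q2R q.
Proof.
  intros H; apply Rmult_lt_0_compat; [now apply IZR_lt|].
  apply Rinv_0_lt_compat, IZR_lt; reflexivity.
Qed.

Lemma Qred_nonneg q : (0 <= Qnum q)%Z -> (0 <= Qnum (Qred q))%Z.
Proof.
  intros H; assert (L : (0 <= Qred q)%Q).
  { rewrite Qred_correct; unfold Qle; simpl; lia. }
  unfold Qle in L; simpl in L; lia.
Qed.

Lemma locally_tcont (t : term) (u : state) (O : R -> Prop) :
  open O -> tcont t u -> O (teval t u) -> @locally St u (fun v => O (teval t v)).
Proof. intros HO C H; apply C, (HO _ H). Qed.

(** The neighbourhood may contain states in which [t] is undefined and has an
    arbitrary value. *)
Lemma tdef_tcont t u :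
  nodiff (tfv t) -> tdef t u -> @locally St u (tcont t).
Proof.
  revert u; induction t; simpl; intros u N H;
    try (assert (N1 : nodiff (tfv t1)) by (intros n Hn; apply (N n), in_or_app; auto);
         assert (N2 : nodiff (tfv t2)) by (intros n Hn; apply (N n), in_or_app; auto)).
  - apply filter_forall; intros v P (eps & HP); exists eps; intros v' Hv'.
    apply HP, Hv'.
  - apply filter_forall; intros v; now apply tcont_const.
  - generalize (filter_and _ _ (IHt1 u N1 (proj1 H)) (IHt2 u N2 (proj2 H))).
    apply filter_imp; intros v (C1 & C2); exact (continuous_plus _ _ _ C1 C2).
  - generalize (filter_and _ _ (IHt1 u N1 (proj1 H)) (IHt2 u N2 (proj2 H))).
    apply filter_imp; intros v (C1 & C2); exact (continuous_minus _ _ _ C1 C2).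
  - generalize (filter_and _ _ (IHt1 u N1 (proj1 H)) (IHt2 u N2 (proj2 H))).
    apply filter_imp; intros v (C1 & C2); exact (continuous_mult _ _ _ C1 C2).
  - destruct H as (H1 & H2 & H3).
    specialize (IHt1 u N1 H1); specialize (IHt2 u N2 H2).
    assert (L := locally_tcont t2 u (fun r => r <> 0) (open_neq 0)
                   (locally_singleton _ _ IHt2) H3).
    generalize (filter_and _ _ (filter_and _ _ IHt1 IHt2) L).
    apply filter_imp; intros v ((C1 & C2) & Nz).
    apply (continuous_mult (teval t1) (fun v => / teval t2 v) v C1).
    apply (continuous_comp (teval t2) Rinv v C2).
    apply continuous_Rinv; auto.
  - destruct H as (H1 & H2); specialize (IHt u N H1).
    assert (C := locally_singleton _ _ IHt).
    assert (K : exists O : R -> Prop, open O /\ O (teval t u) /\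
                forall r, O r -> continuous (fun r => rpow r q) r).
    { unfold rpow; destruct (integral q) eqn:I.
      - destruct H2 as [H2|H2].
        + exists (fun _ => True); split; [apply open_true|]; split; auto; intros r _.
          apply continuous_powerRZ; left; now apply Qred_nonneg.
        + exists (fun r => r <> 0); split; [apply open_neq|]; split; auto; intros r Hr.
          apply continuous_powerRZ; auto.
      - destruct H2 as [H2|(H2 & H3)].
        + exists (fun r => 0 < r); split; [apply open_gt|]; split; auto; intros r Hr.
          apply continuous_Rpower_nonneg; auto.
        (* For a positive exponent the value 0 given to nonpositive arguments makes the power
           continuous on the whole line, also where it is not defined. *)
        + exists (fun _ => True); split; [apply open_true|]; split; auto; intros r _.
          apply continuous_Rpower_nonneg.
          apply Q2R_pos in H3; destruct (Rtotal_order 0 r) as [?|[?|?]]; auto. }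
    destruct K as (O & HO & Hu & K).
    generalize (filter_and _ _ IHt (locally_tcont t u O HO C Hu)).
    apply filter_imp; intros v (Cv & Ov).
    exact (continuous_comp (teval t) (fun r => rpow r q) v Cv (K _ Ov)).
  (* A variable below the differential would contribute its differential variable to [tfv], so only
     closed terms remain here. *)
  - apply filter_forall; intros v; apply tcont_const; simpl.
    assert (E : tfv t = []).
    { destruct (tfv t) as [|[n|n] l] eqn:E; auto; exfalso; apply (N n); simpl; auto.
      right; apply in_or_app; right; simpl; auto. }
    now rewrite E.
Qed.

Lemma ode_sol_cont ode w T g x :
  ode_sol ode w T g -> cont_on T (fun s => g s x).
Proof.
  intros (_ & H); destruct (in_dec var_eq_dec x (odevars ode)) as [I|I].
  - apply in_map_iff in I as ((n & e) & <- & I); simpl.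
    apply D_in_cont_on with (fun s => teval e (g s)).
    intros t Ht; now apply (H t Ht).
  - intros t Ht eps He; exists 1; split; [lra|]; intros s Hs _.
    rewrite (proj2 (H t Ht) x I), (proj2 (H s Hs) x I), Rminus_diag, Rabs_R0; auto.
Qed.

(** Continuity in the uniform sense holds because only the finitely many variables of the system
    move. *)
Lemma ode_sol_continuous ode w T g :
  0 <= T -> ode_sol ode w T g ->
  forall t, @continuous R_UniformSpace St (fun s => g (clamp T s)) t.
Proof.
  intros HT Hg t.
  assert (L : forall (xs : list var) (eps : posreal),
     locally t (fun s => forall x, In x xs -> ball (g (clamp T t) x) eps (g (clamp T s) x))).
  { intros xs eps; induction xs as [|x xs IH].
    - apply filter_forall; intros s x [].
    - assert (C := proj1 (continuity_pt_filterlim _ _)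
                     (cont_on_clamp T _ HT (ode_sol_cont _ _ _ _ x Hg) t)).
      specialize (C _ (locally_ball _ eps)).
      generalize (filter_and _ _ IH C); apply filter_imp.
      intros s (H1 & H2) z [<-|Hz]; auto. }
  intros P (eps & HP); unfold filtermap.
  generalize (L (odevars ode) eps); apply filter_imp; intros s Hs.
  apply HP; intros x; destruct (in_dec var_eq_dec x (odevars ode)) as [I|I]; auto.
  destruct Hg as (_ & Hg).
  rewrite (proj2 (Hg _ (clamp_range T s HT)) x I), (proj2 (Hg _ (clamp_range T t HT)) x I).
  apply ball_center.
Qed.

Lemma ode_sol_limit ode w T g h t :
  0 <= t <= T -> ode_sol ode w T g -> ode_sol ode w T h ->
  (forall s, 0 <= s < t -> g s = h s) -> g t = h t.
Proof.
  intros Ht Hg Hh E; destruct (Rle_lt_or_eq_dec 0 t) as [Pt| <-]; [lra| |].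
  2: { now rewrite (proj1 Hg), (proj1 Hh). }
  apply functional_extensionality; intros x.
  apply NNPP; intros N.
  assert (Pe : 0 < Rabs (g t x - h t x) / 2)
    by (apply Rdiv_lt_0_compat; [apply Rabs_pos_lt; lra|lra]).
  destruct (ode_sol_cont _ _ _ _ x Hg t Ht _ Pe) as (d1 & Pd1 & H1).
  destruct (ode_sol_cont _ _ _ _ x Hh t Ht _ Pe) as (d2 & Pd2 & H2).
  assert (M1 := Rmin_l d1 (Rmin d2 t)); assert (M2 := Rmin_r d1 (Rmin d2 t)).
  assert (M3 := Rmin_l d2 t); assert (M4 := Rmin_r d2 t).
  assert (Pm : 0 < Rmin d1 (Rmin d2 t)) by (repeat apply Rmin_pos; auto).
  set (m := Rmin d1 (Rmin d2 t)) in *.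
  specialize (H1 (t - m / 2)); specialize (H2 (t - m / 2)).
  rewrite (E (t - m / 2)) in H1 by lra.
  replace (t - m / 2 - t) with (- (m / 2)) in H1, H2 by ring.
  rewrite Rabs_Ropp, Rabs_pos_eq in H1, H2 by lra.
  specialize (H1 ltac:(lra) ltac:(lra)); specialize (H2 ltac:(lra) ltac:(lra)).
  set (z := h (t - m / 2) x) in *.
  assert (B : Rabs (g t x - h t x) <= Rabs (z - g t x) + Rabs (z - h t x)).
  { replace (g t x - h t x) with (- (z - g t x) + (z - h t x)) by ring.
    eapply Rle_trans; [apply Rabs_triang|]; rewrite Rabs_Ropp; lra. }
  lra.
Qed.

(** * Differential ghosts *)

Lemma agree_upd_notin l x u r : ~ In x l -> agree l (upd u x r) u.
Proof. intros N z Hz; apply upd_other; congruence. Qed.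

Lemma teval_upd_notin t x u r : ~ In x (tfv t) -> teval t (upd u x r) = teval t u.
Proof. intros N; now apply teval_agree, agree_upd_notin. Qed.

Lemma upd_upd u x r r' : upd (upd u x r) x r' = upd u x r'.
Proof.
  apply functional_extensionality; intros z; unfold upd; destruct var_eq_dec; auto.
Qed.

Lemma upd_id u x : upd u x (u x) = u.
Proof.
  apply functional_extensionality; intros z; unfold upd; destruct var_eq_dec; congruence.
Qed.

Lemma linear_affine y t u r :
  linear_in y t ->
  teval t (upd u y r) =
  (teval t (upd u y 1) - teval t (upd u y 0)) * r + teval t (upd u y 0).
Proof.
  induction 1; simpl; try rewrite !(teval_upd_notin _ _ _ _ H);
    try rewrite !(teval_upd_notin _ _ _ _ H0);
    try rewrite IHlinear_in; try rewrite IHlinear_in1, IHlinear_in2; try ring.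
  - rewrite !upd_same; ring.
  - unfold Rdiv; ring.
Qed.

(** A linear term has y in no denominator, power or differential, so its definedness does not depend
    on y. This gives access to the values 0 and 1 of y, from which the coefficients are read off. *)
Lemma linear_tdef y t u r : linear_in y t -> tdef t u -> tdef t (upd u y r).
Proof.
  assert (F : forall t, ~ In y (tfv t) -> tdef t u -> tdef t (upd u y r)).
  { intros s N; apply tdef_agree, agree_sym, agree_upd_notin, N. }
  induction 1; simpl; try rewrite teval_upd_notin by auto; intuition auto.
Qed.

Section Ghost.
  Variables (ode : list (nat * term)) (y : nat) (e : term).
  Let Y := V y.
  Hypothesis y_new : ~ In Y (odevars ode).
  Hypothesis y_rhs : forall x t, In (x, t) ode -> ~ In Y (tfv t).
  Hypothesis e_lin : linear_in Y e.
  Hypothesis e_nodiff : nodiff (tfv e).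

  (** The ghost equation is y' = slope * y + offset, with coefficients independent of y. Writing
      them through values of [e] lets them inherit its continuity. *)
  Definition slope (u : state) : R := teval e (upd u Y 1) - teval e (upd u Y 0).
  Definition offset (u : state) : R := teval e (upd u Y 0).

  Definition coeff_cont (u : state) : Prop :=
    @continuous St R_UniformSpace slope u /\ @continuous St R_UniformSpace offset u.

  Lemma tcont_upd r u : @locally St (upd u Y r) (tcont e) ->
    @locally St u (fun v => @continuous St R_UniformSpace (fun v => teval e (upd v Y r)) v).
  Proof.
    assert (C : forall v, @continuous St St (fun v => upd v Y r) v).
    { intros v P (eps & HP); exists eps; intros v' Hv'; apply HP; intros x.
      unfold upd; destruct var_eq_dec; auto using ball_center. }
    intros L; generalize (C u _ L); unfold filtermap; apply filter_imp; intros v Hv.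
    exact (continuous_comp (fun v : St => (upd v Y r : St)) (teval e) v (C v) Hv).
  Qed.

  Lemma tdef_coeff_cont u : tdef e u -> @locally St u coeff_cont.
  Proof.
    intros H.
    assert (L : forall r, @locally St u (fun v =>
        @continuous St R_UniformSpace (fun v => teval e (upd v Y r)) v)).
    { intros r; apply tcont_upd, tdef_tcont; auto using linear_tdef. }
    generalize (filter_and _ _ (L 1) (L 0)); apply filter_imp.
    intros v (C1 & C0); split; auto.
    exact (continuous_minus _ _ _ C1 C0).
  Qed.

  Notation ode' := (ode ++ [(y, e)]).

  Lemma odevars_ghost : odevars ode' = odevars ode ++ [Y].
  Proof. unfold odevars; now rewrite map_app. Qed.

  (** For the original system the ghost belongs to the constant background, so it is frozen at its
      value in [w]; no right-hand side of the system notices. *)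
  Lemma ghost_sol_project w r S g :
    ode_sol ode' (upd w Y r) S g -> ode_sol ode w S (fun t => upd (g t) Y (w Y)).
  Proof.
    intros (G0 & G); split.
    - now rewrite G0, upd_upd, upd_id.
    - intros t Ht; destruct (G t Ht) as (Gd & Gc); split.
      + intros x t' Hx.
        assert (N : V x <> Y).
        { intros E; apply y_new; rewrite <- E.
          apply (in_map (fun xe => V (fst xe)) _ _ Hx). }
        eapply D_in_ext; [| |apply (Gd x t'), in_or_app; left; exact Hx].
        * intros s; cbv beta; now rewrite upd_other.
        * cbv beta; rewrite teval_upd_notin; auto; eapply y_rhs; eauto.
      + intros z Hz; destruct (var_eq_dec z Y) as [->|N].
        * now rewrite upd_same.
        * rewrite upd_other, Gc, upd_other; auto.
          rewrite odevars_ghost, in_app_iff; simpl; intuition.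
  Qed.

  Lemma comp_clamp_cont w S g (F : state -> R) :
    0 <= S -> ode_sol ode w S g ->
    (forall t, 0 <= t <= S -> @continuous St R_UniformSpace F (g t)) ->
    forall t, continuous (fun s => F (g (clamp S s))) t.
  Proof.
    intros HS Hg C t.
    apply (@continuous_comp R_UniformSpace St R_UniformSpace
             (fun s => g (clamp S s)) F t).
    - now apply (ode_sol_continuous ode w).
    - now apply C, clamp_range.
  Qed.

  (** Along a fixed solution the ghost equation is linear with coefficients depending continuously
      on time alone, so it is solvable on all of [0,S] without blow-up. *)
  Lemma ghost_sol_extend w r S g :
    0 <= S -> ode_sol ode w S g -> (forall t, 0 <= t <= S -> coeff_cont (g t)) ->
    exists Z, ode_sol ode' (upd w Y r) S (fun t => upd (g t) Y (Z t)).
  Proof.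
    intros HS Hg C.
    destruct (linear_ode_exists (fun s => slope (g (clamp S s)))
                (fun s => offset (g (clamp S s))) r) as (Z & Z0 & DZ).
    { apply (comp_clamp_cont w); auto; intros; now apply C. }
    { apply (comp_clamp_cont w); auto; intros; now apply C. }
    exists Z; split.
    - now rewrite (proj1 Hg), Z0.
    - destruct Hg as (G0 & G); intros t Ht; destruct (G t Ht) as (Gd & Gc); split.
      + intros x t' Hx; apply in_app_or in Hx as [Hx|[Hx|[]]].
        * assert (N : V x <> Y).
          { intros E; apply y_new; rewrite <- E.
            apply (in_map (fun xe => V (fst xe)) _ _ Hx). }
          eapply D_in_ext; [| |apply (Gd x t' Hx)].
          -- intros s; cbv beta; now rewrite upd_other.
          -- cbv beta; rewrite teval_upd_notin; auto; eapply y_rhs; eauto.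
        * injection Hx as <- <-.
          eapply D_in_ext; [| |apply (is_derive_D_in Z (fun t =>
            slope (g (clamp S t)) * Z t + offset (g (clamp S t)))), DZ].
          -- intros s; cbv beta; now rewrite upd_same.
          -- cbv beta; rewrite clamp_id by auto.
             rewrite (linear_affine Y e (g t) (Z t)); auto.
      + intros z Hz; rewrite odevars_ghost, in_app_iff in Hz; simpl in Hz.
        rewrite !upd_other, Gc; auto.
  Qed.

  (** Equal projections give equal coefficients, so both ghost components solve one and the same
      linear equation. *)
  Lemma ghost_sol_unique w r S g1 g2 :
    0 <= S -> ode_sol ode' (upd w Y r) S g1 -> ode_sol ode' (upd w Y r) S g2 ->
    (forall t, 0 <= t <= S -> upd (g1 t) Y (w Y) = upd (g2 t) Y (w Y)) ->
    (forall t, 0 <= t <= S -> coeff_cont (upd (g1 t) Y (w Y))) ->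
    forall t, 0 <= t <= S -> g1 t = g2 t.
  Proof.
    intros HS H1 H2 E C t Ht.
    set (h := fun t => upd (g1 t) Y (w Y)) in *.
    assert (Hh : ode_sol ode w S h) by (eapply ghost_sol_project; eauto).
    set (A := fun s => slope (h (clamp S s))); set (B := fun s => offset (h (clamp S s))).
    assert (Ee : forall u v r, upd u Y (w Y) = upd v Y (w Y) -> upd u Y r = upd v Y r).
    { intros u v r' Euv; rewrite <- (upd_upd u Y (w Y)), Euv; apply upd_upd. }
    assert (D : forall g, ode_sol ode' (upd w Y r) S g ->
              (forall t, 0 <= t <= S -> upd (g t) Y (w Y) = h t) ->
              forall t, 0 <= t <= S ->
              D_in (fun s => g s Y) (fun s => A s * g s Y + B s) (within0 S) t).
    { intros g (_ & G) Eg s Hs; destruct (G s Hs) as (Gd & _).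
      eapply D_in_ext; [| |apply (Gd y e), in_or_app; simpl; auto].
      - reflexivity.
      - cbv beta; unfold A, B, slope, offset; rewrite clamp_id by auto.
        rewrite <- (Eg s Hs), !upd_upd, <- linear_affine, upd_id; auto. }
    assert (EY : g1 t Y = g2 t Y).
    { apply (linear_ode_unique A B (fun s => g1 s Y) (fun s => g2 s Y) S); auto.
      - apply (comp_clamp_cont w); auto; intros; now apply C.
      - now rewrite (proj1 H1), (proj1 H2).
      - apply D; auto; intros s Hs; symmetry; exact (E s Hs). }
    rewrite <- (upd_id (g1 t) Y), EY, (Ee _ (g2 t) _ (E t Ht)); apply upd_id.
  Qed.

  (** A competitor in the extended system projects onto [g] by uniqueness of the original flow, and
      its ghost component then equals [Z]. *)
  Lemma ghost_extend w r T g :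
    ode_flow ode w T g -> (forall t, 0 <= t <= T -> tdef e (g t)) ->
    exists Z, ode_flow ode' (upd w Y r) T (fun t => upd (g t) Y (Z t)).
  Proof.
    intros (HT & Hg & U) Hd.
    assert (C : forall t, 0 <= t <= T -> coeff_cont (g t)).
    { intros t Ht; apply (locally_singleton (T := St)), tdef_coeff_cont; auto. }
    destruct (ghost_sol_extend w r T g HT Hg C) as (Z & HZ).
    exists Z; split; [|split]; auto.
    intros S g2 HS H2.
    assert (Eg : forall t, 0 <= t <= S -> upd (g2 t) Y (w Y) = g t).
    { apply (U S (fun t => upd (g2 t) Y (w Y))); auto; eapply ghost_sol_project; eauto. }
    apply (ghost_sol_unique w r S); auto; try lra.
    - eapply ode_sol_restrict; [|exact HZ]; lra.
    - intros t Ht; rewrite Eg, upd_upd by auto; rewrite <- (Eg t Ht), upd_upd; auto.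
    - intros t Ht; rewrite Eg by auto; apply C; lra.
  Qed.

  Lemma sol_continuous_at w T g t P :
    ode_sol ode w T g -> 0 <= t <= T -> @locally St (g t) P ->
    exists d, 0 < d /\ forall s, 0 <= s <= T -> Rabs (s - t) < d -> P (g s).
  Proof.
    intros Hg Ht HP.
    assert (HT : 0 <= T) by lra.
    assert (C : locally t (fun s => P (g (clamp T s)))).
    { apply (ode_sol_continuous ode w T g HT Hg t P).
      now rewrite (clamp_id T t Ht). }
    destruct C as (d & Hd).
    exists d; split; [apply cond_pos|]; intros s Hs Hst.
    rewrite <- (clamp_id T s Hs); now apply Hd.
  Qed.

  (** A solution [g] that leaves [h] does so where the coefficients are
      continuous, so it extends to the system with the ghost, at least for a short
      time; hence uniqueness there excludes it. *)
  Lemma branching_excluded w S g h :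
    ode_sol ode w S g -> ode_sol ode w S h ->
    (forall t, 0 <= t <= S -> @locally St (h t) coeff_cont) ->
    (forall S', 0 <= S' <= S -> (forall t, 0 <= t <= S' -> coeff_cont (g t)) ->
       forall t, 0 <= t <= S' -> g t = h t) ->
    forall t, 0 <= t <= S -> g t = h t.
  Proof.
    intros Hg Hh L U; apply real_induction.
    - intros t Ht E.
      eapply (ode_sol_limit ode w t); try lra; auto;
        eapply ode_sol_restrict; eauto; lra.
    - intros t Ht E.
      destruct (sol_continuous_at w S g t coeff_cont) as (d & Pd & Hd); auto; try lra.
      { rewrite E by lra; apply L; lra. }
      exists (d / 2); split; [lra|]; intros s Hs HsS.
      apply (U s); try lra.
      intros s' Hs'; destruct (Rle_dec s' t).
      + rewrite E by lra; apply (locally_singleton (T := St)), L; lra.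
      + apply Hd; [lra|]; rewrite Rabs_pos_eq; lra.
  Qed.

  (** Definedness of [e] is available only at the ends of genuine runs of the original system, hence
      the hypothesis presupposes [ode_flow] up to [S]. Real induction breaks the circle: uniqueness
      up to t gives definedness on [0,t], hence continuous coefficients slightly beyond t, hence
      uniqueness a little further. *)
  Lemma ghost_project w r T g :
    ode_flow ode' (upd w Y r) T g ->
    let h := fun t => upd (g t) Y (w Y) in
    (forall S, 0 <= S <= T -> ode_flow ode w S h -> tdef e (h S)) ->
    ode_flow ode w T h.
  Proof.
    intros (HT & Hg & U) h Hd.
    assert (Hh : ode_sol ode w T h) by (eapply ghost_sol_project; eauto).
    assert (HhS : forall S, S <= T -> ode_sol ode w S h)
      by (intros; eapply ode_sol_restrict; eauto).
    assert (U' : forall S g', 0 <= S <= T -> ode_sol ode w S g' ->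
        (forall t, 0 <= t <= S -> coeff_cont (g' t)) ->
        forall t, 0 <= t <= S -> g' t = h t).
    { intros S g' HS Hg' C t Ht.
      destruct (ghost_sol_extend w r S g') as (Z & HZ); auto; try lra.
      unfold h; rewrite <- (U S _ HS HZ t Ht), upd_upd.
      rewrite <- (proj2 (proj2 Hg' t Ht) Y y_new) ; symmetry; apply upd_id. }
    enough (K : forall t, 0 <= t <= T -> ode_flow ode w t h) by (apply K; lra).
    apply real_induction.
    (* Shorter flows force agreement strictly before [S]; continuity of both solutions gives it at
       [S]. *)
    - intros t Ht K; split; [lra|]; split; [apply HhS; lra|].
      intros S g' HS Hg'.
      assert (E : forall s, 0 <= s < S -> g' s = h s).
      { intros s Hs; destruct (K s) as (_ & _ & Us); [lra|].
        apply (Us s g'); try lra; eapply ode_sol_restrict; [|exact Hg']; lra. }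
      intros s Hs; destruct (Rle_lt_or_eq_dec s S) as [Ls| ->]; try lra.
      + apply E; lra.
      + apply (ode_sol_limit ode w S); auto; try lra; apply HhS; lra.
    (* Past [t] definedness of [e] is not yet known; what persists there is local continuity of the
       coefficients, an open condition by [locally_locally]. *)
    - intros t Ht K.
      assert (Lt : forall s, 0 <= s <= t -> @locally St (h s) coeff_cont).
      { intros s Hs; apply tdef_coeff_cont, Hd; [lra|]; apply K; lra. }
      destruct (sol_continuous_at w T h t (fun u => @locally St u coeff_cont))
        as (d & Pd & Ld); auto; try lra.
      { apply (locally_locally (T := St)), Lt; lra. }
      exists (d / 2); split; [lra|]; intros s Hs HsT.
      split; [lra|]; split; [apply HhS; lra|].
      intros S g' HS Hg'; apply (branching_excluded w S); auto; try (apply HhS; lra).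
      + intros s' Hs'; destruct (Rle_dec s' t); [apply Lt; lra|].
        apply Ld; [lra|]; rewrite Rabs_pos_eq; lra.
      + intros S' HS'; apply U'; [lra|]; eapply ode_sol_restrict; [|exact Hg']; lra.
  Qed.
End Ghost.

(** * Sequents *)

Definition some_true (Dl : list dfml) (w : state) : Prop :=
  exists f, In f Dl /\ dsem f w.

Definition valid (G : ctx) (Dl : list dfml) : Prop :=
  forall w, csat G w -> some_true Dl w.

Definition ivalid (G : ctx) (Js : list dfml) (a : dprog) (f : dfml)
    (Dl : list dfml) : Prop :=
  forall w, csat G w -> (forall J, In J Js -> dsem (FBox a J) w) ->
    some_true (FBox a f :: Dl) w.

Lemma some_true_cons f Dl w : some_true (f :: Dl) w <-> dsem f w \/ some_true Dl w.
Proof.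
  split.
  - intros (g & [<-|H] & Hg); [auto|right; exists g; auto].
  - intros [H|(g & H & Hg)]; [exists f|exists g]; simpl; auto.
Qed.

Lemma some_true_nil w : ~ some_true [] w.
Proof. intros (f & [] & _). Qed.

Lemma some_true_app D1 D2 w : some_true (D1 ++ D2) w <-> some_true D1 w \/ some_true D2 w.
Proof.
  induction D1; simpl.
  - split; auto; intros [H|H]; auto; now apply some_true_nil in H.
  - rewrite !some_true_cons, IHD1; tauto.
Qed.

Lemma asms_app G1 G2 : asms (G1 ++ G2) = asms G1 ++ asms G2.
Proof. induction G1 as [|[] G1 IH]; simpl; congruence. Qed.

Lemma asms_map_asm l : asms (map asm l) = l.
Proof. induction l; simpl; congruence. Qed.

Lemma csat_app G1 G2 w : csat (G1 ++ G2) w <-> csat G1 w /\ csat G2 w.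
Proof.
  unfold csat; rewrite asms_app; split; [intros H; split; intros p Hp; apply H|
    intros (H1 & H2) p Hp]; rewrite in_app_iff in *; intuition.
Qed.

Lemma csat_cons x p G w : csat (CAsm x p :: G) w <-> dsem p w /\ csat G w.
Proof.
  unfold csat; simpl; split; [auto|]; intros (H1 & H2) q [<-|Hq]; auto.
Qed.

Lemma csat_nil w : csat [] w.
Proof. intros p []. Qed.

Lemma csat_asms Js w : csat (map asm Js) w <-> forall J, In J Js -> dsem J w.
Proof. unfold csat; now rewrite asms_map_asm. Qed.

Lemma csat_snoc G x p w : csat (G ++ [CAsm x p]) w <-> csat G w /\ dsem p w.
Proof. rewrite csat_app, csat_cons; intuition auto using csat_nil. Qed.

Lemma asms_incl_cvars G p : In p (asms G) -> incl (fvars tfv p) (cvars G).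
Proof.
  induction G as [|[x q|i e|i b] G IH]; simpl; [tauto| | |]; intros H z Hz;
    apply in_or_app; auto.
  - destruct H as [->|H]; [auto|right; now apply IH].
  - right; now apply IH.
  - right; now apply IH.
Qed.

Lemma csat_agree_off l G u v :
  agree_off l u v -> (forall x, In x l -> ~ In x (cvars G)) ->
  csat G u <-> csat G v.
Proof.
  intros O F; split; intros H p Hp; eapply (dsem_agree_off l p u v); eauto;
    intros x Hx J; apply (F x Hx); eapply asms_incl_cvars; eauto.
Qed.

Lemma some_true_agree_off l Dl u v :
  agree_off l u v -> (forall x, In x l -> ~ In x (dvars Dl)) ->
  some_true Dl u <-> some_true Dl v.
Proof.
  intros O F; split; intros (f & Hf & H); exists f; (split; [auto|]);
    eapply (dsem_agree_off l f u v); eauto;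
    intros x Hx J; apply (F x Hx), in_flat_map; eauto.
Qed.

Lemma agree_off_sym l u v : agree_off l u v -> agree_off l v u.
Proof. intros O x Hx; symmetry; auto. Qed.

Lemma agree_off_upd w x r : agree_off [x] (upd w x r) w.
Proof. intros z Hz; apply upd_other; simpl in Hz; intuition. Qed.

Lemma csat_csubst l G G' w :
  csubst l G = Some G' -> csat G' w <-> csat G (subst_state l w).
Proof.
  intros H; apply omap_Forall2 in H.
  induction H as [|[x p|i e|i b] c' G G' E HG IH]; [split; intros; apply csat_nil| | |];
    simpl in E; binv; injection E as <-.
  - rewrite !csat_cons, IH, (fsubst_sound _ _ _ _ E0); tauto.
  - exact IH.
  - exact IH.
Qed.

Lemma some_true_dsubst l Dl D' w :
  dsubst l Dl = Some D' -> some_true D' w <-> some_true Dl (subst_state l w).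
Proof.
  intros H; apply omap_Forall2 in H.
  induction H as [|p p' D D' E HD IH].
  - split; intros H; now apply some_true_nil in H.
  - rewrite !some_true_cons, IH, (fsubst_sound _ _ _ _ E); tauto.
Qed.

Lemma conj_of_sem l w : dsem (conj_of l) w <-> forall p, In p l -> dsem p w.
Proof.
  unfold dsem; induction l as [|q l IH]; simpl.
  - split; auto; tauto.
  - rewrite IH; split; [intros (H1 & H2) p [<-|Hp]; auto | auto].
Qed.

Lemma disj_of_sem l w : dsem (disj_of l) w -> some_true l w.
Proof.
  induction l as [|p [|q l] IH]; intros H.
  - exfalso; apply H; reflexivity.
  - exists p; simpl; auto.
  - apply some_true_cons; destruct H as [H|H]; auto.
Qed.

(** * Patterns and forward proofs *)

Section PatInd.
  Variable P : pat -> Prop.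
  Hypotheses (HId : forall i, P (PtId i)) (HVar : forall x, P (PtVar x))
    (HIn : forall p xs, P (PtIn p xs)) (HNotIn : forall p xs, P (PtNotIn p xs))
    (HWild : P PtWild)
    (HOr : forall p q, P p -> P q -> P (PtOr p q))
    (HAnd : forall p q, P p -> P q -> P (PtAnd p q))
    (HNot : forall p, P p -> P (PtNot p))
    (HOp : forall o ps, Forall P ps -> P (PtOp o ps)).
  Fixpoint pat_nested_ind (p : pat) : P p :=
    match p with
    | PtId i => HId i
    | PtVar x => HVar x
    | PtIn p xs => HIn p xs
    | PtNotIn p xs => HNotIn p xs
    | PtWild => HWild
    | PtOr p q => HOr p q (pat_nested_ind p) (pat_nested_ind q)
    | PtAnd p q => HAnd p q (pat_nested_ind p) (pat_nested_ind q)
    | PtNot p => HNot p (pat_nested_ind p)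
    | PtOp o ps =>
        HOp o ps
          ((fix all ps : Forall P ps :=
              match ps with
              | [] => Forall_nil P
              | p :: ps => Forall_cons p (pat_nested_ind p) (all ps)
              end) ps)
    end.
End PatInd.

(** Matching only adds abbreviations, which carry no meaning, so patterns can be ignored in every
    soundness argument. *)
Lemma pmatch_asms H p :
  forall G e G', pmatch H G p e = Some G' -> asms G' = asms G.
Proof.
  induction p as [i|x|p xs|p xs| |p q IHp IHq|p q IHp IHq|p IHp|o ps IH]
    using pat_nested_ind; simpl; intros G e G' E;
    try solve [match type of E with (if ?c then _ else _) = _ => destruct c end; congruence].
  - destruct (lookup G i) as [[e'|b]|]; try discriminate.
    + destruct expr_eq_dec; congruence.
    + injection E as <-; rewrite asms_app; simpl; apply app_nil_r.
  - congruence.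
  - destruct (pmatch H G p e) eqn:Ep; [injection E as <-|]; eauto.
  - binv; transitivity (asms r); eauto.
  - destruct forallb; [|discriminate]; destruct pmatch; congruence.
  - destruct (view e) as [[o' es]|]; [|discriminate].
    destruct op_eq_dec; [|discriminate].
    revert G es E; induction IH as [|p ps Hp _ IH]; intros G [|e' es] E;
      try congruence.
    binv; transitivity (asms r); eauto.
Qed.

Lemma pmatch_csat H G p e G' w : pmatch H G p e = Some G' -> csat G w -> csat G' w.
Proof. unfold csat; intros E; now rewrite (pmatch_asms _ _ _ _ _ E). Qed.

Section Facts.
  Variables (Sigma : dfml -> Prop) (auto_m : list dfml -> dfml -> Prop).
  Hypothesis Sigma_valid : forall f, Sigma f -> dvalid f.
  Hypothesis auto_sound : forall F f, auto_m F f ->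
     forall w, (forall g, In g F -> dsem g w) -> dsem f w.

  Lemma fpcheck_sound H G r p w : fpcheck Sigma H G r p -> csat G w -> dsem p w.
  Proof.
    intros C Hw; induction C as [p f [S|I] M|f1 f2 p q _ IH1 _ IH2|f1 t t' x p q _ IH _ E].
    - apply Sigma_valid, S.
    - now apply Hw.
    - destruct IH1 as [N|Q]; auto; now apply N in IH2.
    - rewrite (fsubst_sound _ _ _ _ E), subst_state_one; apply IH.
  Qed.

  Lemma facts_sound H G ps fs F w :
    facts Sigma H G ps fs F -> csat G w -> forall g, In g F -> dsem g w.
  Proof.
    intros HF Hw.
    assert (K : (F = asms G) \/ exists cs, Forall2 (fpcheck Sigma H G) fs cs /\
        F = filter (fun f => existsb (fun p => matches H G p f) ps) (asms G) ++ cs).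
    { destruct ps; [destruct fs|]; auto. }
    destruct K as [->|(cs & Hc & ->)]; [exact Hw|].
    intros g Hg; apply in_app_or in Hg as [Hg|Hg].
    - apply filter_In in Hg; now apply Hw.
    - destruct (Forall2_in_r _ _ _ _ Hc Hg) as (r & _ & Hr).
      eapply fpcheck_sound; eauto.
  Qed.

  Lemma show_sound H G Dl q ps fs m F f :
    facts Sigma H G ps fs F -> goal_of H G Dl q f -> closes auto_m m F f -> valid G Dl.
  Proof.
    intros HF Hg Hc w Hw.
    assert (Hs := facts_sound _ _ _ _ _ w HF Hw).
    assert (Hf : dsem f w).
    { destruct m; simpl in Hc; auto.
      - destruct Hc as (_ & V); destruct (V w) as [N|V']; auto.
        exfalso; apply N, conj_of_sem, Hs.
      - eapply auto_sound; eauto. }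
    destruct q as [q|]; simpl in Hg.
    - exists f; split; [apply Hg|auto].
    - subst f; now apply disj_of_sem.
  Qed.
End Facts.

(** * Soundness of the rules for assignments *)

Lemma fresh_notin xs H G Dl more x : fresh xs H G Dl more -> In x xs ->
  ~ In x (cvars G) /\ ~ In x (dvars Dl) /\ ~ In x more.
Proof.
  intros (_ & F) I; specialize (F x I); rewrite !in_app_iff in F; tauto.
Qed.

Lemma dvars_cons p Dl x : In x (dvars (p :: Dl)) <-> In x (fvars tfv p) \/ In x (dvars Dl).
Proof. unfold dvars; simpl; apply in_app_iff. Qed.

Lemma modal_assign b x t f w :
  dsem (modal b (PAssign x t) f) w <-> dsem f (upd w x (teval t w)).
Proof.
  destruct b; unfold dsem; simpl; split.
  - intros H; now apply H.
  - intros H v ->; auto.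
  - intros (v & -> & H); auto.
  - eauto.
Qed.

Lemma assign_sub_sound b x t f f' w :
  fsubst [(x, t)] f = Some f' -> dsem f' w <-> dsem (modal b (PAssign x t) f) w.
Proof.
  intros E; now rewrite (fsubst_sound _ _ _ _ E), subst_state_one, modal_assign.
Qed.

(** In [v] the fresh [xi] remembers the old value of [x]. Renaming [x] to [xi] thus undoes the
    assignment: context and side formulas mean in [v] what they meant in [w], while [f] sees the new
    value. *)
Lemma renamed_state_sound H G G1 Dl D1 x xi g f w r :
  fresh [xi] H G (g :: Dl) [] -> In x (fvars tfv g) ->
  incl (fvars tfv f) (fvars tfv g) ->
  csubst [(x, TVar xi)] G = Some G1 -> dsubst [(x, TVar xi)] Dl = Some D1 ->
  csat G w ->
  let v := upd (upd w x r) xi (w x) in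
  v x = r /\ csat G1 v /\ (some_true D1 v -> some_true Dl w) /\
  (dsem f v -> dsem f (upd w x r)) /\ agree_off [xi] (upd v x (v xi)) w.
Proof.
  intros Fr Ix If EG ED Hw v.
  destruct (fresh_notin _ _ _ _ _ xi Fr) as (FG & FD & _); [simpl; auto|].
  rewrite dvars_cons in FD.
  assert (N : x <> xi) by (intros <-; tauto).
  assert (O : agree_off [xi] (upd v x (v xi)) w).
  { intros z Hz; simpl in Hz; unfold v; rewrite upd_same.
    unfold upd; repeat destruct var_eq_dec; subst; tauto. }
  assert (ES : subst_state [(x, TVar xi)] v = upd v x (v xi)) by apply subst_state_one.
  split; [|split; [|split; [|split]]]; auto.
  - unfold v; rewrite upd_other, upd_same; auto.
  - rewrite (csat_csubst _ _ _ _ EG), ES.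
    eapply csat_agree_off; eauto; simpl; intros z [<-|[]]; auto.
  - rewrite (some_true_dsubst _ _ _ _ ED), ES.
    rewrite (some_true_agree_off [xi] Dl _ _ O); auto; simpl; intros z [<-|[]]; auto.
  - rewrite (dsem_agree_off [xi] f v _ (agree_off_upd _ _ _)); auto.
    simpl; intros z [<-|[]] J; apply FD; left; auto.
Qed.

Lemma assign_eq_sound H G G1 b x xi t t1 f Dl D1 :
  fresh [xi] H G (modal b (PAssign x t) f :: Dl) [] ->
  csubst [(x, TVar xi)] G = Some G1 ->
  tsubst [(x, TVar xi)] t = Some t1 ->
  dsubst [(x, TVar xi)] Dl = Some D1 ->
  valid (G1 ++ [asm (FCmp EQ (TVar x) t1)]) (f :: D1) ->
  valid G (modal b (PAssign x t) f :: Dl).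
Proof.
  intros Fr EG Et ED V w Hw.
  assert (Iv : fvars tfv (modal b (PAssign x t) f) = (x :: tfv t) ++ fvars tfv f)
    by now destruct b.
  destruct (renamed_state_sound H G G1 Dl D1 x xi _ f w (teval t w) Fr)
    as (Ex & HG & HD & Hf & O); auto.
  { rewrite Iv; simpl; auto. }
  { rewrite Iv; apply incl_appr, incl_refl. }
  set (v := upd (upd w x (teval t w)) xi (w x)) in *.
  apply some_true_cons; destruct (V v) as (g & [<-|Hg] & Hv).
  - apply csat_snoc; split; auto; unfold dsem; simpl.
    rewrite Ex, (tsubst_sound _ _ _ _ Et), subst_state_one; simpl.
    apply teval_agree; intros z Hz; symmetry; apply O; simpl; intros [<-|[]].
    destruct (fresh_notin _ _ _ _ _ xi Fr) as (_ & FD & _); [simpl; auto|].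
    apply FD, dvars_cons; rewrite Iv; left; apply in_or_app; simpl; auto.
  - left; apply modal_assign; auto.
  - right; apply HD; exists g; auto.
Qed.

Lemma assign_any_sound H G G1 x xi f Dl D1 :
  fresh [xi] H G (FBox (PRand x) f :: Dl) [] ->
  csubst [(x, TVar xi)] G = Some G1 ->
  dsubst [(x, TVar xi)] Dl = Some D1 ->
  valid G1 (f :: D1) -> valid G (FBox (PRand x) f :: Dl).
Proof.
  intros Fr EG ED V w Hw; apply some_true_cons.
  destruct (classic (some_true Dl w)) as [HD|HD]; auto; left.
  intros v (r & ->).
  destruct (renamed_state_sound H G G1 Dl D1 x xi _ f w r Fr)
    as (_ & HG & HD' & Hf & _); auto; simpl; auto.
  { apply incl_tl, incl_refl. }
  destruct (V _ HG) as (g & [<-|Hg] & Hv); [now apply Hf|].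
  exfalso; apply HD, HD'; exists g; auto.
Qed.

(** * Abstraction *)

Lemma sigma_combine_in bs ys z :
  length ys = length bs -> In z bs ->
  exists y, In y ys /\ sigma (combine bs (map TVar ys)) z = TVar y.
Proof.
  revert ys; induction bs as [|b bs IH]; intros [|y ys] L I; try discriminate;
    [destruct I|]; destruct I as [->|I]; unfold sigma; simpl;
    destruct var_eq_dec; try congruence; try (exists y; simpl; auto; fail).
  destruct (IH ys) as (y' & Iy & E); auto; exists y'; simpl; auto.
Qed.

Lemma sigma_combine_notin bs (ts : list term) z :
  ~ In z bs -> sigma (combine bs ts) z = TVar z.
Proof.
  revert ts; induction bs as [|b bs IH]; intros [|t ts] N; auto.
  unfold sigma; simpl; destruct var_eq_dec as [->|Nz].
  - exfalso; apply N; simpl; auto.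
  - apply IH; intros I; apply N; simpl; auto.
Qed.

(** The fresh [ys] are overwritten with the values that [bs] had in [w], so that the renaming reads
    off the old state from the new one. *)
Lemma saved_state bs ys w u :
  length ys = length bs -> NoDup ys ->
  exists u', agree_off ys u' u /\
    forall z, In z bs -> subst_state (combine bs (map TVar ys)) u' z = w z.
Proof.
  revert ys; induction bs as [|b bs IH]; intros [|y ys] L N; try discriminate.
  - exists u; split; [intros z _; reflexivity|intros z []].
  - inversion N as [|y' ys' Ny N']; subst.
    destruct (IH ys) as (u1 & O & S); auto.
    exists (upd u1 y (w b)); split.
    + intros z Hz; simpl in Hz; rewrite upd_other, O; intuition.
    + intros z Hz; unfold subst_state, sigma; simpl.
      destruct var_eq_dec as [->|Nz]; [apply upd_same|].
      destruct Hz as [->|Hz]; [congruence|].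
      rewrite <- (S z Hz); unfold subst_state.
      change (teval (sigma (combine bs (map TVar ys)) z) (upd u1 y (w b)) =
              teval (sigma (combine bs (map TVar ys)) z) u1).
      destruct (sigma_combine_in bs ys z) as (y' & Iy & ->); auto.
      apply upd_other; congruence.
Qed.

Lemma abstraction_notin a ys more H G Dl Ha Ga Da y :
  abstraction a ys more H G Dl Ha Ga Da -> In y ys ->
  ~ In y (pvars tfv a) /\ ~ In y more.
Proof.
  intros (_ & F & _) I; destruct (fresh_notin _ _ _ _ _ y F I) as (_ & _ & N).
  rewrite in_app_iff in N; tauto.
Qed.

(** [zs] makes room for the variable of a loop variant. *)
Lemma abstraction_sound a ys more H G Dl Ha Ga Da zs w u :
  abstraction a ys more H G Dl Ha Ga Da ->
  csat G w -> agree_off (bv a ++ zs) u w ->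
  (forall z, In z zs -> ~ In z (cvars G) /\ ~ In z (dvars Dl)) ->
  exists u', agree_off ys u' u /\ csat Ga u' /\ (some_true Da u' -> some_true Dl w).
Proof.
  intros Ab Hw O Fz; pose proof Ab as (L & F & EG & ED & _).
  destruct (saved_state (bvset a) ys w u L) as (u' & O' & S); [apply F|].
  exists u'; split; auto.
  assert (A : agree_off (ys ++ zs)
                (subst_state (combine (bvset a) (map TVar ys)) u') w).
  { intros z Hz; rewrite in_app_iff in Hz.
    destruct (in_dec var_eq_dec z (bvset a)) as [I|N]; auto.
    unfold subst_state; rewrite (sigma_combine_notin _ _ _ N); simpl.
    unfold bvset in N; rewrite nodup_In in N.
    rewrite O', O; auto; rewrite in_app_iff; tauto. }
  rewrite (csat_csubst _ _ _ _ EG), (some_true_dsubst _ _ _ _ ED); split.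
  - eapply csat_agree_off; eauto; intros x Hx; apply in_app_or in Hx as [Hx|Hx].
    + now apply (fresh_notin _ _ _ _ _ x F).
    + now apply Fz.
  - rewrite (some_true_agree_off _ Dl _ _ A); auto.
    intros x Hx; apply in_app_or in Hx as [Hx|Hx].
    + now apply (fresh_notin _ _ _ _ _ x F).
    + now apply Fz.
Qed.

Lemma abstraction_run_sound a ys more H G Dl Ha Ga Da w u :
  abstraction a ys more H G Dl Ha Ga Da -> csat G w -> agree_off (bv a) u w ->
  exists u', agree_off ys u' u /\ csat Ga u' /\ (some_true Da u' -> some_true Dl w).
Proof.
  intros Ab Hw O; eapply (abstraction_sound _ _ _ _ _ _ _ _ _ []); eauto.
  now rewrite app_nil_r.
Qed.

Lemma abstraction_dsem a ys more H G Dl Ha Ga Da p u u' :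
  abstraction a ys more H G Dl Ha Ga Da -> agree_off ys u' u ->
  incl (fvars tfv p) (pvars tfv a ++ more) -> dsem p u' <-> dsem p u.
Proof.
  intros Ab O I; apply (dsem_agree_off ys); auto; intros x Hx J.
  destruct (abstraction_notin _ _ _ _ _ _ _ _ _ x Ab Hx).
  apply I, in_app_or in J as []; auto.
Qed.

Arguments abstraction_notin {a ys more H G Dl Ha Ga Da} y _ _.
Arguments abstraction_run_sound {a ys more H G Dl Ha Ga Da} w u _ _ _.
Arguments abstraction_sound {a ys more H G Dl Ha Ga Da} zs w u _ _ _ _.
Arguments abstraction_dsem {a ys more H G Dl Ha Ga Da} p {u u'} _ _ _.

Lemma incl_dvars J Js : In J Js -> incl (fvars tfv J) (dvars Js).
Proof. intros I x Hx; apply in_flat_map; eauto. Qed.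

Lemma after_sound b a p f ys more H G Dl Ha Ga Da :
  abstraction a ys more H G Dl Ha Ga Da ->
  incl (fvars tfv p) more -> incl (fvars tfv f) more ->
  valid G (modal b a p :: Dl) -> valid (Ga ++ [asm p]) (f :: Da) ->
  valid G (modal b a f :: Dl).
Proof.
  intros Ab Ip If V1 V2 w Hw; apply some_true_cons.
  destruct (classic (some_true Dl w)) as [HD|HD]; auto; left.
  (* The second premise is applied in the reached state with the initial values saved; the resulting
     implication serves box and diamond alike. *)
  assert (K : forall u, drun a w u -> dsem p u -> dsem f u).
  { intros u Hu Hp.
    destruct (abstraction_run_sound w u Ab Hw (bound_effect _ _ _ Hu))
      as (u' & O & HG & HD').
    destruct (V2 u') as (g & [<-|Hg] & Hv).
    - apply csat_snoc; split; auto.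
      apply (abstraction_dsem p Ab O); auto; now apply incl_appr.
    - apply (abstraction_dsem f Ab O); auto; now apply incl_appr.
    - exfalso; apply HD, HD'; exists g; auto. }
  destruct (V1 w Hw) as (g & [<-|Hg] & Hv); [|exfalso; apply HD; exists g; auto].
  destruct b; simpl in *.
  - intros u Hu; apply K; auto; apply Hv, Hu.
  - destruct Hv as (u & Hu & Hp); exists u; split; [exact Hu|].
    apply K; [exact Hu|exact Hp].
Qed.

(** * Loops *)

Lemma loop_inv_sound a p f ys more H G Dl Ha Ga Da Js :
  abstraction a ys more H G Dl Ha Ga Da ->
  incl (dvars Js) more -> incl (fvars tfv p) more ->
  valid (G ++ map asm Js) (p :: Dl) ->
  valid (Ga ++ map asm Js ++ [asm p]) (FBox a p :: Da) ->
  ivalid G (Js ++ [p]) (PLoop a) f Dl -> ivalid G Js (PLoop a) f Dl.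
Proof.
  intros Ab IJ Ip V1 V2 V3 w Hw HJ.
  destruct (classic (some_true Dl w)) as [HD|HD]; [apply some_true_cons; auto|].
  apply V3; auto; intros J HJ1; apply in_app_or in HJ1 as [HJ1|[<-|[]]]; auto.
  intros v Hv.
  assert (Hp0 : dsem p w).
  { destruct (V1 w) as (g & [<-|Hg] & Hg'); auto; [|exfalso; apply HD; exists g; auto].
    apply csat_app; split; auto; apply csat_asms; intros J HJ1.
    apply (HJ J HJ1); apply rt_refl. }
  (* Splitting off the last iteration keeps the prefix a run of the loop from [w], so the earlier
     invariants [Js] hold in [u]. *)
  apply clos_rt_rtn1 in Hv; induction Hv as [|u v Huv Hwu IH]; auto.
  apply clos_rtn1_rt in Hwu.
  destruct (abstraction_run_sound w u Ab Hw
              (bound_effect (PLoop a) _ _ Hwu)) as (u' & O & HG & HD').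
  destruct (V2 u') as (g & [<-|Hg] & Hg').
  - rewrite !csat_app; split; [auto|split].
    + apply csat_asms; intros J HJ1; apply (abstraction_dsem J Ab O).
      * apply incl_appr; eapply incl_tran; [apply incl_dvars|]; eauto.
      * apply (HJ J HJ1); exact Hwu.
    + apply csat_cons; split; [|apply csat_nil].
      apply (abstraction_dsem p Ab O); auto; now apply incl_appr.
  - assert (K : dsem (FBox a p) u).
    { apply (abstraction_dsem (FBox a p) Ab O); auto; simpl.
      apply incl_app; [apply incl_appl, incl_refl|now apply incl_appr]. }
    apply K, Huv.
  - exfalso; apply HD, HD'; exists g; auto.
Qed.

Lemma loop_finally_sound a f ys more H G Dl Ha Ga Da Js :
  abstraction a ys more H G Dl Ha Ga Da ->
  incl (dvars Js) more -> incl (fvars tfv f) more ->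
  valid (Ga ++ map asm Js) (f :: Da) -> ivalid G Js (PLoop a) f Dl.
Proof.
  intros Ab IJ If V w Hw HJ; apply some_true_cons.
  destruct (classic (some_true Dl w)) as [HD|HD]; auto; left; intros u Hu.
  destruct (abstraction_run_sound w u Ab Hw
              (bound_effect (PLoop a) _ _ Hu)) as (u' & O & HG & HD').
  destruct (V u') as (g & [<-|Hg] & Hg').
  - rewrite !csat_app; split; auto.
    apply csat_asms; intros J HJ1; apply (abstraction_dsem J Ab O).
    + apply incl_appr; eapply incl_tran; [apply incl_dvars|]; eauto.
    + apply (HJ J HJ1); exact Hu.
  - apply (abstraction_dsem f Ab O); auto; now apply incl_appr.
  - exfalso; apply HD, HD'; exists g; auto.
Qed.

Lemma Q2R_0 : Q2R 0 = 0.
Proof. unfold Q2R; simpl; field. Qed.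

(** The variant is real-valued but drops by exactly one per iteration while positive, so a natural
    number above its initial value bounds the iterations and carries the induction. *)
Lemma variant_sound a f v p p1 ys H G Dl Ha Ga Da :
  fresh [v] H G (FDia (PLoop a) f :: Dl) [] ->
  fsubst [(v, TMinus (TVar v) (TConst 1))] p = Some p1 ->
  abstraction a ys (v :: fvars tfv p ++ fvars tfv f) H G Dl Ha Ga Da ->
  valid G (FEx v p :: Dl) ->
  valid (Ga ++ [asm p; asm (FCmp GT (TVar v) (TConst 0))]) (FDia a p1 :: Da) ->
  valid (Ga ++ [asm p; asm (FCmp LE (TVar v) (TConst 0))]) [FDia (PLoop a) f] ->
  valid G (FDia (PLoop a) f :: Dl).
Proof.
  intros Fr Ep Ab V1 V2 V3 w Hw; apply some_true_cons.
  destruct (classic (some_true Dl w)) as [HD|HD]; auto; left.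
  destruct (fresh_notin _ _ _ _ _ v Fr) as (FG & FD & _); [simpl; auto|].
  rewrite dvars_cons in FD; simpl in FD; rewrite in_app_iff in FD.
  assert (Zs : forall z, In z [v] -> ~ In z (cvars G) /\ ~ In z (dvars Dl))
    by (intros z [<-|[]]; tauto).
  assert (Ny : ~ In v ys)
    by (intros I; apply (abstraction_notin v Ab I); simpl; auto).
  assert (Q0 := Q2R_0).
  assert (Q1 : Q2R 1 = 1) by (unfold Q2R; simpl; field).
  assert (Ip : incl (fvars tfv p) (pvars tfv a ++ v :: fvars tfv p ++ fvars tfv f))
    by (intros z Hz; rewrite in_app_iff; simpl; rewrite in_app_iff; auto).
  assert (If : incl (fvars tfv (FDia (PLoop a) f))
                 (pvars tfv a ++ v :: fvars tfv p ++ fvars tfv f))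
    by (simpl; intros z; rewrite !in_app_iff; simpl; rewrite in_app_iff; tauto).
  (* [v] is exempt from agreement with [w], since the induction lowers it although [a] does not bind
     it. *)
  assert (K : forall n u, agree_off (bv a ++ [v]) u w -> dsem p u -> u v <= INR n ->
            dsem (FDia (PLoop a) f) u).
  { intros n; induction n as [|n IH]; intros u O Hp Hn;
      destruct (abstraction_sound [v] w u Ab Hw O Zs)
        as (u' & O' & HG & HD');
      assert (Ev : u' v = u v) by (now apply O');
      assert (Hp' : dsem p u') by (apply (abstraction_dsem p Ab O'); auto);
      (destruct (Rle_dec (u v) 0) as [Hv|Hv];
       [ apply (abstraction_dsem (FDia (PLoop a) f) Ab O'); [exact If|];
         destruct (V3 u') as (g & [<-|[]] & Hg); auto;
         unfold asm; rewrite csat_app, !csat_cons; repeat split; auto using csat_nil;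
         unfold dsem; simpl; lra | ]).
    - simpl in Hn; lra.
    - destruct (V2 u') as (g & [<-|Hg] & Hg').
      + unfold asm; rewrite csat_app, !csat_cons; repeat split; auto using csat_nil.
        unfold dsem; simpl; lra.
      + destruct Hg' as (x' & Hx' & Hx1).
        change (dsem p1 x') in Hx1; rewrite (fsubst_sound _ _ _ _ Ep), subst_state_one in Hx1.
        simpl in Hx1; rewrite Q1 in Hx1.
        destruct (drun_agree_off ys a u' u x') as (x & Hx & Ox); auto.
        { intros y Iy; apply (abstraction_notin y Ab Iy). }
        assert (Exv : x v = u v).
        { apply (bound_effect _ _ _ Hx); intros I; apply bv_incl_vars in I; tauto. }
        assert (Exv' : x' v = u v) by (rewrite Ox; auto).
        (* [p1] in [x'] means [p] with [v] lowered by one, and [a] keeps [v], so the induction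
           hypothesis fits the state with [v] set to [u v - 1]. Freshness of [v] then lets the
           conclusion return to [x]. *)
        assert (D : dsem (FDia (PLoop a) f) (upd x v (u v - 1))).
        { apply IH.
          - intros z Hz; rewrite in_app_iff in Hz; simpl in Hz.
            rewrite upd_other by (intros ->; tauto).
            rewrite (bound_effect _ _ _ Hx) by tauto; apply O.
            rewrite in_app_iff; simpl; tauto.
          - eapply (dsem_agree_off ys p); [| |exact Hx1].
            + intros z Hz; rewrite Exv'; unfold upd; destruct var_eq_dec; auto.
              symmetry; auto.
            + intros y Iy J; apply (abstraction_notin y Ab Iy).
              simpl; rewrite in_app_iff; auto.
          - rewrite upd_same; rewrite S_INR in Hn; lra. }
        apply (dsem_agree_off [v] _ _ x) in D; [|apply agree_off_upd|].
        2: { simpl; intros z [<-|[]]; rewrite in_app_iff; tauto. }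
        destruct D as (z & Hz & Hf); exists z; split; auto.
        eapply rt_trans; [apply rt_step; exact Hx|exact Hz].
      + exfalso; apply HD, HD'; exists g; auto. }
  destruct (V1 w Hw) as (g & [<-|Hg] & Hv); [|exfalso; apply HD; exists g; auto].
  destruct Hv as (r & Hr).
  destruct (INR_unbounded r) as (n & Hn).
  apply (dsem_agree_off [v] _ (upd w v r)); [apply agree_off_upd| |].
  { simpl; intros z [<-|[]]; rewrite in_app_iff; tauto. }
  apply (K n); auto.
  - intros z Hz; apply agree_off_upd; rewrite in_app_iff in Hz; tauto.
  - rewrite upd_same; lra.
Qed.

(** * Differential equations *)

Lemma subst_state_cons x e l w :
  subst_state ((x, e) :: l) w = upd (subst_state l w) x (teval e w).
Proof.
  apply functional_extensionality; intros z; unfold subst_state, sigma, upd; simpl.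
  destruct var_eq_dec; reflexivity.
Qed.

(** Both sides are the same iterated update, as [sigma] and [curve] both let the first entry
    prevail. The list [l] lets the base states differ on auxiliary variables such as time. *)
Lemma subst_curve ode ys ys' t l w w' r :
  agree_off l w' w ->
  Forall2 (fun e e' => teval e' w' = teval e (upd w t r)) ys ys' ->
  agree_off l (subst_state (combine (odevars ode) ys') w') (curve ode ys t w r).
Proof.
  intros O F; unfold curve; generalize (odevars ode) as xs; intros xs; revert xs.
  induction F as [|e e' ys ys' E F IH]; intros [|x xs]; try exact O.
  simpl; rewrite subst_state_cons, E; intros z Hz; unfold upd.
  destruct var_eq_dec; auto; now apply IH.
Qed.

Lemma during_sem s e qs w :
  dsem (during s e qs) w <->
  forall r, 0 <= r <= teval e (upd w s r) -> dsem qs (upd w s r).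
Proof.
  unfold during, dsem; simpl.
  assert (E : forall r, upd w s r s = r) by (intros; apply upd_same).
  split; intros H r; specialize (H r); rewrite Q2R_0, E in *.
  - intros Hr; destruct H as [N|H]; auto; tauto.
  - destruct (classic (0 <= r <= teval e (upd w s r))) as [C|C]; auto.
Qed.

Lemma at_time_sound t e ys ys' w :
  at_time t e ys = Some ys' ->
  Forall2 (fun y y' => teval y' w = teval y (upd w t (teval e w))) ys ys'.
Proof.
  intros H; apply omap_Forall2 in H.
  induction H as [|y y' ys ys' E H IH]; constructor; auto.
  now rewrite (tsubst_sound _ _ _ _ E), subst_state_one.
Qed.

Lemma Forall2_refl {X} (P : X -> X -> Prop) l :
  (forall x, In x l -> P x x) -> Forall2 P l l.
Proof. induction l; intros H; constructor; simpl in *; auto. Qed.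

Lemma Forall2_impl_in {X Y} (P Q : X -> Y -> Prop) l l' :
  (forall x y, In x l -> P x y -> Q x y) -> Forall2 P l l' -> Forall2 Q l l'.
Proof.
  intros I F; induction F; constructor; simpl in *; auto.
Qed.

Section Solve.
  Variables (ode : list (nat * term)) (q : dfml) (ys : list term) (t s : var).
  Hypothesis s_new : ~ In s (flat_map tfv ys).
  Hypothesis ts : t <> s.

  Lemma ys_upd_s w r : forall y, In y ys -> teval y (upd w s r) = teval y w.
  Proof.
    intros y Hy; apply teval_upd_notin; intros I; apply s_new, in_flat_map; eauto.
  Qed.

  Lemma upd_comm w x y a b : x <> y -> upd (upd w x a) y b = upd (upd w y b) x a.
  Proof.
    intros N; apply functional_extensionality; intros z; unfold upd.
    repeat destruct var_eq_dec; congruence.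
  Qed.

  (** In [yss] time is read from [s] alone, so [w'] may hold another value of [t], such as the total
      duration. *)
  Lemma at_time_s_sound yss qs w w' r :
    at_time t (TVar s) ys = Some yss ->
    fsubst (solution_subst ode yss) q = Some qs ->
    (forall x, In x [t; s] -> ~ In x (fvars tfv q)) ->
    agree_off [t] w' w ->
    dsem qs (upd w' s r) <-> dsem q (curve ode ys t w r).
  Proof.
    intros Ey Eq F O; rewrite (fsubst_sound _ _ _ _ Eq).
    apply (dsem_agree_off [t; s]); auto.
    apply subst_curve.
    - intros z Hz; simpl in Hz; rewrite upd_other by (intros ->; tauto).
      apply O; simpl; intuition.
    - eapply Forall2_impl_in; [|apply (at_time_sound t (TVar s) ys yss (upd w' s r) Ey)].
      intros y y' Hy ->; simpl; rewrite upd_same, upd_comm, ys_upd_s by auto.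
      f_equal; apply functional_extensionality; intros z; unfold upd.
      destruct var_eq_dec; auto; apply O; simpl; intuition.
  Qed.
End Solve.

Lemma solve_box_sound H G ode q f f' Dl ys yss t s qs :
  fresh [t; s] H G (FBox (PODE ode q) f :: Dl) [] ->
  ~ In s (flat_map tfv ys) ->
  (forall w T g, csat G w -> ode_flow ode w T g ->
     (forall r, 0 <= r <= T -> dsem q (g r)) ->
     ode_sol ode w T (curve ode ys t w)) ->
  at_time t (TVar s) ys = Some yss ->
  fsubst (solution_subst ode yss) q = Some qs ->
  fsubst (solution_subst ode ys) f = Some f' ->
  valid (G ++ [asm (FCmp GE (TVar t) (TConst 0)); asm (during s (TVar t) qs)])
        (f' :: Dl) ->
  valid G (FBox (PODE ode q) f :: Dl).
Proof.
  intros Fr Ns Sol Ey Eq Ef V w Hw; apply some_true_cons.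
  destruct (classic (some_true Dl w)) as [HD|HD]; auto; left.
  intros v (T & g & Hg & Hq & ->).
  assert (Fts : forall x, In x [t; s] -> ~ In x (cvars G) /\ ~ In x (dvars Dl) /\
      ~ In x (fvars tfv q) /\ ~ In x (fvars tfv f)).
  { intros x Hx; destruct (fresh_notin _ _ _ _ _ x Fr Hx) as (FG & FD & _).
    rewrite dvars_cons in FD; simpl in FD; rewrite !in_app_iff in FD; tauto. }
  assert (ts : t <> s) by (destruct Fr as (N & _); inversion N; simpl in *; intuition).
  assert (HT : 0 <= T) by apply Hg.
  (* The curve is a solution, and the uniqueness built into the flow identifies it with [g]. *)
  assert (E : forall r, 0 <= r <= T -> curve ode ys t w r = g r).
  { apply (proj2 (proj2 Hg)); [lra|]; eapply Sol; eauto. }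
  (* The fresh time variable receives the duration of the given run. *)
  set (w1 := upd w t T).
  assert (O1 : agree_off [t] w1 w) by apply agree_off_upd.
  destruct (V w1) as (h & [<-|Hh] & Hv).
  - rewrite csat_app; split.
    { eapply (csat_agree_off [t]); eauto; intros x [<-|[]]; apply Fts; simpl; auto. }
    apply csat_cons; split; [|apply csat_cons; split; [|apply csat_nil]].
    + unfold dsem, w1; simpl; rewrite upd_same, Q2R_0; lra.
    + apply during_sem; intros r Hr; simpl in Hr; unfold w1 in Hr.
      rewrite upd_other, upd_same in Hr by auto.
      rewrite (at_time_s_sound ode q ys t s Ns ts yss qs w w1 r Ey Eq); auto.
      * rewrite E by auto; apply Hq; auto.
      * intros x Hx; now apply Fts.
  - rewrite (fsubst_sound _ _ _ _ Ef) in Hv; change (dsem f (g T)); rewrite <- E by lra.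
    eapply (dsem_agree_off [t]); [| |exact Hv].
    + apply agree_off_sym, subst_curve; auto; apply Forall2_refl; auto.
    + intros x [<-|[]]; apply Fts; simpl; auto.
  - exfalso; apply HD; eapply (some_true_agree_off [t]); [apply agree_off_sym, O1| |].
    + intros x [<-|[]]; apply Fts; simpl; auto.
    + exists h; auto.
Qed.

Lemma solve_dia_sound H G ode q f f' Dl ys yss yst t s et qs :
  fresh [t; s] H G (FDia (PODE ode q) f :: Dl) (tfv et) ->
  ~ In s (flat_map tfv ys) ->
  (forall w, csat G w -> 0 <= teval et w ->
     ode_flow ode w (teval et w) (curve ode ys t w)) ->
  at_time t (TVar s) ys = Some yss ->
  at_time t et ys = Some yst ->
  fsubst (solution_subst ode yss) q = Some qs ->
  fsubst (solution_subst ode yst) f = Some f' ->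
  valid G (FAnd (FCmp GE et (TConst 0)) (during s et qs) :: Dl) ->
  valid G (f' :: Dl) -> valid G (FDia (PODE ode q) f :: Dl).
Proof.
  intros Fr Ns Sol Ey Et Eq Ef V1 V2 w Hw; apply some_true_cons.
  destruct (classic (some_true Dl w)) as [HD|HD]; auto; left.
  assert (Fts : forall x, In x [t; s] -> ~ In x (fvars tfv q) /\ ~ In x (fvars tfv f) /\
      ~ In x (tfv et)).
  { intros x Hx; destruct (fresh_notin _ _ _ _ _ x Fr Hx) as (FG & FD & Fe).
    rewrite dvars_cons in FD; simpl in FD; rewrite !in_app_iff in FD; tauto. }
  assert (ts : t <> s) by (destruct Fr as (N & _); inversion N; simpl in *; intuition).
  destruct (V1 w Hw) as (h & [<-|Hh] & Hv); [|exfalso; apply HD; exists h; auto].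
  destruct Hv as (H0 & Hd); change (dsem (during s et qs) w) in Hd.
  simpl in H0; rewrite Q2R_0 in H0; apply Rge_le in H0.
  rewrite during_sem in Hd.
  destruct (V2 w Hw) as (h & [<-|Hh] & Hv'); [|exfalso; apply HD; exists h; auto].
  exists (curve ode ys t w (teval et w)); split.
  - exists (teval et w), (curve ode ys t w); split; [now apply Sol|]; split; auto.
    intros r Hr.
    apply (at_time_s_sound ode q ys t s Ns ts yss qs w w r Ey Eq).
    + intros x Hx; now apply Fts.
    + intros x _; reflexivity.
    + apply Hd; rewrite teval_upd_notin; auto; apply Fts; simpl; auto.
  - change (dsem f (curve ode ys t w (teval et w))).
    rewrite (fsubst_sound _ _ _ _ Ef) in Hv'.
    eapply (dsem_agree_off []); [| |exact Hv'].
    + apply agree_off_sym, subst_curve; [intros x _; reflexivity|].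
      now apply at_time_sound.
    + intros x [].
Qed.

(** * Differential invariants *)

Lemma diff_assigns_sem ode p v :
  nodiff (flat_map (fun xe => tfv (snd xe)) ode) -> dsem (diff_assigns ode p) v ->
  exists u, dsem p u /\ (forall n, u (V n) = v (V n)) /\
    (forall n, In (V n) (odevars ode) ->
       exists e, In (n, e) ode /\ u (D n) = teval e v) /\
    (forall n, ~ In (V n) (odevars ode) -> u (D n) = v (D n)).
Proof.
  revert v; induction ode as [|[x e] ode IH]; simpl; intros v N H.
  - exists v; repeat split; auto; intros n [].
  - assert (N1 : nodiff (flat_map (fun xe => tfv (snd xe)) ode))
      by (intros n Hn; apply (N n), in_or_app; auto).
    destruct (IH (upd v (D x) (teval e v)) N1) as (u & Hp & EV & ED & EN).
    { apply H; reflexivity. }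
    exists u; split; [auto|]; split; [|split].
    + intros n; rewrite EV; apply upd_other; discriminate.
    (* If a variable had several equations the last assignment would win, so only some equation for
       [n] is obtained; a solution satisfies all of them. Right-hand sides contain no differential
       variables and are not disturbed by earlier assignments. *)
    + intros n Hn; destruct (in_dec var_eq_dec (V n) (odevars ode)) as [I|I].
      * destruct (ED n I) as (e' & Ie & ->); exists e'; split; auto.
        apply teval_upd_notin; intros J; apply (N1 x), in_flat_map.
        exists (n, e'); auto.
      * destruct Hn as [Hn|Hn]; [injection Hn as <-|tauto].
        exists e; split; auto; rewrite (EN x I); apply upd_same.
    + intros n Hn; rewrite EN by tauto; apply upd_other; intros E; injection E as ->; auto.
Qed.

Lemma flow_run ode q w T g t :
  ode_flow ode w T g -> (forall s, 0 <= s <= T -> dsem q (g s)) -> 0 <= t <= T ->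
  drun (PODE ode q) w (g t).
Proof.
  intros Hg Hq Ht; exists t, g; split; [|split]; auto.
  - eapply ode_flow_restrict; eauto.
  - intros s Hs; apply Hq; lra.
Qed.

(** A prefix of a flow is a run, so the boxed [Js] hold at all intermediate times and the flow stays
    in the stronger domain that [along] mentions. *)
Lemma along_flow G ode q Js P w T g :
  along G ode q Js P -> csat G w -> (forall J, In J Js -> dsem (FBox (PODE ode q) J) w) ->
  ode_flow ode w T g -> (forall s, 0 <= s <= T -> dsem q (g s)) ->
  forall t, 0 <= t <= T -> P (g t).
Proof.
  intros Al Hw HJ Hg Hq t Ht; apply (Al w); auto.
  eapply flow_run; eauto; intros s Hs.
  assert (K : dsem q (g s) /\ dsem (conj_of Js) (g s)); [|exact K].
  split; auto; apply conj_of_sem; intros J IJ; apply (HJ J IJ).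
  eapply flow_run; eauto.
Qed.

Lemma D_in_const_on h c (P : R -> Prop) t :
  (forall s, P s -> h s = c) -> P t -> D_in h (fun _ => 0) P t.
Proof.
  intros E Ht eps He; exists 1; split; [lra|]; intros s ((Hs & _) & _).
  simpl; unfold R_dist; rewrite !E by auto.
  unfold Rdiv; rewrite Rminus_diag, Rmult_0_l, Rminus_diag, Rabs_R0; auto.
Qed.

Definition zero_diffs (u : state) : state :=
  fun z => match z with V n => u (V n) | D _ => 0 end.

Lemma zero_diffs_agree l u : nodiff l -> agree l (zero_diffs u) u.
Proof. intros N [n|n] Hz; [reflexivity|exfalso; eapply N; eauto]. Qed.

(** Differential variables outside the system are unconstrained by the induction
    step; with the value 0 they make it speak of the derivative along the flow. *)
Lemma ode_inv_sound ode q p p' f ys more H G Dl Ha Ga Da Js :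
  fdiff p = Some p' ->
  abstraction (PODE ode q) ys more H G Dl Ha Ga Da ->
  incl (dvars Js) more -> incl (fvars tfv p) more ->
  along G ode q Js (fdifferentiable p) ->
  nodiff (flat_map ffv (asms Ga ++ Js ++ q :: p :: Da) ++
          flat_map (fun xe => tfv (snd xe)) ode) ->
  valid (G ++ map asm Js) (p :: Dl) ->
  valid (Ga ++ map asm Js ++ [asm q]) (diff_assigns ode p' :: Da) ->
  ivalid G (Js ++ [p]) (PODE ode q) f Dl -> ivalid G Js (PODE ode q) f Dl.
Proof.
  intros Ep Ab IJ Ip Al Nd V1 V2 V3 w Hw HJ.
  destruct (classic (some_true Dl w)) as [HD|HD]; [apply some_true_cons; auto|].
  apply V3; auto; intros J HJ1; apply in_app_or in HJ1 as [HJ1|[<-|[]]]; auto.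
  intros v (T & g & Hg & Hq & ->); change (dsem p (g T)).
  change (forall t, 0 <= t <= T -> dsem q (g t)) in Hq.
  assert (HT : 0 <= T) by apply Hg.
  assert (G0 : g 0 = w) by apply Hg.
  assert (Js_g : forall J t, In J Js -> 0 <= t <= T -> dsem J (g t)).
  { intros J t HJ1 Ht; apply (HJ J HJ1); eapply flow_run; eauto. }
  assert (Hp0 : dsem p w).
  { destruct (V1 w) as (h & [<-|Hh] & Hh'); auto; [|exfalso; apply HD; exists h; auto].
    apply csat_app; split; auto; apply csat_asms; intros J HJ1.
    rewrite <- G0; apply Js_g; auto; lra. }
  assert (Nf : forall h, In h (asms Ga ++ Js ++ q :: p :: Da) -> nodiff (ffv h)).
  { intros h Hh n Hn; apply (Nd n), in_or_app; left; apply in_flat_map; eauto. }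
  assert (Ne : nodiff (flat_map (fun xe => tfv (snd xe)) ode)).
  { intros n Hn; apply (Nd n), in_or_app; auto. }
  assert (Z : forall h u, In h (asms Ga ++ Js ++ q :: p :: Da) ->
            dsem h (zero_diffs u) <-> dsem h u).
  { intros h u Hh; apply dsem_agree, zero_diffs_agree, Nf, Hh. }
  assert (K : forall t, exists u, 0 <= t <= T ->
     dsem p' u /\ (forall n, In (V n) (ffv p) -> u (V n) = g t (V n)) /\
     (forall n, In (V n) (odevars ode) ->
        exists e, In (n, e) ode /\ u (D n) = teval e (g t)) /\
     (forall n, ~ In (V n) (odevars ode) -> u (D n) = 0)).
  { intros t; destruct (classic (0 <= t <= T)) as [Ht|Ht];
      [|exists w; intros; tauto].
    assert (Hr : drun (PODE ode q) w (g t)) by (eapply flow_run; eauto).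
    destruct (abstraction_run_sound w (g t) Ab Hw (bound_effect _ _ _ Hr))
      as (u' & O & HG & HD').
    destruct (V2 (zero_diffs u')) as (h & [<-|Hh] & Hv).
    - rewrite !csat_app; split; [|split].
      + intros h Hh; apply Z; [apply in_or_app; auto|now apply HG].
      + apply csat_asms; intros J HJ1; apply Z; [rewrite !in_app_iff; auto|].
        apply (abstraction_dsem J Ab O); auto.
        apply incl_appr; eapply incl_tran; [apply incl_dvars|]; eauto.
      + apply csat_cons; split; [|apply csat_nil].
        apply Z; [rewrite !in_app_iff; simpl; auto|].
        apply (abstraction_dsem q Ab O); auto.
        simpl; intros z Hz; rewrite !in_app_iff; auto.
    - destruct (diff_assigns_sem _ _ _ Ne Hv) as (u & Hu & EV & ED & EN).
      exists u; intros _; split; [auto|]; split; [|split].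
      + intros n Hn; rewrite EV; apply O; intros I.
        destruct (abstraction_notin _ Ab I) as (_ & Nm).
        now apply Nm, Ip, fv_incl_vars.
      + intros n Hn; destruct (ED n Hn) as (e & Ie & ->); exists e; split; auto.
        rewrite (teval_agree e (zero_diffs u') u').
        * apply teval_agree; intros z Hz; apply O; intros I.
          destruct (abstraction_notin _ Ab I) as (Na & _); apply Na.
          simpl; rewrite !in_app_iff; right; right; left; apply in_flat_map.
          exists (n, e); auto.
        * apply zero_diffs_agree; intros m Hm; apply (Ne m), in_flat_map.
          exists (n, e); auto.
      + intros n Hn; now rewrite EN.
    - exfalso; apply HD, HD'; exists h; split; auto; apply Z; auto.
      rewrite !in_app_iff; simpl; auto. }
  (* The induction step yields a state with stored velocities for each time separately; choice makes
     them a function of time for [diff_invariant]. *)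
  apply functional_choice in K as (u & K).
  rewrite <- G0 in Hp0.
  apply (diff_invariant p p' T g u); auto.
  - intros t Ht; apply (along_flow G ode q Js (fdifferentiable p) w T g); auto.
  - apply Nf; rewrite !in_app_iff; simpl; auto.
  - intros t Ht [n|n] Hn; [now apply (K t Ht)|].
    exfalso; apply (Nf p) in Hn; auto; rewrite !in_app_iff; simpl; auto.
  - intros t n Ht Hn; destruct (K t Ht) as (_ & _ & ED & EN).
    destruct Hg as (_ & (_ & Hs) & _); destruct (Hs t Ht) as (Hd & Hc).
    destruct (in_dec var_eq_dec (V n) (odevars ode)) as [I|I].
    + destruct (ED n I) as (e & Ie & Ee).
      eapply D_in_ext; [reflexivity| |apply (Hd n e Ie)]; simpl; auto.
    + eapply D_in_ext; [reflexivity| |apply D_in_const_on with (c := w (V n))]; auto.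
      * symmetry; auto.
      * intros s Hs'; now apply (Hs s Hs').
  - intros t Ht; apply (K t Ht).
Qed.

Lemma ode_finally_sound ode q f ys more H G Dl Ha Ga Da Js :
  abstraction (PODE ode q) ys more H G Dl Ha Ga Da ->
  incl (dvars Js) more -> incl (fvars tfv f) more ->
  valid (Ga ++ map asm Js ++ [asm q]) (f :: Da) -> ivalid G Js (PODE ode q) f Dl.
Proof.
  intros Ab IJ If V w Hw HJ; apply some_true_cons.
  destruct (classic (some_true Dl w)) as [HD|HD]; auto; left; intros u Hu.
  destruct (abstraction_run_sound w u Ab Hw (bound_effect _ _ _ Hu)) as (u' & O & HG & HD').
  destruct (V u') as (g & [<-|Hg] & Hg').
  - rewrite !csat_app; split; [auto|split].
    + apply csat_asms; intros J HJ1; apply (abstraction_dsem J Ab O).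
      * apply incl_appr; eapply incl_tran; [apply incl_dvars|]; eauto.
      * apply (HJ J HJ1); exact Hu.
    + apply csat_cons; split; [|apply csat_nil].
      apply (abstraction_dsem q Ab O).
      * simpl; intros z Hz; rewrite !in_app_iff; auto.
      * destruct Hu as (T & h & Hh & Hq & ->); apply Hq.
        destruct Hh as (HT & _); lra.
  - apply (abstraction_dsem f Ab O); auto; now apply incl_appr.
  - exfalso; apply HD, HD'; exists g; auto.
Qed.

Lemma ghost_sound H G Js ode q f Dl y t t' :
  fresh [V y; D y] H G (FBox (PODE ode q) f :: Js ++ Dl) (tfv t) ->
  linear_in (V y) t' -> nodiff (tfv t') -> along G ode q Js (tdef t') ->
  ivalid (G ++ [asm (FCmp EQ (TVar (V y)) t)]) Js (PODE (ode ++ [(y, t')]) q) f Dl ->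
  ivalid G Js (PODE ode q) f Dl.
Proof.
  intros Fr Lin Nd Al Val w Hw HJ; apply some_true_cons.
  destruct (classic (some_true Dl w)) as [HD|HD]; auto; left.
  destruct (fresh_notin _ _ _ _ _ (V y) Fr) as (FG & FD & Ft); [simpl; auto|].
  rewrite dvars_cons in FD; simpl in FD; unfold dvars in FD.
  rewrite flat_map_app, !in_app_iff in FD.
  assert (Fo : ~ In (V y) (odevars ode)) by tauto.
  assert (Fe : forall x e, In (x, e) ode -> ~ In (V y) (tfv e)).
  { intros x e I J; apply FD; left; left; right; right; left.
    apply in_flat_map; exists (x, e); auto. }
  assert (F1 : forall p u v, agree_off [V y] u v -> ~ In (V y) (fvars tfv p) ->
             dsem p u -> dsem p v).
  { intros p u v O N; rewrite (dsem_agree_off [V y] p u v O); auto.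
    intros x [<-|[]]; auto. }
  set (w1 := upd w (V y) (teval t w)).
  assert (O1 : agree_off [V y] w1 w) by apply agree_off_upd.
  destruct (Val w1) as (h & [<-|Hh] & Hv).
  - apply csat_snoc; split.
    + eapply (csat_agree_off [V y]); eauto; intros x [<-|[]]; auto.
    + unfold dsem, w1; simpl; now rewrite upd_same, teval_upd_notin.
  (* The invariants are known for the original system but needed for the extended one, so a run of
     the latter is projected; [J] does not see the ghost. *)
  - intros J IJ v (T & g & Hg & Hq & ->); change (dsem J (g T)).
    set (h := fun s => upd (g s) (V y) (w (V y))).
    assert (Oh : forall s, agree_off [V y] (h s) (g s)) by (intros; apply agree_off_upd).
    assert (Hq' : forall s, 0 <= s <= T -> dsem q (h s)).
    { intros s Hs; eapply F1; [apply agree_off_sym, Oh|tauto|now apply Hq]. }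
    assert (Hh : ode_flow ode w T h).
    { apply (ghost_project ode y t' Fo Fe Lin Nd w (teval t w)); auto.
      intros S HS Hf; apply (along_flow G ode q Js (tdef t') w S h); auto; try lra.
      intros s Hs; apply Hq'; lra. }
    apply (F1 J (h T) (g T)); auto.
    + intros I; apply FD; right; left; apply in_flat_map; eauto.
    + apply (HJ J IJ); eapply flow_run; eauto; destruct Hg; lra.
  (* The goal goes the other way: a run of the original system is lifted, with the ghost starting at
     the value of [t]. *)
  - intros v (T & g & Hg & Hq & ->); change (dsem f (g T)).
    destruct (ghost_extend ode y t' Fo Fe Lin Nd w (teval t w) T g Hg) as (Z & HZ).
    { apply (along_flow G ode q Js (tdef t') w T g); auto. }
    assert (Oz : forall s, agree_off [V y] (upd (g s) (V y) (Z s)) (g s))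
      by (intros; apply agree_off_upd).
    apply (F1 f _ _ (Oz T)); [tauto|].
    apply Hv.
    apply (flow_run _ q w1 T (fun s => upd (g s) (V y) (Z s)) T); auto.
    + intros s Hs; eapply F1; [apply agree_off_sym, Oz|tauto|now apply Hq].
    + destruct Hg; lra.
  - exfalso; apply HD; eapply (some_true_agree_off [V y]);
      [apply agree_off_sym, O1| |exists h; split; eauto].
    intros x [<-|[]]; unfold dvars; tauto.
Qed.

(** * Soundness of the calculus *)

Lemma conv_sound p q w : conv p q -> dsem q w -> dsem p w.
Proof.
  unfold dsem; destruct 1; simpl; intros H; try tauto.
  - intros v (u & Hu & Hv); exact (H u Hu v Hv).
  - destruct H as (u & Hu & v & Hv & Hp); exists v; split; [exists u|]; auto.
  - intros r; apply H; eauto.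
  - destruct H as (v & (r & ->) & H); eauto.
  - destruct (classic (fsem absurd_atom p w)); auto.
  - exists w; tauto.
  - intros K; destruct H as (r & H); auto.
  - intros (r & K); exact (H r K).
  - intros K; destruct H as (v & Hv & H); auto.
  - intros (v & Hv & K); exact (H v Hv K).
Qed.

Scheme check_mut := Minimality for check Sort Prop
  with ipcheck_mut := Minimality for ipcheck Sort Prop.
Combined Scheme check_ipcheck_ind from check_mut, ipcheck_mut.

Lemma valid_conv G p q Dl :
  (forall w, dsem q w -> dsem p w) -> valid G (q :: Dl) -> valid G (p :: Dl).
Proof.
  intros H V w Hw; specialize (V w Hw); rewrite some_true_cons in *.
  destruct V; auto.
Qed.

Lemma valid_pmatch H G p e G1 Dl : pmatch H G p e = Some G1 -> valid G1 Dl -> valid G Dl.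
Proof. intros E V w Hw; apply V; eapply pmatch_csat; eauto. Qed.

Section Soundness.
  Variables (Sigma : dfml -> Prop) (auto_m : list dfml -> dfml -> Prop).
  Hypothesis Sigma_valid : forall f, Sigma f -> dvalid f.
  Hypothesis auto_sound : forall F f, auto_m F f ->
     forall w, (forall g, In g F -> dsem g w) -> dsem f w.

  Lemma check_sound :
    (forall H G Dl s H', check Sigma auto_m H G Dl s H' -> valid G Dl) /\
    (forall H G Js a f Dl i, ipcheck Sigma auto_m H G Js a f Dl i -> ivalid G Js a f Dl).
  Proof.
    apply check_ipcheck_ind.
    - intros H H1 H' G f Dl x e p s1 s2 _ _ V1 _ V2 w Hw; apply V2, csat_snoc; split; auto.
      destruct (V1 w Hw) as (g & [<-|[]] & Hg); auto.
    - intros H H' G f Dl x r p s C _ V w Hw; apply V, csat_snoc; split; auto.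
      eapply fpcheck_sound; eauto.
    - intros H H' G G1 f Dl p e e' s _ E _; now apply valid_pmatch with (1 := E).
    - intros H H' G f Dl t tnow i e b s _ _ _ V w Hw; apply V.
      unfold csat; rewrite asms_app; simpl; now rewrite app_nil_r.
    - auto.
    - intros H H' G D1 f D2 p s _ _ V w Hw; specialize (V w Hw).
      rewrite some_true_app, some_true_cons; rewrite some_true_cons, some_true_app in V; tauto.
    - intros H H' G1 x f G2 Dl p s _ _ V w Hw; rewrite csat_app, csat_cons in Hw.
      specialize (V w); rewrite csat_app, some_true_cons in V.
      destruct V as [N|V]; try tauto; exfalso; exact (N (proj1 (proj2 Hw))).
    - intros; eapply show_sound; eauto.
    - intros H H' G G1 x p f g Dl s E _ V w Hw; apply some_true_cons.
      destruct (classic (dsem f w)) as [Hf|Hf]; [|left; left; exact Hf].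
      specialize (V w); rewrite csat_snoc, some_true_cons in V.
      destruct V as [V|V]; auto; [split; auto; eapply pmatch_csat; eauto|].
      left; right; exact V.
    - intros H H' G G1 x p f g Dl s E _ V w Hw; apply some_true_cons.
      destruct (classic (dsem f w)) as [Hf|Hf]; [|left; intros v (-> & K); tauto].
      specialize (V w); rewrite csat_snoc, some_true_cons in V.
      destruct V as [V|V]; auto; [split; auto; eapply pmatch_csat; eauto|].
      left; intros v (-> & _); exact V.
    - intros H H1 H2 G G1 f g Dl p s1 s2 E _ V1 _ V2 w Hw.
      assert (Hw' := pmatch_csat _ _ _ _ _ _ E Hw).
      specialize (V1 w Hw'); specialize (V2 w Hw'); rewrite some_true_cons in *.
      destruct V1 as [V1|]; auto; destruct V2 as [V2|]; auto; left; split; auto.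
    - intros H H1 G G1 f g Dl p s E _ V w Hw.
      assert (Hw' := pmatch_csat _ _ _ _ _ _ E Hw).
      specialize (V w Hw'); rewrite !some_true_cons in *.
      destruct V as [V|[V|V]]; auto; left; [left|right]; exact V.
    - intros H H1 H2 G G1 f g Dl p x s1 y s2 E _ V1 _ V2 w Hw.
      assert (Hw' := pmatch_csat _ _ _ _ _ _ E Hw).
      specialize (V1 w); specialize (V2 w).
      rewrite csat_snoc, some_true_cons in *.
      destruct (classic (some_true Dl w)) as [HD|HD]; auto; left; split;
        [destruct (classic (dsem f w)) | destruct (classic (dsem g w))];
        try (left; assumption); right; [change (dsem g w)|change (dsem f w)]; tauto.
    - intros H H' G b x e t f f' Dl s _ E _ V.
      eapply valid_conv; [|exact V]; intros w; now apply assign_sub_sound.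
    - intros; eapply assign_eq_sound; eauto.
    - intros; eapply assign_any_sound; eauto.
    - intros H H' G x e t f f' Dl s _ E _ V.
      eapply valid_conv; [|exact V]; intros w Hw.
      rewrite (fsubst_sound _ _ _ _ E), subst_state_one in Hw.
      eexists; split; [eexists; reflexivity|exact Hw].
    - intros H H1 H2 G G1 a b f Dl p s1 s2 E _ V1 _ V2 w Hw.
      assert (Hw' := pmatch_csat _ _ _ _ _ _ E Hw).
      specialize (V1 w Hw'); specialize (V2 w Hw'); rewrite some_true_cons in *.
      destruct V1 as [V1|]; auto; destruct V2 as [V2|]; auto; left.
      intros v [Hv|Hv]; [now apply V1|now apply V2].
    - intros H H1 G G1 a b f Dl p s E _ V w Hw.
      assert (Hw' := pmatch_csat _ _ _ _ _ _ E Hw).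
      specialize (V w Hw'); rewrite !some_true_cons in *.
      destruct V as [(v & Hv & K)|[(v & Hv & K)|V]]; auto; left; exists v;
        (split; [|exact K]); [left|right]; exact Hv.
    - intros H H1 H2 G G1 a f g Dl p s1 s2 E _ V1 _ V2 w Hw.
      assert (Hw' := pmatch_csat _ _ _ _ _ _ E Hw).
      specialize (V1 w Hw'); specialize (V2 w Hw'); rewrite some_true_cons in *.
      destruct V1 as [V1|]; auto; destruct V2 as [V2|]; auto; left.
      intros v Hv; split; [now apply V1|now apply V2].
    - intros H H1 H2 G G1 a f Dl p s1 s2 E _ V1 _ V2 w Hw.
      assert (Hw' := pmatch_csat _ _ _ _ _ _ E Hw).
      specialize (V1 w Hw'); specialize (V2 w Hw'); rewrite some_true_cons in *.
      destruct V1 as [V1|]; auto; destruct V2 as [V2|]; auto; left.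
      intros v Hv; apply clos_rt_rt1n in Hv; destruct Hv as [|u v Hu Hv]; auto.
      apply (V2 u Hu); now apply clos_rt1n_rt.
    - intros H H1 G G1 a f Dl p s E _ V w Hw.
      assert (Hw' := pmatch_csat _ _ _ _ _ _ E Hw).
      specialize (V w Hw'); rewrite !some_true_cons in *.
      destruct V as [V|[(u & Hu & v & Hv & K)|V]]; auto; left.
      + exists w; split; [apply rt_refl|exact V].
      + exists v; split; [|exact K]; eapply rt_trans; [apply rt_step, Hu|exact Hv].
    - intros H Hp Hpa H' G Ga b a e p f Dl Da ys s1 s2 _ _ V1 Ab _ V2.
      eapply after_sound; eauto; intros z Hz; rewrite !in_app_iff; auto.
    - intros; eapply solve_box_sound; eauto.
    - intros; eapply solve_dia_sound; eauto.
    - intros; eapply variant_sound; eauto.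
    - intros H G a f Dl i _ V w Hw; apply V; auto; intros J [].
    - intros H H' G f g Dl s Cv _ V; eapply valid_conv; [|exact V].
      intros w; now apply conv_sound.
    - intros H H1 H2 Ha G Ga Js a f Dl Da x e p ys s1 s2 i _ Ab _ V1 _ V2 _ V3.
      eapply loop_inv_sound; eauto; intros z Hz; rewrite !in_app_iff; auto.
    - intros H H1 Ha G Ga Js a f Dl Da ys s Ab _ V.
      eapply loop_finally_sound; eauto; intros z Hz; rewrite !in_app_iff; auto.
    - intros H H1 H2 Ha G Ga Js ode q f Dl Da x e p p' ys s1 s2 i _ Ep Ab Al Nd
        _ V1 _ V2 _ V3.
      eapply ode_inv_sound; eauto; intros z Hz; rewrite !in_app_iff; auto.
    - intros H H1 Ha G Ga Js ode q f Dl Da ys s Ab _ V.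
      eapply ode_finally_sound; eauto; intros z Hz; rewrite !in_app_iff; auto.
    - intros; eapply ghost_sound; eauto.
  Qed.
End Soundness.

(** * Nominalization *)

Lemma map_pair_id {X Y} (l : list (X * Y)) : map (fun xe => (fst xe, snd xe)) l = l.
Proof. induction l as [|[] l IH]; simpl; congruence. Qed.

Lemma clos_rt_iff {X} (P Q : X -> X -> Prop) :
  (forall x y, P x y <-> Q x y) ->
  forall x y, clos_refl_trans X P x y <-> clos_refl_trans X Q x y.
Proof.
  intros E x y; split; induction 1;
    [apply rt_step, E; auto|apply rt_refl|eapply rt_trans; eauto|
     apply rt_step, E; auto|apply rt_refl|eapply rt_trans; eauto].
Qed.

Lemma lift_sem (I : sname -> state) :
  (forall (p : dfml) w, fsem I (flift p) w <-> dsem p w) /\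
  (forall (a : dprog) w v, psem I (plift a) w v <-> drun a w v).
Proof.
  unfold flift, plift, dsem, drun; apply fml_prog_ind; simpl; try tauto.
  - intros p IHp q IHq w; now rewrite IHp, IHq.
  - intros p IHp q IHq w; now rewrite IHp, IHq.
  - intros p IHp w; now rewrite IHp.
  - intros x p IHp w; split; intros H r; now apply IHp.
  - intros x p IHp w; split; intros (r & H); exists r; now apply IHp.
  - intros a IHa p IHp w; split; intros H v Hv; apply IHp, H, IHa, Hv.
  - intros a IHa p IHp w; split; intros (v & Hv & H); exists v;
      (split; [now apply IHa|now apply IHp]).
  - intros p IHp w v; now rewrite IHp.
  - intros a IHa b IHb w v; split; intros (u & H1 & H2); exists u;
      (split; [now apply IHa|now apply IHb]).
  - intros a IHa b IHb w v; now rewrite IHa, IHb.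
  - intros a IHa w v; now apply clos_rt_iff.
  - intros ode q IHq w v; rewrite map_pair_id.
    split; intros (T & f & Hf & Hq & E); exists T, f; repeat split; try apply Hf; auto;
      intros t Ht; apply IHq; auto.
Qed.

(** Ghosts require the second claim: the nominalization for the extended system
    begins with that system, so only its remainder can be compared. *)
Lemma nom_runs a s r : nom a s r ->
  (forall I w v, psem I r w v -> drun a w v) /\
  (forall c b i c' r', loop_or_ode c -> a = PSeq c b -> s = SInv i -> r = PSeq c' r' ->
     forall I w v, psem I r' w v -> drun b w v).
Proof.
  induction 1 as
    [a t s r _ [IH _]|a q ps fs m|a b s|a s _|a p s|a x p s1 s2 r _ [IH _]
    |a p e s r _ [IH _]|a t i e s r _ [IH _]|a x f s r _ [IH _]
    |p a x pt s r _ [IH _]|x t a e s r _ [IH _]|x a s r _ [IH _]|x a e s r _ [IH _]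
    |ode q a s r _ [IH _]|ode q a e s1 s r _ [IH _]
    |a b s1 p s2 r1 r2 _ [IH1 _] _ [IH2 _]|c b x p s1 s2 i r Lc _ [IH IH']
    |c b s r Lc _ [IH _]|ode q a y e e' t' i r _ [_ IH]];
    (split; [|try (intros; discriminate)]).
  - intros I w v (u & (-> & _) & Hv); eauto.
  - intros I w v; apply lift_sem.
  - intros I w v; apply lift_sem.
  - intros I w v; apply lift_sem.
  - intros I w v; apply lift_sem.
  - exact IH.
  - exact IH.
  - exact IH.
  - exact IH.
  - intros I w v (u & (-> & Hp) & Hv); exists w; split; [|eapply IH; eauto].
    split; auto; now apply (proj1 (lift_sem I)).
  - intros I w v (u & Hu & Hv); exists u; split; [exact Hu|eapply IH; eauto].
  - intros I w v (u & Hu & Hv); exists u; split; [exact Hu|eapply IH; eauto].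
  - intros I w v (u & Hu & Hv); exists u; split; [exact Hu|eapply IH; eauto].
  - intros I w v (u & Hu & Hv); exists u; split; [|eapply IH; eauto].
    now apply (proj2 (lift_sem I)).
  - intros I w v (u & Hu & Hv); exists u; split; [|eapply IH; eauto].
    now apply (proj2 (lift_sem I)).
  - intros I w v (u & Hu & Hv); exists u; split; [eapply IH1|eapply IH2]; eauto.
  - exact IH.
  - intros c0 b0 i0 c' r' L0 E _ Er; injection E as <- <-.
    eapply IH'; eauto.
  - intros I w v (u & Hu & Hv); exists u; split; [|eapply IH; eauto].
    now apply (proj2 (lift_sem I)).
  (* The second claim originates here, where the remainder is the nominalization of [b]; invariant
     and ghost steps only pass it on. *)
  - intros c0 b0 i0 c' r' _ E _ Er; injection E as <- <-; injection Er as <- <-.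
    exact IH.
  - intros I w v (u & Hu & Hv); exists u; split; [now apply (proj2 (lift_sem I))|].
    refine (IH _ _ _ _ _ _ eq_refl eq_refl eq_refl I u v Hv); exact Logic.I.
  - intros c0 b0 i0 c' r' _ E _ Er; injection E as <- <-; injection Er as <- <-.
    refine (IH _ _ _ _ _ _ eq_refl eq_refl eq_refl); exact Logic.I.
Qed.

Theorem theorem7p10
  (Sigma : dfml -> Prop) (auto : list dfml -> dfml -> Prop)
  (Sigma_valid : forall f, Sigma f -> dvalid f)
  (auto_sound : forall F f, auto F f ->
     forall w, (forall g, In g F -> dsem g w) -> dsem f w)
  (H H' : trace) (G : ctx) (a : dprog) (f : dfml) (s : sp) (r : hprog)
  (checks : check Sigma auto H G [FBox a f] s H')
  (nominalizes : nom a s r)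
  (eta : dtrace) (I : sname -> state)
  (eta_ok : dtrace_ok eta) (I_eta : interp_of eta I) :
  hvalid I G (FBox r (flift f)).
Proof.
  intros w Hw v Hv; apply (proj1 (lift_sem I)).
  destruct (proj1 (check_sound _ _ Sigma_valid auto_sound) _ _ _ _ _ checks w)
    as (g & [<-|[]] & Hg).
  - intros p Hp; apply (proj1 (lift_sem I)); auto.
  - apply Hg; now apply (proj1 (nom_runs _ _ _ nominalizes) I).
Qed.
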